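(* Let $\mathcal{T}$ be a compact $3$-manifold triangulation built from $n$ tetrahedra, with vertices $V_1,\ldots,V_m$. Suppose we are given the quadrilateral solution set for $\mathcal{T}$, consisting of the $k$ vectors $\mathbf{q}_1,\ldots,\mathbf{q}_k\in\mathbb{R}^{3n}$. Then the following algorithm computes the standard solution set for $\mathcal{T}$. Construct lists (finite sets) of vectors $L_0,L_1,\ldots,L_m\subset\mathbb{R}^{7n}$ as follows. 1. Fill the list $L_0$ with the canonical extensions $\varepsilon(\mathbf{q}_1),\ldots,\varepsilon(\mathbf{q}_k)\in\mathbb{R}^{7n}$. 2. Create a set of coordinate positions $C\subseteq\{1,2,\ldots,7n\}$, initialised to the set of all quadrilateral coordinate positions, $C=\{5,6,7,\,12,13,14,\,\ldots,\,7n-2,7n-1,7n\}$. 3. For each $r=1,2,\ldots,m$, fill the list $L_r$ as follows. (a) For each $\mathbf{x}\in L_{r-1}$, insert the partial canonical part $\kappa_v^{(r)}(\mathbf{x})$ into $L_r$. (b) Insert the negative vertex link $-\ell(V_r)$ into $L_r$. (c) Let $T_r=\{p\mid \ell(V_r)_p\neq 0\}\subset\{1,\ldots,7n\}$ be the set of coordinate positions corresponding to triangular disc types in $\ell(V_r)$. For each position $p\in T_r$ perform the following steps. (i) Partition $L_r$ into $S_0=\{\mathbf{x}\in L_r\mid x_p=0\}$, $S_+=\{\mathbf{x}\in L_r\mid x_p>0\}$ and $S_-=\{\mathbf{x}\in L_r\mid x_p<0\}$. (ii) Create a new temporary list $L'=S_0\cup S_+$. (iii) Run through all pairs $\mathbf{u}\in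 S_+$, $\mathbf{w}\in S_-$ satisfying both of the following conditions: (A) $\mathbf{u}$ and $\mathbf{w}$ together satisfy the quadrilateral constraints, that is, for each tetrahedron $\Delta_i$ of $\mathcal{T}$, at least two of the three quadrilateral coordinates for $\Delta_i$ are zero in both $\mathbf{u}$ and $\mathbf{w}$ simultaneously; (B) there is no vector $\mathbf{z}\in L_r$ other than $\mathbf{u}$ and $\mathbf{w}$ for which, whenever a coordinate position $i\in C$ satisfies both $u_i=0$ and $w_i=0$, then $z_i=0$ also. For each such pair, insert the vector $(u_p\mathbf{w}-w_p\mathbf{u})/(u_p-w_p)$ into $L'$. (iv) Empty out $L_r$ and refill it with the vectors in $L'$, and insert the position $p$ into the set $C$. (d) Finish the list by inserting the positive vertex link $\ell(V_r)$ into $L_r$. Suppose that the final list $L_m$ consists of the $k'$ vectors $\mathbf{v}_1,\ldots,\mathbf{v}_{k'}\in\mathbb{R}^{7n}$. Then the standard solution set for $\mathcal{T}$ consists of the $k'$ projective images $\overline{\mathbf{v}_1},\ldots,\overline{\mathbf{v}_{k'}}$.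
   Context: Triangulations. A compact $3$-manifold triangulation $\mathcal{T}$ is a finite collection of tetrahedra $\Delta_1,\ldots,\Delta_n$, some or all of whose $4n$ faces are affinely identified in pairs, such that the resulting topological space is a compact $3$-manifold (possibly with boundary). Different vertices (or edges, or faces) of the same tetrahedron may be identified. Vertices, edges and faces of $\mathcal{T}$ are equivalence classes of tetrahedron vertices, edges and faces. A face not identified with another is a boundary face; boundary edges are those lying in the boundary. Normal discs. In each tetrahedron there are seven normal disc types: four triangle types (each surrounding one vertex of the tetrahedron) and three quadrilateral types (each separating one pair of opposite edges). Vectors in $\mathbb{R}^{7n}$ are written $(t_{1,1},t_{1,2},t_{1,3},t_{1,4},q_{1,1},q_{1,2},q_{1,3};\ \ldots,q_{n,3})$, where $t_{i,j}$ corresponds to the $j$th triangle type and $q_{i,k}$ to the $k$th quadrilateral type in $\Delta_i$; positions are numbered $1,\ldots,7n$ in this order and $w_p$ is the coordinate of $\mathbf{w}$ in position $p$. Vectors in $\mathbb{R}^{3n}$ are written $(q_{1,1},q_{1,2},q_{1,3};\ldots,q_{n,3})$. Standard matching equations (on $\mathbb{R}^{7n}$): for each non-boundary face $F$ and each edge $e$ of $F$, let $\Delta_i,\Delta_j$ be the two tetrahedra joined along $F$. In each there is exactly one triangle type and one quadrilateral type meeting $F$ in an arc parallel to $e$; if these have coordinates $t_{i,a},q_{i,b}$ and $t_{j,c},q_{j,d}$, the equation is $t_{i,a}+q_{i,b}=t_{j,c}+q_{j,d}$. Quadrilateral matching equations (on $\mathbb{R}^{3n}$): for each non-boundary edge $e$,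 the tetrahedra containing $e$ are arranged in a cycle $\Delta_{i_1},\ldots,\Delta_{i_k}$ around $e$. Choose a direction around the cycle and label the ends of $e$ upper and lower. In each of these tetrahedra two quadrilateral types meet $e$: the upward one, rising from the lower end to the upper end as we move around the cycle (it cuts off the lower end of $e$ in the face through which we enter the tetrahedron and the upper end in the face through which we leave), and the downward one, falling in the opposite direction. With upward coordinates $q_{i_1,u_1},\ldots,q_{i_k,u_k}$ and downward coordinates $q_{i_1,d_1},\ldots,q_{i_k,d_k}$, the equation is $\sum_s q_{i_s,u_s}=\sum_s q_{i_s,d_s}$. Quadrilateral constraints (on $\mathbb{R}^{7n}$ or $\mathbb{R}^{3n}$): for each $i$, at most one of $q_{i,1},q_{i,2},q_{i,3}$ is non-zero. A vector in $\mathbb{R}^{7n}$ (resp. $\mathbb{R}^{3n}$) is admissible if its entries are non-negative, it satisfies the standard (resp. quadrilateral) matching equations, and it satisfies the quadrilateral constraints. Solution sets. The standard projective solution space $\mathscr{S}(\mathcal{T})\subset\mathbb{R}^{7n}$ (resp. quadrilateral projective solution space $\mathscr{Q}(\mathcal{T})\subset\mathbb{R}^{3n}$) is the polytope of all vectors with non-negative coordinates summing to $1$ that satisfy the standard (resp. quadrilateral) matching equations. The standard (resp. quadrilateral) solution set is the finite set of all vertices of $\mathscr{S}(\mathcal{T})$ (resp. $\mathscr{Q}(\mathcal{T})$) that satisfy the quadrilateral constraints. The projective image of $\mathbf{x}\ne\mathbf{0}$ is $\overline{\mathbf{x}}=\mathbf{x}/\sum x_i$, and $\overline{\mathbf{0}}=\mathbf{0}$.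 Vertex links and canonical vectors. For a vertex $V$ of $\mathcal{T}$, $\ell(V)\in\mathbb{R}^{7n}$ is the vector with $1$ in each triangular coordinate whose disc type surrounds $V$ and $0$ elsewhere (the standard vector of the vertex link of $V$). A vector $\mathbf{w}\in\mathbb{R}^{7n}$ is canonical if for every vertex $V$, all triangular coordinates of $\mathbf{w}$ for disc types surrounding $V$ are $\ge 0$ and at least one of them equals $0$. The quadrilateral projection $\pi:\mathbb{R}^{7n}\to\mathbb{R}^{3n}$ deletes all triangular coordinates. For admissible $\mathbf{w}\in\mathbb{R}^{3n}$, the canonical extension $\varepsilon(\mathbf{w})$ is the unique admissible canonical vector in $\mathbb{R}^{7n}$ with $\pi(\varepsilon(\mathbf{w}))=\mathbf{w}$. For $\mathbf{w}\in\mathbb{R}^{7n}$, the $r$th partial canonical part is $\kappa_v^{(r)}(\mathbf{w})=\mathbf{w}-\lambda\,\ell(V_r)$, where $\lambda\in\mathbb{R}$ is the largest scalar for which all coordinates of $\mathbf{w}-\lambda\ell(V_r)$ corresponding to triangular disc types surrounding $V_r$ are non-negative. *)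

(* Defs.v *)
From HB Require Import structures.
From Stdlib Require Import Relation_Operators.
From mathcomp Require Import all_boot all_order all_fingroup all_algebra.
From mathcomp Require Import finmap.
From mathcomp Require Import all_classical all_reals.
From mathcomp Require Import topology normedtype.

Set Implicit Arguments.
Unset Strict Implicit.
Unset Printing Implicit Defensive.

Import Order.TTheory GRing.Theory Num.Theory.
Import numFieldNormedType.Exports.

Local Open Scope classical_set_scope.
Local Open Scope ring_scope.

(** * Gluings of tetrahedra *)

(* The vertices of each tetrahedron are numbered by 'I_4, and face f is the
   face opposite vertex f.  [glue i f = Some (j, s)] means that face f of
   tetrahedron i is identified with face [s f] of tetrahedron j by the affine
   map sending each vertex [a != f] of the former to the vertex [s a] of the
   latter; the value of s at f only records the target face.
   [glue i f = None] means that the face is a boundary face. *)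
Record gluing (n : nat) := Gluing {
  glue : 'I_n -> 'I_4 -> option ('I_n * 'S_4);
  glue_sym : forall i f j s,
    glue i f = Some (j, s) -> glue j (s f) = Some (i, s^-1%g);
  glue_irrefl : forall i f j s, glue i f = Some (j, s) -> (j, s f) <> (i, f)
}.

(** * The underlying topological space *)

Section Realization.
Context (R : realType) (n : nat) (T : gluing n).

(* Points of a tetrahedron are given by their barycentric coordinates. *)
Definition simplex : set 'rV[R]_4 :=
  [set x | (forall a, 0 <= x 0 a) /\ \sum_a x 0 a = 1].

Definition pieces : topologicalType := {i : 'I_n & set_type simplex}.

Definition bary (x : pieces) (a : 'I_4) : R := set_val (tagged x) 0 a.

Definition glued (x y : pieces) : Prop :=
  exists f s, [/\ glue T (tag x) f = Some (tag y, s), bary x f = 0 &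
    forall a, bary y (s a) = bary x a].

Definition same_point (x y : pieces) : bool :=
  `[< clos_refl_sym_trans pieces glued x y >].

Lemma same_point_refl : reflexive same_point.
Proof. by move=> x; apply/asboolP; exact: rst_refl. Qed.

Lemma same_point_sym : symmetric same_point.
Proof. by move=> x y; apply/asboolP/asboolP; exact: rst_sym. Qed.

Lemma same_point_trans : transitive same_point.
Proof.
by move=> y x z /asboolP xy /asboolP yz; apply/asboolP; exact: rst_trans yz.
Qed.

Canonical same_point_equiv :=
  EquivRel same_point same_point_refl same_point_sym same_point_trans.

Definition realization : topologicalType :=
  quotient_topology {eq_quot same_point}%qT.

End Realization.

Definition homeomorphic (X Y : topologicalType) : Prop :=
  exists (f : X -> Y) (g : Y -> X),
    [/\ continuous f, continuous g, cancel f g & cancel g f].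

Definition half_space (R : realType) : set 'rV[R]_3 :=
  [set v | 0 <= v 0 ord_max].

(* Compact topological 3-manifold, possibly with boundary. *)
Definition compact_3manifold (R : realType) (X : topologicalType) : Prop :=
  [/\ compact [set: X], hausdorff_space X, @second_countable X &
    forall x : X, exists (U : set X) (W : set 'rV[R]_3),
      [/\ open U, U x, open W &
        homeomorphic (set_type U) (set_type (W `&` @half_space R))]].

(** * Vertices and normal discs *)

Notation corner n := ('I_n * 'I_4)%type.

Definition corner_adj n (T : gluing n) : rel (corner n) := fun c d =>
  [exists f, (f != c.2) &&
    (if glue T c.1 f is Some (j, s) then d == (j, s c.2) else false)].

(* [corner_adj] is symmetric by [glue_sym], so [connect] is the equivalence
   relation it generates. *)
Definition vertices n (T : gluing n) : {set {set corner n}} :=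
  [set [set d | connect (corner_adj T) c d] | c : corner n]%SET.

(* A vector of R^(7n) is an n x (4 + 3) matrix, whose row i is
   (t_{i,1}, ..., t_{i,4}, q_{i,1}, q_{i,2}, q_{i,3}); a vector of R^(3n) is an
   n x 3 matrix.  Reading the entries row by row gives the usual order. *)
Notation stdvec R n := 'M[R]_(n, 4 + 3).
Notation quadvec R n := 'M[R]_(n, 3).
Notation position n := ('I_n * 'I_(4 + 3))%type.

(* Triangle type a surrounds vertex a of its tetrahedron. *)
Definition tri (a : 'I_4) : 'I_(4 + 3) := lshift 3 a.
Definition quad (k : 'I_3) : 'I_(4 + 3) := rshift 4 k.

(* The quadrilateral type separating the vertices a, b (for a != b) from the
   other two: types 0, 1, 2 are 01|23, 02|13, 03|12. *)
Definition quad_of (a b : 'I_4) : 'I_3 := inord (minn (a + b) (6 - (a + b))).-1.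

Lemma quad_of_opp (a b c d : 'I_4) :
  uniq [:: a; b; c; d] -> quad_of a b = quad_of c d.
Proof.
move=> abcd; rewrite /quad_of; congr inord; move: abcd.
by case: a b c d => [[|[|[|[|a]]]] ?] [[|[|[|[|b]]]] ?] [[|[|[|[|c]]]] ?]
  [[|[|[|[|d]]]] ?].
Qed.

Lemma quad_of_inj (a b c : 'I_4) :
  a != b -> a != c -> quad_of a b = quad_of a c -> b = c.
Proof.
move=> ab ac /(congr1 val); rewrite /quad_of => E; apply/val_inj; move: ab ac E.
by case: a b c => [[|[|[|[|a]]]] ?] [[|[|[|[|b]]]] ?] [[|[|[|[|c]]]] ?] //= _ _;
  rewrite !inordK.
Qed.

(** * Matching equations *)

(* A step of a walk around an edge: a tetrahedron F.1 with its vertices ordered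
   as the lower end of the edge, its upper end, the vertex opposite the face
   through which we enter, the vertex opposite the face through which we
   leave. *)
Notation flag n := ('I_n * 'S_4)%type.

Section Matching.
Context (R : realType) (n : nat) (T : gluing n).

(* An edge e of face f is given by the vertex c of f opposite to it: an arc of
   f parallel to e cuts c off from e, hence belongs to the triangle around c or
   to the quadrilateral separating c, f from the ends of e. *)
Definition std_matching (w : stdvec R n) : Prop :=
  forall i f j s, glue T i f = Some (j, s) -> forall c, c != f ->
    w i (tri c) + w i (quad (quad_of c f)) =
    w j (tri (s c)) + w j (quad (quad_of (s c) (s f))).

Definition lower (F : flag n) : 'I_4 := F.2 0.
Definition upper (F : flag n) : 'I_4 := F.2 1.
Definition entry (F : flag n) : 'I_4 := F.2 2.
Definition exit (F : flag n) : 'I_4 := F.2 3.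

Definition turn : rel (flag n) := fun F G =>
  if glue T F.1 (exit F) is Some (j, s) then
    [&& G.1 == j, lower G == s (lower F), upper G == s (upper F)
      & entry G == s (exit F)]
  else false.

(* The cycle of tetrahedra around a non-boundary edge, with a choice of a
   starting point, of a direction, and of an upper and a lower end.  Walking
   around a boundary edge stops at a boundary face, so that no such cycle
   arises. *)
Definition edge_cycle (c : seq (flag n)) : Prop := ucycle turn c.

(* The entered face, spanned by lower, upper and exit, loses its lower end to
   the upward quadrilateral, which thus separates {lower, entry} from
   {upper, exit}; it cuts off the upper end in the face that we leave. *)
Definition upward (F : flag n) : 'I_3 := quad_of (lower F) (entry F).
Definition downward (F : flag n) : 'I_3 := quad_of (upper F) (entry F).

Definition quad_matching (w : quadvec R n) : Prop :=
  forall c, edge_cycle c ->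
    \sum_(F <- c) w F.1 (upward F) = \sum_(F <- c) w F.1 (downward F).

End Matching.

(** * Solution sets *)

Section Solutions.
Context (R : realType) (n : nat) (T : gluing n).

Definition qproj (w : stdvec R n) : quadvec R n := rsubmx w.

Definition quad_constraints (w : quadvec R n) : Prop :=
  forall i, (#|[set k : 'I_3 | w i k != 0%R]%SET| <= 1)%N.

Definition std_admissible (w : stdvec R n) : Prop :=
  [/\ forall i j, 0 <= w i j, std_matching T w & quad_constraints (qproj w)].

Definition proj_simplex m : set 'M[R]_(n, m) :=
  [set w | (forall i j, 0 <= w i j) /\ \sum_i \sum_j w i j = 1].

Definition std_solution_space : set (stdvec R n) :=
  [set w | proj_simplex w /\ std_matching T w].

Definition quad_solution_space : set (quadvec R n) :=
  [set w | proj_simplex w /\ quad_matching T w].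

Definition polytope_vertices (V : lmodType R) (P : set V) : set V :=
  [set x | P x /\ forall y z (t : R), P y -> P z -> 0 < t < 1 ->
    x = t *: y + (1 - t) *: z -> y = z].

Definition std_solution_set : set (stdvec R n) :=
  [set w | polytope_vertices std_solution_space w /\
    quad_constraints (qproj w)].

Definition quad_solution_set : set (quadvec R n) :=
  [set w | polytope_vertices quad_solution_space w /\ quad_constraints w].

(* Since 0^-1 = 0, the projective image of 0 is 0. *)
Definition projective_image (w : stdvec R n) : stdvec R n :=
  (\sum_i \sum_j w i j)^-1 *: w.

Definition vlink (V : {set corner n}) : stdvec R n :=
  row_mx (\matrix_(i < n, a < 4) ((i, a) \in V)%:R) 0.

Definition canonical (w : stdvec R n) : Prop :=
  forall V, V \in vertices T ->
    (forall c, c \in V -> 0 <= w c.1 (tri c.2)) /\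
    (exists2 c, c \in V & w c.1 (tri c.2) = 0).

(* The vector is unique when w is admissible; [xget] returns 0 when there is
   none. *)
Definition canonical_ext (w : quadvec R n) : stdvec R n :=
  xget 0 [set x | [/\ std_admissible x, canonical x & qproj x = w]].

Definition link_scalars (V : {set corner n}) (w : stdvec R n) : set R :=
  [set l | forall c, c \in V -> 0 <= (w - l *: vlink V) c.1 (tri c.2)].

Definition largest (A : set R) : R := xget 0 (A `&` ubound A).

Definition partial_canonical (V : {set corner n}) (w : stdvec R n) :
    stdvec R n :=
  w - largest (link_scalars V w) *: vlink V.

End Solutions.

(** * The conversion algorithm *)

Section Algorithm.
Context (R : realType) (n : nat) (T : gluing n).
Implicit Types (L : {fset stdvec R n}) (C : {set position n}).

Definition quad_positions : {set position n} :=
  [set (i, quad k) | i in 'I_n, k in 'I_3]%SET.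

Definition link_positions (V : {set corner n}) : {set position n} :=
  [set p | vlink R V p.1 p.2 != 0]%SET.

Definition compatible (u w : stdvec R n) : bool :=
  [forall i, (2 <= #|[set k : 'I_3 | (qproj u i k == 0%R) &&
                                     (qproj w i k == 0%R)]%SET|)%N].

Definition zero_on_common_zeros C (u w z : stdvec R n) : bool :=
  [forall p in C, (u p.1 p.2 == 0) && (w p.1 p.2 == 0) ==> (z p.1 p.2 == 0)].

Definition adjacent C L (u w : stdvec R n) : bool :=
  ~~ has (fun z => [&& z != u, z != w & zero_on_common_zeros C u w z]) L.

Definition combine (p : position n) (u w : stdvec R n) : stdvec R n :=
  (u p.1 p.2 - w p.1 p.2)^-1 *: (u p.1 p.2 *: w - w p.1 p.2 *: u).

(* One iteration of the inner loop, for the position p; the state is (L, C). *)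
Definition position_step (s : {fset stdvec R n} * {set position n})
    (p : position n) : {fset stdvec R n} * {set position n} :=
  let: (L, C) := s in
  let S0 := [fset x in L | x p.1 p.2 == 0]%fset in
  let Sp := [fset x in L | 0 < x p.1 p.2]%fset in
  let Sm := [fset x in L | x p.1 p.2 < 0]%fset in
  ((S0 `|` Sp `|` [fset combine p u w | u in Sp,
      w in [fset w in Sm | compatible u w && adjacent C L u w]])%fset,
   (p |: C)%SET).

(* One iteration of the outer loop, for the vertex V; [order V] is the order in
   which the positions of triangles around V are processed. *)
Definition vertex_step (order : {set corner n} -> seq (position n))
    (s : {fset stdvec R n} * {set position n}) (V : {set corner n}) :
    {fset stdvec R n} * {set position n} :=
  let: (L, C) := s in
  let L1 := ([fset partial_canonical V x | x in L] `|` [fset - vlink R V])%fset in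
  let: (L2, C2) := foldl position_step (L1, C) (order V) in
  ((L2 `|` [fset vlink R V])%fset, C2).

Definition convert (vs : seq {set corner n})
    (order : {set corner n} -> seq (position n))
    (qs : {fset quadvec R n}) : {fset stdvec R n} :=
  (foldl (vertex_step order)
     ([fset canonical_ext T q | q in qs]%fset, quad_positions) vs).1.

End Algorithm.

(* Main.v *)
From Stdlib Require Import Relation_Operators.
Require Import Defs.
From mathcomp Require Import all_boot all_order all_fingroup all_algebra.
From mathcomp Require Import finmap.
From mathcomp Require Import all_classical all_reals.
From mathcomp Require Import topology normedtype.
From mathcomp Require Import lra.

Set Implicit Arguments.
Unset Strict Implicit.
Unset Printing Implicit Defensive.

Import Order.TTheory GRing.Theory Num.Theory.
Import numFieldNormedType.Exports.

Local Open Scope classical_set_scope.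
Local Open Scope ring_scope.

(** The proof has a topological and a polyhedral half.

    _Topology._ The manifold enters through one fact: each solution q of the
    quadrilateral matching equations lifts to a solution of the standard ones
    ([std_matching_exists]).  The triangle coordinates of a lift form a function on
    the corners whose change across each glued face is prescribed by q ([jump]).
    Such a function exists if and only if these changes add up to zero along each
    closed walk in each vertex link.  The equations of q only say so for the walks
    around a single vertex of a link, so that the obstruction is the first real
    cohomology of the link.  It vanishes for the following reason
    ([vertex_potential]).  Near a vertex of the triangulation, consider the
    locally constant functions on the points of the tetrahedra with the
    prescribed jumps.  By the equations of q they exist locally, except at the
    vertex itself ([jump_section_exists]), and they are unique up to constants
    ([jump_section_uniq]).  A chart carries this problem to a punctured cube or half
    cube of R^3.  There solutions exist over closed boxes, by Cousin's lemma
    ([section_box]), and can be glued along connected intersections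
    ([section_glue]), hence exist over a shell around the vertex
    ([section_shell]).  The shell contains a copy of the link, on the triangles of
    which the solution takes the required values.

    _Polyhedra._ Lists are described by zero sets.  A list is a ray basis for a set C of
    positions ([ray_basis]) if, among the extremal rays of the cone of the solutions
    that are nonnegative on C, it has exactly one member on each ray that satisfies the
    quadrilateral constraints, where vectors that vanish on C count as zero.  The
    initial list is a ray basis for the quadrilateral positions
    ([initial_basis]), treating the vertex V turns a ray basis for C into one for C and
    the positions around V ([vertex_step_basis]), and the projective images of a ray
    basis for all positions are the standard solution set
    ([solution_set_of_basis]).  Treating V is double description, one position at a
    time, except that the link l of V, which is a ray once one position has been processed, is
    left out until the end, and that the partial canonical parts x stay
    in the list although they are not extremal until they have a zero
    among the processed positions ([loop_invariant]).  These two deviations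
    compensate each other ([loop_step]): double description would combine l only
    with rays w that are the lowest point of a line x + R l, up to scaling, and the
    algorithm obtains the same ray by combining x with w. *)

Local Notation glue := Defs.glue.
Local Notation ev w p := (fun_of_matrix w p.1 p.2).

(** * Cousin's lemma *)

Section Cousin.
Context {R : realType}.

(** An additive property of intervals that holds for all small intervals around
    each point holds for [a, b]: the supremum of the t with Q a t is attained, and
    could be passed if it were less than b. *)
Lemma cousin (Q : R -> R -> Prop) (a b : R) : a <= b ->
  (forall x y z, x <= y -> y <= z -> Q x y -> Q y z -> Q x z) ->
  (forall t, a <= t <= b -> exists2 e, 0 < e & forall c d,
     a <= c -> c <= d -> d <= b -> `|c - t| < e -> `|d - t| < e -> Q c d) ->
  Q a b.
Proof.
move=> ab add loc.
pose S := [set t | a <= t <= b /\ Q a t].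
have Sa : S a.
  split; first by rewrite lexx.
  have [|e e0 He] := loc a; first by rewrite lexx.
  by apply: He; rewrite ?subrr ?normr0.
have Sub : has_sup S.
  by split; [exists a|exists b => t [/andP[]]].
pose m := sup S.
have am : a <= m by apply: ub_le_sup => //; case: Sub.
have mb : m <= b by apply: ge_sup; [exists a|move=> t [/andP[]]].
have [|e e0 He] := loc m; first by rewrite am.
have [s [/andP[as_ sb] Qs] sm] : exists2 s, S s & m - e < s.
  by apply: sup_adherent.
have sm' : s <= m by apply: ub_le_sup; [case: Sub|split=> //; rewrite as_].
pose t := Num.min b (m + e / 2).
have mt : m <= t by rewrite /t le_min mb /=; lra.
have tb : t <= b by rewrite /t ge_min lexx.
have te : t <= m + e / 2 by rewrite /t ge_min lexx orbT.
have Qt : Q a t.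
  apply: (add _ s) => //; first lra.
  apply: He => //; first lra.
    by rewrite ltr_norml; apply/andP; split; lra.
  by rewrite ltr_norml; apply/andP; split; lra.
have : t <= m.
  apply: ub_le_sup; [by case: Sub|split=> //].
  by apply/andP; split => //; lra.
rewrite {1}/t ge_min => /orP[bm|]; last by lra.
by have -> : b = t by lra.
Qed.

(** One coordinate at a time: for the outer coordinates fixed at a point, the
    inner property is required uniformly over small intervals around that point,
    which is again additive and local. *)
Lemma cousin3 (Q : R -> R -> R -> R -> R -> R -> Prop) (x1 x2 y1 y2 z1 z2 : R) :
  x1 <= x2 -> y1 <= y2 -> z1 <= z2 ->
  (forall a b c y y' z z', a <= b -> b <= c -> y <= y' -> z <= z' ->
    Q a b y y' z z' -> Q b c y y' z z' -> Q a c y y' z z') ->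
  (forall a b c x x' z z', a <= b -> b <= c -> x <= x' -> z <= z' ->
    Q x x' a b z z' -> Q x x' b c z z' -> Q x x' a c z z') ->
  (forall a b c x x' y y', a <= b -> b <= c -> x <= x' -> y <= y' ->
    Q x x' y y' a b -> Q x x' y y' b c -> Q x x' y y' a c) ->
  (forall x y z, x1 <= x <= x2 -> y1 <= y <= y2 -> z1 <= z <= z2 ->
   exists2 e, 0 < e & forall a a' b b' c c',
     x1 <= a -> a <= a' -> a' <= x2 -> y1 <= b -> b <= b' -> b' <= y2 ->
     z1 <= c -> c <= c' -> c' <= z2 ->
     `|a - x| < e -> `|a' - x| < e -> `|b - y| < e -> `|b' - y| < e ->
     `|c - z| < e -> `|c' - z| < e -> Q a a' b b' c c') ->
  Q x1 x2 y1 y2 z1 z2.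
Proof.
move=> x12 y12 z12 addx addy addz loc.
pose near e a a' x x1 x2 : Prop :=
  [/\ x1 <= a :> R, a <= a', a' <= x2, `|a - x| < e & `|a' - x| < e].
have near_le e e' a a' x u u' : e <= e' -> near e a a' x u u' -> near e' a a' x u u'.
  by move=> ee' [? ? ? h1 h2]; split => //; apply: lt_le_trans ee'.
have mgt (e e' : R) : 0 < e -> 0 < e' -> 0 < Num.min e e' by rewrite lt_min => -> ->.
have mle1 (e e' : R) : Num.min e e' <= e by rewrite ge_min lexx.
have mle2 (e e' : R) : Num.min e e' <= e' by rewrite ge_min lexx orbT.
have Hz x y : x1 <= x <= x2 -> y1 <= y <= y2 -> exists2 e, 0 < e &
    forall a a' b b', near e a a' x x1 x2 -> near e b b' y y1 y2 -> Q a a' b b' z1 z2.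
  move=> hx hy.
  apply: (@cousin (fun c c' => exists2 e, 0 < e & forall a a' b b',
    near e a a' x x1 x2 -> near e b b' y y1 y2 -> Q a a' b b' c c') z1 z2 z12).
    move=> u v w uv vw [e e0 He] [e' e'0 He']; exists (Num.min e e'); first exact: mgt.
    move=> a a' b b' na nb; apply: (addz _ v) => //; (try by case: na); (try by case: nb).
    - by apply: He; [exact: near_le (mle1 _ _) na|exact: near_le (mle1 _ _) nb].
    - by apply: He'; [exact: near_le (mle2 _ _) na|exact: near_le (mle2 _ _) nb].
  move=> z hz; have [e e0 He] := loc x y z hx hy hz; exists e => // c d *.
  by exists e => // a a' b b' [? ? ? ? ?] [? ? ? ? ?]; apply: He.
have Hy x : x1 <= x <= x2 -> exists2 e, 0 < e &
    forall a a', near e a a' x x1 x2 -> Q a a' y1 y2 z1 z2.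
  move=> hx.
  apply: (@cousin (fun b b' => exists2 e, 0 < e & forall a a',
    near e a a' x x1 x2 -> Q a a' b b' z1 z2) y1 y2 y12).
    move=> u v w uv vw [e e0 He] [e' e'0 He']; exists (Num.min e e'); first exact: mgt.
    move=> a a' na; apply: (addy _ v) => //; try by case: na.
    - by apply: He; exact: near_le (mle1 _ _) na.
    - by apply: He'; exact: near_le (mle2 _ _) na.
  move=> y hy; have [e e0 He] := Hz x y hx hy; exists e => // c d *.
  by exists e => // a a' na; apply: He.
apply: (@cousin (fun a a' => Q a a' y1 y2 z1 z2)) => //.
  by move=> u v w *; apply: (addx _ v).
by move=> x hx; have [e e0 He] := Hy x hx; exists e => // c d *; apply: He.
Qed.

End Cousin.

(** * Rigid regions and gluing of sections *)

Lemma between_near (R : realType) (a b w x e : R) :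
  a <= w <= b -> `|a - x| < e -> `|b - x| < e -> `|w - x| < e.
Proof.
rewrite !ltr_norml => /andP[aw wb] /andP[ax _] /andP[_ bx].
by apply/andP; split; lra.
Qed.

Section Boxes.
Context {R : realType}.
Notation Z := 'rV[R]_3.
Implicit Types (A B K N : set Z).

Definition point3 (x y z : R) : Z :=
  \row_i (if i == 0 then x else if i == 1 then y else z).

Lemma point3E (x y z : R) :
  (point3 x y z 0 0 = x) * (point3 x y z 0 1 = y) * (point3 x y z 0 ord_max = z).
Proof. by rewrite !mxE. Qed.

Lemma ord3_ind (Q : 'I_3 -> Prop) : Q 0 -> Q 1 -> Q ord_max -> forall i, Q i.
Proof.
move=> Q0 Q1 Q2 [[|[|[|i]]] hi] //.
- by have -> : Ordinal hi = 0 by exact: val_inj.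
- by have -> : Ordinal hi = 1 by exact: val_inj.
- by have -> : Ordinal hi = ord_max by exact: val_inj.
Qed.

Lemma nbhs_coord (z : Z) N : nbhs z N <-> exists2 e : R, 0 < e & forall w : Z,
  `|w 0 0 - z 0 0| < e -> `|w 0 1 - z 0 1| < e ->
  `|w 0 ord_max - z 0 ord_max| < e -> N w.
Proof.
split.
  move=> /nbhs_ballP[e e0 He]; exists e => // w w0 w1 w2; apply: He; split=> // i j.
  by rewrite ord1 /ball /=; elim/ord3_ind: j; rewrite distrC.
move=> [e e0 He]; apply/nbhs_ballP; exists e => // w [_ bw].
by apply: He; rewrite distrC; apply: bw.
Qed.

Definition box (x1 x2 y1 y2 z1 z2 : R) : set Z :=
  [set w | [/\ x1 <= w 0 0 <= x2, y1 <= w 0 1 <= y2 & z1 <= w 0 ord_max <= z2]].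

Lemma box_closed x1 x2 y1 y2 z1 z2 (z : Z) :
  ~ box x1 x2 y1 y2 z1 z2 z -> \forall w \near z, ~ box x1 x2 y1 y2 z1 z2 w.
Proof.
have sep (i : 'I_3) (l u : R) : ~~ (l <= z 0 i <= u) -> exists2 e : R, 0 < e &
    forall w : Z, `|w 0 i - z 0 i| < e -> ~~ (l <= w 0 i <= u).
  rewrite negb_and -!ltNge => /orP[h|h].
    exists (l - z 0 i); first by lra.
    by move=> w; rewrite ltr_norml negb_and -ltNge => /andP[_ ?]; apply/orP; left; lra.
  exists (z 0 i - u); first by lra.
  by move=> w; rewrite ltr_norml negb_and -!ltNge => /andP[? _]; apply/orP; right; lra.
move=> nb; apply/nbhs_coord.
have [hx|/sep[e e0 He]] := boolP (x1 <= z 0 0 <= x2); last first.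
  by exists e => // w /He /negP nw _ _ [].
have [hy|/sep[e e0 He]] := boolP (y1 <= z 0 1 <= y2); last first.
  by exists e => // w _ /He /negP nw _ [].
have [hz|/sep[e e0 He]] := boolP (z1 <= z 0 ord_max <= z2); last first.
  by exists e => // w _ _ /He /negP nw [].
by case: nb.
Qed.

Definition closed_region A := forall z, ~ A z -> \forall w \near z, ~ A w.

Lemma closed_regionU A B :
  closed_region A -> closed_region B -> closed_region (A `|` B).
Proof.
move=> cA cB z nAB.
have nA : ~ A z by move=> Az; exact: nAB (or_introl Az).
have nB : ~ B z by move=> Bz; exact: nAB (or_intror Bz).
by apply: filterS2 (cA _ nA) (cB _ nB) => w ? ? [].
Qed.

(** Connectedness, in the form in which it is used: locally constant functions
    are constant. *)
Definition rigid K := forall g : Z -> R,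
  (forall z, K z -> \forall w \near z, K w -> g w = g z) ->
  forall z w, K z -> K w -> g z = g w.

Lemma rigidU A B : rigid A -> rigid B -> (exists2 z, A z & B z) -> rigid (A `|` B).
Proof.
move=> rA rB [c Ac Bc] g lg.
have gA z : A z -> g z = g c.
  move=> Az; apply: rA => // w Aw; have := lg w (or_introl Aw).
  by apply: filterS => u h Au; apply: h; left.
have gB z : B z -> g z = g c.
  move=> Bz; apply: rB => // w Bw; have := lg w (or_intror Bw).
  by apply: filterS => u h Bu; apply: h; right.
by move=> z w [/gA|/gB] -> [/gA|/gB] ->.
Qed.

Definition segment_closed K :=
  forall s t (u : R), K s -> K t -> 0 <= u <= 1 -> K (s + u *: (t - s)).

(** Cousin's lemma along the segment from s to t. *)
Lemma rigid_segment_closed K : segment_closed K -> rigid K.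
Proof.
move=> conv g lg s t Ks Kt; pose x (u : R) := s + u *: (t - s).
have xE u i : x u 0 i = s 0 i + u * (t 0 i - s 0 i) by rewrite !mxE.
have x0 : x 0 = s by rewrite /x scale0r addr0.
have x1 : x 1 = t by rewrite /x scale1r addrC subrK.
rewrite -x0 -x1; apply: (@cousin R (fun u w => g (x u) = g (x w))) => //.
  by move=> u w z _ _ -> ->.
move=> u hu; have /nbhs_coord[e e0 He] := lg _ (conv s t u Ks Kt hu).
pose d := 1 + \sum_i `|t 0 i - s 0 i|.
have sum_ge0 : 0 <= \sum_i `|t 0 i - s 0 i| by exact: sumr_ge0.
have d0 : 0 < d by rewrite ltr_pwDl.
have led i : `|t 0 i - s 0 i| <= d.
  rewrite /d (bigD1 i) //= addrCA lerDl addr_ge0 //; exact: sumr_ge0.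
exists (e / d); first by rewrite divr_gt0.
move=> c c' c0 cc' c1 hc hc'.
suff H w : 0 <= w <= 1 -> `|w - u| < e / d -> g (x w) = g (x u).
  by rewrite !H //; apply/andP; split; lra.
move=> hw; rewrite ltr_pdivlMr // => wu.
have close i : `|x w 0 i - x u 0 i| < e.
  rewrite !xE opprD addrACA subrr add0r -mulrBl normrM.
  by apply: le_lt_trans wu; rewrite ler_wpM2l.
by apply: He; [exact: close|exact: close|exact: close|exact: conv].
Qed.

Lemma box_segment_closed x1 x2 y1 y2 z1 z2 : segment_closed (box x1 x2 y1 y2 z1 z2).
Proof.
have mid (a b c d u : R) : 0 <= u <= 1 -> a <= c <= b -> a <= d <= b ->
    a <= c + u * (d - c) <= b.
  move=> /andP[u0 u1] /andP[ac cb] /andP[ad db].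
  have v0 : 0 <= 1 - u by lra.
  have := mulr_ge0 u0 (_ : 0 <= d - a); have := mulr_ge0 u0 (_ : 0 <= b - d).
  have := mulr_ge0 v0 (_ : 0 <= c - a); have := mulr_ge0 v0 (_ : 0 <= b - c).
  by rewrite !subr_ge0 => /(_ cb) ? /(_ ac) ? /(_ db) ? /(_ ad) ?; apply/andP; split; lra.
by move=> s t u [? ? ?] [? ? ?] hu; split; rewrite !mxE; exact: mid.
Qed.

Lemma rigid_boxI x1 x2 y1 y2 z1 z2 x1' x2' y1' y2' z1' z2' :
  rigid (box x1 x2 y1 y2 z1 z2 `&` box x1' x2' y1' y2' z1' z2').
Proof.
apply: rigid_segment_closed => s t u [? ?] [? ?] hu.
by split; exact: box_segment_closed.
Qed.

End Boxes.

Section Torsor.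
Context {R : realType} {P : Type}.
Notation Z := 'rV[R]_3.
Variables (D : set P) (phi : P -> Z) (S : set Z -> (P -> R) -> Prop).
Hypothesis S_sub : forall N N' s, N' `<=` N -> S N s -> S N' s.
Hypothesis S_shift : forall N s c, S N s -> S N (fun p => s p + c).
Implicit Types (A B K N : set Z) (s t : P -> R).

(** [S N s] is meant to say that s solves a fixed local problem over N, where two
    solutions differ locally by a constant; phi maps the domain D of the unknown
    functions to the ambient space.  A section is a function that agrees near each
    point of K with some solution defined on a full neighbourhood. *)
Definition section_on K t := forall z, K z -> exists N s,
  [/\ nbhs z N, S N s & forall p, D p -> N (phi p) -> K (phi p) -> t p = s p].

Definition locally_trivial_at (z : Z) : Prop :=
  [/\ exists2 p, D p & phi p = z, exists N s, nbhs z N /\ S N s &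
   forall N s t, nbhs z N -> S N s -> S N t -> exists c,
     \forall w \near z, forall p, D p -> phi p = w -> s p = t p + c].

(** The difference of the two sections is locally constant on the intersection,
    hence a constant, which is added to one of them. *)
Lemma section_glue A B tA tB :
  closed_region A -> closed_region B -> rigid (A `&` B) ->
  (forall z, A z -> B z -> locally_trivial_at z) ->
  section_on A tA -> section_on B tB -> exists t, section_on (A `|` B) t.
Proof.
move=> cA cB rAB triv secA secB.
have [g gP] : exists g : Z -> R, forall z, A z -> B z ->
    exists2 p, D p /\ phi p = z & g z = tA p - tB p.
  suff /choice[g gP] : forall z, exists r, A z -> B z ->
      exists2 p, D p /\ phi p = z & r = tA p - tB p by exists g.
  move=> z; have [[Az Bz]|nAB] := pselect (A z /\ B z); last by exists 0 => ? ?; case: nAB.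
  by have [[p Dp pz] _ _] := triv _ Az Bz; exists (tA p - tB p) => _ _; exists p.
have key z : A z -> B z -> exists N sA sB, [/\ nbhs z N, S N sA &
   [/\ (forall p, D p -> N (phi p) -> A (phi p) -> tA p = sA p),
       (forall p, D p -> N (phi p) -> B (phi p) -> tB p = sB p),
       (forall p, D p -> N (phi p) -> sA p = sB p + g z) & True]].
  move=> Az Bz; have [_ _ uniq] := triv _ Az Bz.
  have [NA [sA [nA SA eA]]] := secA _ Az; have [NB [sB [nB SB eB]]] := secB _ Bz.
  have nI : nbhs z (NA `&` NB) by apply: filterI.
  have [c Hc] := uniq _ _ _ nI (S_sub (@subIsetl _ _ _) SA) (S_sub (@subIsetr _ _ _) SB).
  have gc : g z = c.
    have [p [Dp pz] ->] := gP z Az Bz; have Hz := nbhs_singleton Hc.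
    rewrite eA ?pz //; last exact: nbhs_singleton nA.
    rewrite eB ?pz //; last exact: nbhs_singleton nB.
    by rewrite (Hz p) // addrAC subrr add0r.
  pose N := (NA `&` NB) `&` [set w | forall p, D p -> phi p = w -> sA p = sB p + c].
  exists N, sA, sB; split; first exact: filterI.
    by apply: S_sub SA => w [[]].
  split=> //.
  - by move=> p Dp [[? ?] _]; exact: eA.
  - by move=> p Dp [[? ?] _]; exact: eB.
  - by move=> p Dp [_ h]; rewrite gc; exact: h.
have gconst z w : A z -> B z -> A w -> B w -> g z = g w.
  move=> Az Bz Aw Bw; apply: rAB => // u [Au Bu].
  have [N [sA [sB [nN _ [eA eB eAB _]]]]] := key u Au Bu.
  apply: filterS nN => v Nv [Av Bv].
  have [p [Dp pv] ->] := gP v Av Bv.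
  by rewrite eA ?pv // eB ?pv // eAB ?pv // addrAC subrr add0r.
have [c cP] : exists c, forall z, A z -> B z -> g z = c.
  have [[z [Az Bz]]|nAB] := pselect (exists z, A z /\ B z); last first.
    by exists 0 => z Az Bz; case: nAB; exists z.
  by exists (g z) => w Aw Bw; exact: gconst.
exists (fun p => if `[< A (phi p) >] then tA p else tB p + c) => z ABz.
have [Az|nAz] := pselect (A z); last first.
  have Bz : B z by case: ABz.
  have [N [s [nN SN eN]]] := secB z Bz.
  exists (N `&` ~` A), (fun p => s p + c); split.
  - by apply: filterI => //; exact: cA.
  - by apply: S_shift; apply: S_sub SN => w [].
  move=> p Dp [Np nAp] [//|Bp]; case: asboolP => // _; congr (_ + _); exact: eN.
have [Bz|nBz] := pselect (B z); last first.
  have [N [s [nN SN eN]]] := secA z Az.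
  exists (N `&` ~` B), s; split.
  - by apply: filterI => //; exact: cB.
  - by apply: S_sub SN => w [].
  move=> p Dp [Np nBp] [Ap|//]; case: asboolP => // _; exact: eN.
have [N [sA [sB [nN SN [eA eB eAB _]]]]] := key z Az Bz.
exists N, sA; split=> // p Dp Np ABp.
case: asboolP => [Ap|nAp]; first exact: eA.
have Bp : B (phi p) by case: ABp.
by rewrite eB // eAB // cP.
Qed.

(** By Cousin's lemma: two adjacent boxes meet in a box, which is rigid. *)
Lemma section_box x1 x2 y1 y2 z1 z2 : x1 <= x2 -> y1 <= y2 -> z1 <= z2 ->
  (forall z, box x1 x2 y1 y2 z1 z2 z -> locally_trivial_at z) ->
  exists t, section_on (box x1 x2 y1 y2 z1 z2) t.
Proof.
set K := box _ _ _ _ _ _ => x12 y12 z12 triv.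
pose Q a a' b b' c c' :=
  box a a' b b' c c' `<=` K -> exists t, section_on (box a a' b b' c c') t.
suff: Q x1 x2 y1 y2 z1 z2 by apply.
have glue A B C : A `|` B = C -> closed_region A -> closed_region B ->
    rigid (A `&` B) -> (A `<=` K -> exists t, section_on A t) ->
    (B `<=` K -> exists t, section_on B t) -> C `<=` K -> exists t, section_on C t.
  move=> <- cA cB rAB hA hB ABK.
  have AK : A `<=` K by move=> z ?; apply: ABK; left.
  have BK : B `<=` K by move=> z ?; apply: ABK; right.
  have [tA sA] := hA AK; have [tB sB] := hB BK.
  by apply: (section_glue cA cB rAB _ sA sB) => z /AK Kz _; exact: triv.
apply: (@cousin3 R Q) => //.
- move=> a b c y y' z z' ab bc _ _; apply: glue; try exact: box_closed; last exact: rigid_boxI.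
  apply/seteqP; split=> w.
    by move=> [] [/andP[? ?] ? ?]; split=> //; apply/andP; split; lra.
  move=> [/andP[? ?] ? ?]; have [?|?] := lerP (w 0 0) b; [left|right];
    by split=> //; apply/andP; split; lra.
- move=> a b c x x' z z' ab bc _ _; apply: glue; try exact: box_closed; last exact: rigid_boxI.
  apply/seteqP; split=> w.
    by move=> [] [? /andP[? ?] ?]; split=> //; apply/andP; split; lra.
  move=> [? /andP[? ?] ?]; have [?|?] := lerP (w 0 1) b; [left|right];
    by split=> //; apply/andP; split; lra.
- move=> a b c x x' y y' ab bc _ _; apply: glue; try exact: box_closed; last exact: rigid_boxI.
  apply/seteqP; split=> w.
    by move=> [] [? ? /andP[? ?]]; split=> //; apply/andP; split; lra.
  move=> [? ? /andP[? ?]]; have [?|?] := lerP (w 0 ord_max) b; [left|right];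
    by split=> //; apply/andP; split; lra.
move=> x y z hx hy hz.
have Kw : K (point3 x y z) by split; rewrite point3E.
have [_ [N [s [nN SN]]] _] := triv _ Kw.
have /nbhs_coord[e e0 He] := nbhs_interior nN.
exists e => // a a' b b' c c' _ _ _ _ _ _ _ _ _ na na' nb nb' nc nc' _.
exists s => u [ua ub uc]; exists N, s; split=> //; apply: He; rewrite point3E.
- exact: between_near ua na na'.
- exact: between_near ub nb nb'.
- exact: between_near uc nc nc'.
Qed.

End Torsor.

(** * Sections over a cubical shell *)

Section Shell.
Context {R : realType} {P : Type}.
Notation Z := 'rV[R]_3.
Variables (D : set P) (phi : P -> Z) (S : set Z -> (P -> R) -> Prop).
Hypothesis S_sub : forall N N' s, N' `<=` N -> S N s -> S N' s.
Hypothesis S_shift : forall N s c, S N s -> S N (fun p => s p + c).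

(** The points of a cube of radius a around v that are outside the open cube of
    radius b, cut below at height zl: the latter is v 0 ord_max - a around an interior
    point of a manifold, and v 0 ord_max around a boundary point. *)
Definition shell (v : Z) (a b zl : R) : set Z :=
  [set z | box (v 0 0 - a) (v 0 0 + a) (v 0 1 - a) (v 0 1 + a) zl (v 0 ord_max + a) z /\
     ([\/ v 0 0 + b <= z 0 0, z 0 0 <= v 0 0 - b, v 0 1 + b <= z 0 1 |
         z 0 1 <= v 0 1 - b] \/
      (v 0 ord_max + b <= z 0 ord_max \/ z 0 ord_max <= v 0 ord_max - b))].

Lemma shell_bound (v z : Z) (a b zl : R) :
  zl = v 0 ord_max \/ zl = v 0 ord_max - a -> shell v a b zl z ->
  [/\ `|z 0 0 - v 0 0| <= a, `|z 0 1 - v 0 1| <= a, `|z 0 ord_max - v 0 ord_max| <= a &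
      zl <= z 0 ord_max].
Proof.
move=> hzl [[/andP[x1 x2] /andP[y1 y2] /andP[z1 z2]] _].
rewrite !ler_distl x1 x2 y1 y2 z1 z2 /=; split=> //; rewrite andbT.
by case: hzl => E; rewrite E in z1; lra.
Qed.

Lemma shell_intro (v z : Z) (a b zl : R) :
  `|z 0 0 - v 0 0| < a -> `|z 0 1 - v 0 1| < a -> `|z 0 ord_max - v 0 ord_max| < a ->
  zl <= z 0 ord_max ->
  ~ [/\ `|z 0 0 - v 0 0| < b, `|z 0 1 - v 0 1| < b & `|z 0 ord_max - v 0 ord_max| < b] ->
  shell v a b zl z.
Proof.
rewrite !ltr_distl => /andP[x1 x2] /andP[y1 y2] /andP[_ z2] z1 out.
split; first by split; apply/andP; split=> //; exact: ltW.
apply: contrapT => h; apply: out; split; apply/andP; split; rewrite ltNge;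
  apply/negP => ?; apply: h.
- by left; apply: Or42.
- by left; apply: Or41.
- by left; apply: Or44.
- by left; apply: Or43.
- by right; right.
- by right; left.
Qed.

Lemma shell_center (v : Z) (a b zl : R) : 0 < b -> ~ shell v a b zl v.
Proof. by move=> b0 [_ [[]|[]]]; lra. Qed.

(** The shell is the union of six boxes, each a part of the cube beyond one of the
    faces of the inner cube (five boxes when the shell is cut through its centre).
    They are added in the order top, sides, bottom, such that each new box meets the
    union of the previous ones in a connected set.  This replaces the simple
    connectedness of a punctured ball. *)
Lemma section_shell (v : Z) (a b zl : R) : 0 < b -> b < a ->
  zl = v 0 ord_max \/ zl = v 0 ord_max - a ->
  (forall z, shell v a b zl z -> locally_trivial_at D phi S z) ->
  exists t, section_on D phi S (shell v a b zl) t.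
Proof.
move=> b0 ba hzl; rewrite /shell.
set x := v 0 0; set y := v 0 1; set z := v 0 ord_max; move=> triv.
have [zl1 zl2] : zl <= z /\ z - a <= zl by case: hzl => ->; rewrite -/z; split; lra.
pose Pt := box (x - a) (x + a) (y - a) (y + a) (z + b) (z + a).
pose Px := box (x + b) (x + a) (y - a) (y + a) zl (z + a).
pose Px' := box (x - a) (x - b) (y - a) (y + a) zl (z + a).
pose Py := box (x - a) (x + a) (y + b) (y + a) zl (z + a).
pose Py' := box (x - a) (x + a) (y - a) (y - b) zl (z + a).
pose Pb := box (x - a) (x + a) (y - a) (y + a) zl (z - b).
set K := (X in section_on _ _ _ X).
have sec u u' w w' r r' : u <= u' -> w <= w' -> r <= r' ->
    box u u' w w' r r' `<=` K -> exists t, section_on D phi S (box u u' w w' r r') t.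
  by move=> ? ? ? sub; apply: (section_box S_sub S_shift) => // p /sub; exact: triv.
have tK : Pt `<=` K.
  move=> p [? ? /andP[? ?]]; split; last by right; left; lra.
  by split=> //; apply/andP; split; lra.
have xK : Px `<=` K.
  move=> p [/andP[? ?] ? ?]; split; last by left; apply: Or41; lra.
  by split=> //; apply/andP; split; lra.
have xK' : Px' `<=` K.
  move=> p [/andP[? ?] ? ?]; split; last by left; apply: Or42; lra.
  by split=> //; apply/andP; split; lra.
have yK : Py `<=` K.
  move=> p [? /andP[? ?] ?]; split; last by left; apply: Or43; lra.
  by split=> //; apply/andP; split; lra.
have yK' : Py' `<=` K.
  move=> p [? /andP[? ?] ?]; split; last by left; apply: Or44; lra.
  by split=> //; apply/andP; split; lra.
have bK : Pb `<=` K.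
  move=> p [? ? /andP[? ?]]; split; last by right; right; lra.
  by split=> //; apply/andP; split; lra.
have [tt st] : exists t, section_on D phi S Pt t by apply: sec => //; lra.
have [tx sx] : exists t, section_on D phi S Px t by apply: sec => //; lra.
have [tx' sx'] : exists t, section_on D phi S Px' t by apply: sec => //; lra.
have [ty sy] : exists t, section_on D phi S Py t by apply: sec => //; lra.
have [ty' sy'] : exists t, section_on D phi S Py' t by apply: sec => //; lra.
have glue A B tA tB : A `<=` K -> B `<=` K -> closed_region A -> closed_region B ->
    rigid (A `&` B) -> section_on D phi S A tA -> section_on D phi S B tB ->
    exists t, section_on D phi S (A `|` B) t.
  move=> AK BK cA cB rAB; apply: (section_glue S_sub S_shift) => // w /AK Kw _.
  exact: triv.
have ct : closed_region Pt by exact: box_closed.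
have cx : closed_region Px by exact: box_closed.
have cx' : closed_region Px' by exact: box_closed.
have cy : closed_region Py by exact: box_closed.
have cy' : closed_region Py' by exact: box_closed.
have UK A B : A `<=` K -> B `<=` K -> A `|` B `<=` K by move=> ? ?; rewrite subUset.
have rI := @rigid_boxI R.
have [t1 s1] : exists t, section_on D phi S (Pt `|` Px) t by apply: glue st sx => //; exact: rI.
have in_box (u u' w w' r r' p q o : R) : [/\ u <= p, p <= u' & w <= q] -> [/\ q <= w', r <= o & o <= r'] ->
  box u u' w w' r r' (point3 p q o).
  by move=> [? ? ?] [? ? ?]; split; rewrite point3E; apply/andP.
have UK2 := UK _ _ (UK _ _ tK xK) yK.
have UK3 := UK _ _ UK2 xK'.
have UK4 := UK _ _ UK3 yK'.
have c2 := closed_regionU (closed_regionU ct cx) cy.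
have c3 := closed_regionU c2 cx'.
have cU4 := closed_regionU c3 cy'.
have [t2 s2] : exists t, section_on D phi S ((Pt `|` Px) `|` Py) t.
  apply: glue s1 sy => //; [exact: UK|exact: closed_regionU|rewrite setIUl].
  apply: rigidU; [exact: rI|exact: rI|exists (point3 (x + a) (y + a) (z + a))];
    by split; apply: in_box; split; (clear -b0 ba zl1 zl2; lra).
have [t3 s3] : exists t, section_on D phi S (((Pt `|` Px) `|` Py) `|` Px') t.
  apply: glue s2 sx' => //.
  have -> : ((Pt `|` Px) `|` Py) `&` Px' = (Pt `&` Px') `|` (Py `&` Px').
    rewrite !setIUl; congr (_ `|` _); rewrite [X in _ `|` X](_ : _ = set0) ?setU0 //.
    by apply/seteqP; split=> // w [[/andP[? ?] _ _] [/andP[? ?] _ _]]; lra.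
  apply: rigidU; [exact: rI|exact: rI|exists (point3 (x - a) (y + a) (z + a))];
    by split; apply: in_box; split; (clear -b0 ba zl1 zl2; lra).
have [t4 s4] : exists t, section_on D phi S ((((Pt `|` Px) `|` Py) `|` Px') `|` Py') t.
  apply: glue s3 sy' => //.
  have -> : (((Pt `|` Px) `|` Py) `|` Px') `&` Py' = (Pt `&` Py') `|` (Px `&` Py') `|` (Px' `&` Py').
    rewrite !setIUl; congr (_ `|` _); rewrite [X in _ `|` X](_ : _ = set0) ?setU0 //.
    by apply/seteqP; split=> // w [[_ /andP[? ?] _] [_ /andP[? ?] _]]; lra.
  apply: rigidU; [apply: rigidU|exact: rI|exists (point3 (x - a) (y - a) (z + a))].
  - exact: rI.
  - exact: rI.
  - by exists (point3 (x + a) (y - a) (z + a)); split; apply: in_box; split; (clear -b0 ba zl1 zl2; lra).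
  - by left; split; apply: in_box; split; (clear -b0 ba zl1 zl2; lra).
  - by split; apply: in_box; split; (clear -b0 ba zl1 zl2; lra).
set U4 := (X in section_on _ _ _ X) in s4 UK4 cU4.
have cover : K `<=` U4 `|` Pb.
  move=> p [[hx hy hz]]; move: (hx) (hy) (hz) => /andP[? ?] /andP[? ?] /andP[? ?].
  move=> [[?|?|?|?]|[?|?]].
  - by left; left; left; left; right; split=> //; apply/andP.
  - by left; left; right; split=> //; apply/andP.
  - by left; left; left; right; split=> //; apply/andP.
  - by left; right; split=> //; apply/andP.
  - by left; left; left; left; left; split=> //; apply/andP.
  - by right; split=> //; apply/andP.
case: hzl => [zlE|zlE].
  exists t4 => p Kp; have U4p : U4 p.
    case: (cover _ Kp) => // -[_ _ /andP[h1 h2]]; exfalso.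
    by move: h1 h2; rewrite zlE -/z => h1 h2; lra.
  have [N [s [nN SN eN]]] := s4 p U4p; exists N, s; split=> // q Dq Nq Kq.
  apply: eN => //; case: (cover _ Kq) => // -[_ _ /andP[h1 h2]]; exfalso.
  by move: h1 h2; rewrite zlE -/z => h1 h2; lra.
have cb : closed_region Pb by exact: box_closed.
have [tb sb] : exists t, section_on D phi S Pb t.
  by apply: sec => //; rewrite ?zlE -/z; lra.
suff [t s5] : exists t, section_on D phi S (U4 `|` Pb) t.
  exists t => p /cover /s5 [N [s [nN SN eN]]]; exists N, s; split=> // q Dq Nq /cover.
  exact: eN.
apply: glue s4 sb => //.
have hl : zl <= z - b by rewrite zlE -/z; lra.
have -> : U4 `&` Pb = (((Px `&` Pb) `|` (Py `&` Pb)) `|` (Px' `&` Pb)) `|` (Py' `&` Pb).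
  have e0 : Pt `&` Pb = set0.
    apply/seteqP; split=> // w [[_ _ /andP[w1 _]] [_ _ /andP[_ w2]]]; exfalso.
    by clear -b0 w1 w2; lra.
  by rewrite /U4 !setIUl e0 set0U.
have r2 : rigid ((Px `&` Pb) `|` (Py `&` Pb)).
  apply: rigidU; [exact: rI|exact: rI|exists (point3 (x + a) (y + a) zl)];
    by split; apply: in_box; split; (clear -b0 ba zl1 zl2 hl; lra).
have r3 : rigid (((Px `&` Pb) `|` (Py `&` Pb)) `|` (Px' `&` Pb)).
  apply: rigidU => //; [exact: rI|exists (point3 (x - a) (y + a) zl)].
    by right; split; apply: in_box; split; (clear -b0 ba zl1 zl2 hl; lra).
  by split; apply: in_box; split; (clear -b0 ba zl1 zl2 hl; lra).
apply: rigidU => //; [exact: rI|exists (point3 (x - a) (y - a) zl)].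
  by right; split; apply: in_box; split; (clear -b0 ba zl1 zl2 hl; lra).
by split; apply: in_box; split; (clear -b0 ba zl1 zl2 hl; lra).
Qed.
End Shell.

(** * Potentials around the edges *)

(** With [A k x] the sum of d over the first k points of the orbit of x and M a
    common multiple of the orbit lengths, [A M] vanishes, so the mean of
    the [A k], for k < M, changes by -d x from x to [step x]. *)
Lemma perm_potential (R : realType) (X : finType) (step : X -> X) (d : X -> R) :
  injective step ->
  (forall x, \sum_(y | fconnect step x y) d y = 0) ->
  exists t : X -> R, forall x, t (step x) = t x + d x.
Proof.
move=> inj sum0.
pose A k x := \sum_(l < k) d (iter l step x).
have A0 x : A 0%N x = 0 by rewrite /A big_ord0.
have AD k l x : A (k + l)%N x = A k x + A l (iter k step x).
  rewrite /A big_split_ord /=; congr (_ + _); apply: eq_bigr => i _.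
  by rewrite addnC iterD.
have AS k x : A k.+1 x = d x + A k (step x) by rewrite -add1n AD /A big_ord1.
have Aorder x : A (fingraph.order step x) x = 0.
  rewrite -[RHS](sum0 x) (eq_bigl (mem (fingraph.orbit step x))); last first.
    by move=> y; rewrite /= fconnect_orbit.
  rewrite -big_uniq ?fingraph.orbit_uniq //= /fingraph.orbit.
  rewrite (big_nth x) size_traject big_mkord; apply: eq_bigr => i _.
  by rewrite nth_traject.
pose M := factorial #|X| .
have AM x : A M x = 0.
  have /dvdnP[c ->] : (fingraph.order step x %| M)%N.
    by rewrite dvdn_fact // fingraph.order_gt0 max_card.
  elim: c => [|c IH]; first by rewrite mul0n A0.
  by rewrite mulSn AD Aorder add0r (iter_order inj).
have M0 : M%:R != 0 :> R by rewrite pnatr_eq0 -lt0n fact_gt0.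
pose B x := \sum_(k < M) A k x.
exists (fun x => - B x / M%:R) => x.
suff -> : B (step x) = B x - d x *+ M.
  by rewrite opprB mulrBl -(mulr_natr (d x)) mulfK // addrC mulNr.
have -> : B (step x) = \sum_(k < M) (A k.+1 x - d x).
  by apply: eq_bigr => k _; rewrite AS addrAC subrr add0r.
rewrite sumrB sumr_const card_ord; congr (_ - _).
have := erefl (\sum_(k < M.+1) A k x).
by rewrite {1}big_ord_recl A0 add0r big_ord_recr /= AM addr0.
Qed.

Section Flags.
Context {R : realType} {n : nat} (T : gluing n) (q : quadvec R n).
Implicit Types F G : flag n.

(** The change of the triangle coordinate at corner a which the standard matching
    equations impose when face f of tetrahedron i is crossed. *)
Definition jump (i : 'I_n) (a f : 'I_4) : R :=
  if glue T i f is Some (j, s) then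
    q i (quad_of a f) - q j (quad_of (s a) (s f))
  else 0.

Lemma jump_sym i a f j s : glue T i f = Some (j, s) ->
  jump j (s a) (s f) = - jump i a f.
Proof.
by move=> g; rewrite /jump (glue_sym g) g !permK opprB.
Qed.

Definition swap_exits F : flag n := (F.1, (tperm (2 : 'I_4) 3 * F.2)%g).

(** Crossing the exit face, which becomes the entry face of the next tetrahedron,
    without renaming it: the result is a flag that exits through the same face, so
    that this is an involution, and it fixes the flags that exit to the boundary. *)
Definition cross_exit F : flag n :=
  if glue T F.1 (exit F) is Some (j, s) then (j, (F.2 * s)%g) else F.

Lemma swap_exitsK : involutive swap_exits.
Proof. by move=> [i s]; rewrite /swap_exits /= mulgA tperm2 mul1g. Qed.

Lemma cross_exitK : involutive cross_exit.
Proof.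
move=> [i r]; rewrite /cross_exit /exit /=.
case g : (glue T i (r 3)) => [[j s]|] /=; last by rewrite g.
by rewrite permM (glue_sym g) -mulgA mulgV mulg1.
Qed.

Lemma swap_exitsE F : [/\ lower (swap_exits F) = lower F,
  upper (swap_exits F) = upper F, entry (swap_exits F) = exit F &
  exit (swap_exits F) = entry F].
Proof.
rewrite /lower /upper /entry /exit /= !permM tpermL tpermR.
by rewrite !tpermD.
Qed.

Lemma quad_flag F : quad_of (lower F) (exit F) = downward F.
Proof.
have inj k l : F.2 k = F.2 l -> k = l by exact: perm_inj.
rewrite /downward; apply: quad_of_opp; rewrite /lower /exit /upper /entry /=.
by rewrite !inE !(inj_eq (@perm_inj _ F.2)).
Qed.

(** Away from the boundary this is [turn]; at the boundary the walk turns back. *)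
Definition edge_step F := swap_exits (cross_exit F).

Lemma edge_step_inj : injective edge_step.
Proof. by move=> F G /(inv_inj swap_exitsK) /(inv_inj cross_exitK). Qed.

Let delta F := jump F.1 (lower F) (exit F).

Lemma delta_cross F : delta (cross_exit F) = - delta F.
Proof.
rewrite /delta /cross_exit; case g : (glue T F.1 (exit F)) => [[j s]|] /=.
  by rewrite /exit /lower /= !permM (jump_sym _ g).
by rewrite /jump g oppr0.
Qed.

(** An orbit without boundary face is an edge cycle, and the claim is its
    matching equation.  An orbit that meets the boundary runs along the same
    tetrahedra in both directions, so it is stable under [cross_exit], which changes
    the sign of delta. *)
Lemma edge_step_sum F : quad_matching T q ->
  \sum_(G | fconnect edge_step F G) delta G = 0.
Proof.
move=> qm; set O := fconnect edge_step F.
have csym := fconnect_sym edge_step_inj.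
have Ostep G : O (edge_step G) = O G.
  rewrite /O !(csym F); apply/idP/idP => h; first exact: connect_trans (fconnect1 _ _) h.
  by apply: connect_trans h; rewrite csym fconnect1.
have [/forall_inP bd|/forall_inPn[H OH nH]] :=
    boolP [forall (G | O G), glue T G.1 (exit G) != None].
  have ec : edge_cycle T (fingraph.orbit edge_step F).
    apply/andP; split; last exact: orbit_uniq.
    have := cycle_orbit edge_step_inj F.
    apply: (@sub_in_cycle _ O) => [G H OG _ /eqP <-|]; last first.
      by apply/allP => G; rewrite -fconnect_orbit.
    rewrite /turn; have := bd _ OG; rewrite /edge_step /cross_exit.
    case g : (glue T G.1 (exit G)) => [[j s]|] //= _.
    by rewrite /lower /upper /entry /exit /= !permM tpermL !tpermD // !eqxx.
  have toO (f : flag n -> R) : \sum_(G <- fingraph.orbit edge_step F) f G = \sum_(G | O G) f G.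
    rewrite big_uniq ?orbit_uniq //=; apply: eq_bigl => G.
    by rewrite -fconnect_orbit.
  have := qm _ ec; rewrite !toO => E.
  transitivity (\sum_(G | O G) (q G.1 (downward G) - q (edge_step G).1 (upward (edge_step G)))).
    apply: eq_bigr => G OG; have := bd _ OG; rewrite /delta /jump -quad_flag.
    rewrite /edge_step /cross_exit.
    case g : (glue T G.1 (exit G)) => [[j s]|] //= _.
    rewrite /upward /lower /entry /exit /= !permM tpermL !tpermD //.
  rewrite sumrB -E [X in X - _](reindex_inj edge_step_inj) /=.
  by rewrite (eq_bigl _ _ Ostep) subrr.
have HsH : edge_step H = swap_exits H.
  by move: nH; rewrite negbK /edge_step /cross_exit => /eqP ->.
have Oswap G : O G -> O (swap_exits G).
  have OE G' : O G' = fconnect edge_step H G'.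
    by rewrite /O; apply: same_connect OH _; exact: csym.
  rewrite !OE => /iter_findex <-; elim: (findex _ _ _) => [|k IH] /=.
    by rewrite -HsH fconnect1.
  set X := iter k _ _ in IH *.
  have E : edge_step (swap_exits (edge_step X)) = swap_exits X.
    by rewrite /edge_step swap_exitsK cross_exitK.
  by rewrite csym; apply: connect_trans (fconnect1 _ _) _; rewrite E csym.
have Ocross G : O (cross_exit G) = O G.
  have imp G' : O G' -> O (cross_exit G').
    by rewrite -Ostep /edge_step => /Oswap; rewrite swap_exitsK.
  by apply/idP/idP => /imp //; rewrite cross_exitK.
have : \sum_(G | O G) delta G = - \sum_(G | O G) delta G.
  rewrite {1}(reindex_inj (inv_inj cross_exitK)) /= (eq_bigl _ _ Ocross) -sumrN.
  by apply: eq_bigr => G _; exact: delta_cross.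
lra.
Qed.

(** Averaging over [swap_exits] a potential for [edge_step] makes it invariant
    under [swap_exits]; then it jumps as required under [cross_exit], because the two
    involutions compose to [edge_step]. *)
Lemma flag_potential : quad_matching T q ->
  exists t : flag n -> R, (forall F, t (swap_exits F) = t F) /\
    forall F, t (cross_exit F) = t F + jump F.1 (lower F) (exit F).
Proof.
move=> qm.
have [t tP] := perm_potential edge_step_inj (fun F => edge_step_sum F qm).
exists (fun F => (t F + t (swap_exits F)) / 2); split=> F.
  by rewrite swap_exitsK addrC.
have -> : cross_exit F = swap_exits (edge_step F) by rewrite /edge_step swap_exitsK.
rewrite swap_exitsK tP.
have E : edge_step (swap_exits (edge_step F)) = swap_exits F.
  by rewrite /edge_step swap_exitsK cross_exitK.
have := tP (swap_exits (edge_step F)); rewrite E.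
have -> : delta (swap_exits (edge_step F)) = - delta F.
  by rewrite /edge_step swap_exitsK delta_cross.
by rewrite /delta => ->; lra.
Qed.

End Flags.

(** * Jump sections *)

Section Pieces.
Context {R : realType} {n : nat} (T : gluing n).
Notation pieces := (@pieces R n).
Implicit Types (p : pieces) (O : set pieces).

Definition glues p p' (f : 'I_4) (s : 'S_4) := [/\ glue T (tag p) f = Some (tag p', s),
  bary p f = 0 & forall a, bary p' (s a) = bary p a].

Lemma bary_ge0 p a : 0 <= bary p a.
Proof. by case: p => i [x hx]; have [h _] := set_mem hx; exact: h. Qed.

Lemma bary_sum p : \sum_a bary p a = 1.
Proof. by case: p => i [x hx]; have [_ h] := set_mem hx; exact: h. Qed.

Lemma piece_ext p p' : tag p = tag p' -> bary p =1 bary p' -> p = p'.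
Proof.
case: p p' => [i x] [j y] /= ij; case: _ / ij y => y E.
congr existT; apply: val_inj; apply/rowP => a; exact: (E a).
Qed.

Lemma piece_exists (j : 'I_n) (x : 'I_4 -> R) : (forall a, 0 <= x a) -> \sum_a x a = 1 ->
  exists p, tag p = j /\ bary p =1 x.
Proof.
move=> x0 x1.
have hx : (\row_a x a) \in @simplex R.
  apply/mem_set; split=> [a|]; first by rewrite mxE.
  by rewrite -[RHS]x1; apply: eq_bigr => a _; rewrite mxE.
exists (existT (fun=> set_type (@simplex R)) j (exist (fun x => x \in @simplex R) _ hx)).
split=> // a.
by rewrite /bary /= mxE.
Qed.

(** A point with a coordinate above 1/2 is thus assigned to one corner of its
    tetrahedron. *)
Lemma big_coord_uniq p a a' : 1/2 < bary p a -> 1/2 < bary p a' -> a = a'.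
Proof.
move=> h h'; apply: contraTeq isT => aa'; have := bary_sum p.
rewrite (bigD1 a) //= (bigD1 a') 1?eq_sym //=.
have : 0 <= \sum_(i | (i != a) && (i != a')) bary p i by apply: sumr_ge0 => ? _; exact: bary_ge0.
by move=> ? ?; exfalso; lra.
Qed.

Lemma glues_move p f j s : glue T (tag p) f = Some (j, s) -> bary p f = 0 ->
  exists p', tag p' = j /\ glues p p' f s.
Proof.
move=> g pf.
have [||p' [tp' bp']] := @piece_exists j (fun a => bary p (s^-1%g a)).
- by move=> a; exact: bary_ge0.
- by rewrite -[RHS](bary_sum p) [RHS](reindex_inj (@perm_inj _ s^-1%g)).
exists p'; split=> //; split=> //; first by rewrite tp'.
by move=> a; rewrite bp' permK.
Qed.

Lemma glues_sym p p' f s : glues p p' f s -> glues p' p (s f) s^-1%g.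
Proof.
move=> [g pf E]; split; [exact: (glue_sym g)|by rewrite E|].
by move=> a; rewrite -E permKV.
Qed.

Definition same p p' := clos_refl_sym_trans pieces (glued T) p p'.

(** Gluing is symmetric, so a property that passes from x to y along each
    gluing passes through the generated equivalence. *)
Lemma same_ind (Q : pieces -> Prop) p p' :
  (forall x y f s, glues x y f s -> Q x -> Q y) -> same p p' -> Q p -> Q p'.
Proof.
move=> step pp'; suff [] : (Q p -> Q p') /\ (Q p' -> Q p) by [].
elim: pp' => [x y [f [s [g xf E]]]|//|x y _ [? ?] //|x y z _ [xy yx] _ [yz zy]].
  have h : glues x y f s by [].
  by split; [exact: step h|exact: step (glues_sym h)].
by split=> h; [exact/yz/xy|exact/yx/zy].
Qed.

Lemma glues_same p p' f s : glues p p' f s -> same p p'.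
Proof. by move=> [? ? ?]; apply: rst_step; exists f, s. Qed.

Lemma same_perm p p' : same p p' -> exists s : 'S_4, forall a, bary p' (s a) = bary p a.
Proof.
move=> h; apply: (same_ind (p := p) (p' := p')
  (Q := fun x => exists s : 'S_4, forall a, bary x (s a) = bary p a)) => //.
  move=> x y f s [_ _ E] [r Er]; exists (r * s)%g => a.
  by rewrite permM E Er.
by exists 1%g => a; rewrite perm1.
Qed.

Definition nearby (r : R) p p' := tag p = tag p' /\ forall k, `|bary p' k - bary p k| < r.

Lemma fin_min (I : finType) (Q : I -> R -> Prop) :
  (forall i, exists2 r, 0 < r & forall r', 0 < r' -> r' <= r -> Q i r') ->
  exists2 r, 0 < r & forall i r', 0 < r' -> r' <= r -> Q i r'.
Proof.
move=> H; suff [r r0 hr] : exists2 r, 0 < r &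
    forall i, i \in enum I -> forall r', 0 < r' -> r' <= r -> Q i r'.
  by exists r => // i r' *; apply: (hr i); rewrite ?mem_enum.
elim: (enum I) => [|i e [r r0 IH]]; first by exists 1.
have [r1 r10 h1] := H i; exists (Num.min r r1); first by rewrite lt_min r0.
move=> j; rewrite inE => /orP[/eqP ->|je] r' r'0; rewrite le_min => /andP[le1 le2].
  exact: h1.
exact: IH.
Qed.

Lemma nearby_refl r p : 0 < r -> nearby r p p.
Proof. by move=> r0; split=> // k; rewrite subrr normr0. Qed.

Lemma nearby_open r p p' : nearby r p p' ->
  exists2 r', 0 < r' & forall p'', nearby r' p' p'' -> nearby r p p''.
Proof.
move=> [tpp' h].
have [k|r' r'0 hr'] := @fin_min _ (fun k r' => r' <= r - `|bary p' k - bary p k|).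
  by exists (r - `|bary p' k - bary p k|) => //; have := h k; lra.
exists r' => // p'' [t' h']; split; first by rewrite tpp'.
move=> k; apply: le_lt_trans (ler_distD (bary p' k) _ _) _.
by have := h' k; have := hr' k _ r'0 (lexx _); lra.
Qed.

Lemma open_pieces O : open O <->
  forall p, O p -> exists2 r, 0 < r & forall p', nearby r p p' -> O p'.
Proof.
split.
  move=> /sigT_openP oO [i x] Op.
  have [B oB BE] := oO i.
  have Bx : B (set_val x) by have : (existT _ i @^-1` O) x by []; rewrite -BE.
  have /nbhs_ballP[r r0 hr] : nbhs (set_val x) B by exact: open_nbhs_nbhs.
  exists r => // -[j y] [/= ij]; case: _ / ij y => y h.
  have : B (set_val y).
    by apply: hr; split=> // k l; rewrite ord1 /ball /= distrC; exact: (h l).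
  by move=> By; have : (set_val @^-1` B) y by []; rewrite BE.
move=> H; apply/sigT_openP => i; rewrite openE => x Ox.
have [r r0 hr] := H _ Ox.
apply: (@filterS _ _ _ (set_val @^-1` ball (set_val x : 'rV[R]_4) r)).
  move=> y [_ hy]; apply: hr; split=> // k.
  by have := hy 0 k; rewrite /ball /= distrC.
have cont : {for x, continuous (set_val : set_type (@simplex R) -> 'rV[R]_4)}.
  exact: (@initial_continuous _ _ set_val x).
apply: cont; exact: nbhsx_ballx.
Qed.

Definition saturated O := forall p p' f s, glues p p' f s -> O p -> O p'.

(** Points of one fibre have the same coordinates up to a permutation, so the fibre
    is finite and radii can be chosen uniformly over it. *)
Lemma same_uniform p0 (Q : pieces -> R -> Prop) :
  (forall p, same p0 p -> exists2 r, 0 < r & forall r', 0 < r' -> r' <= r -> Q p r') ->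
  exists2 r, 0 < r & forall p r', same p0 p -> 0 < r' -> r' <= r -> Q p r'.
Proof.
move=> H.
have [js|r r0 hr] := @fin_min ('I_n * 'S_4)%type (fun js r' => forall p, same p0 p ->
    tag p = js.1 -> (forall a, bary p (js.2 a) = bary p0 a) -> Q p r').
  have [[p [hp tp bp]]|nP] := pselect (exists p, [/\ same p0 p, tag p = js.1 &
    forall a, bary p (js.2 a) = bary p0 a]); last first.
    by exists 1 => // r' _ _ p *; case: nP; exists p.
  have [r r0 hr] := H p hp; exists r => // r' r'0 r'r p' _ tp' bp'.
  suff -> : p' = p by exact: hr.
  by apply: piece_ext => [|a]; rewrite ?tp ?tp' // -[a](permKV js.2) bp bp'.
exists r => // p r' hp r'0 r'r; have [s hs] := same_perm hp.
exact: (hr (tag p, s)).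
Qed.

Definition fibre_nbhd p0 r : set pieces := [set q | exists2 p, same p0 p & nearby r p q].

Lemma fibre_nbhd_open p0 r : open (fibre_nbhd p0 r).
Proof.
apply/open_pieces => q [p hp cpq]; have [r' r'0 hr'] := nearby_open cpq.
by exists r' => // q' /hr' cpq'; exists p.
Qed.

Definition coord_gap p0 r := forall a, bary p0 a != 0 -> r <= bary p0 a.

Lemma coord_gap_exists p0 : exists2 r, 0 < r & forall r', 0 < r' -> r' <= r -> coord_gap p0 r'.
Proof.
have [a|r r0 hr] := @fin_min _ (fun a r => bary p0 a != 0 -> r <= bary p0 a).
  have [->|a0] := eqVneq (bary p0 a) 0; first by exists 1.
  by exists (bary p0 a) => //; rewrite lt_def a0 bary_ge0.
by exists r => // r' r'0 r'r a; exact: hr.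
Qed.

Lemma coord_gap_same p0 p r : coord_gap p0 r -> same p0 p -> coord_gap p r.
Proof. by move=> g /same_perm[s hs] a; rewrite -[a](permKV s) hs; exact: g. Qed.

(** A coordinate of q that vanishes also vanishes at p, because the nonzero
    coordinates of p are at least r; so whatever is glued at q is glued at p. *)
Lemma glues_follow p q q' f s r : coord_gap p r -> nearby r p q -> glues q q' f s ->
  exists2 p', glues p p' f s & nearby r p' q'.
Proof.
move=> gap [tpq h] [g qf E].
have pf : bary p f = 0.
  apply: contraTeq isT => /gap rp; have := h f; rewrite qf sub0r normrN ger0_norm ?bary_ge0 //.
  by rewrite ltNge rp.
rewrite -tpq in g; have [p' [tp' gp']] := glues_move g pf.
exists p' => //; split=> // k; case: gp' => _ _ E'.
by rewrite -[k](permKV s) E E'.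
Qed.

Lemma fibre_nbhd_saturated p0 r : coord_gap p0 r -> saturated (fibre_nbhd p0 r).
Proof.
move=> gap q q' f s gq [p hp cpq].
have [p' gp' cp'] := glues_follow (coord_gap_same gap hp) cpq gq.
by exists p' => //; apply: rst_trans hp (glues_same gp').
Qed.

Lemma fibre_nbhd_self p0 r : 0 < r -> fibre_nbhd p0 r p0.
Proof. by move=> r0; exists p0; [exact: rst_refl|exact: nearby_refl]. Qed.

Variable q : quadvec R n.

(** Functions which could be the triangle coordinates, spread over the corners:
    locally constant, and jumping as the matching equations require. *)
Definition jump_section O (t : pieces -> R) :=
  (forall p, O p -> exists2 r, 0 < r & forall p', O p' -> nearby r p p' -> t p' = t p) /\
  (forall p p' f s a, O p -> O p' -> glues p p' f s -> 1/2 < bary p a ->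
     t p' = t p + jump T q (tag p) a f).

Lemma jump_section_sub O O' t : O' `<=` O -> jump_section O t -> jump_section O' t.
Proof.
move=> sub [loc jmp]; split=> [p /sub Op|p p' f s a /sub ? /sub ?]; last exact: jmp.
by have [r r0 hr] := loc p Op; exists r => // p' /sub; exact: hr.
Qed.

Lemma jump_section_shift O t c : jump_section O t -> jump_section O (fun p => t p + c).
Proof.
move=> [loc jmp]; split=> [p Op|p p' f s a Op Op' g ha].
  by have [r r0 hr] := loc p Op; exists r => // p' Op' cp; rewrite hr.
by rewrite (jmp _ _ _ _ _ Op Op' g ha) addrAC.
Qed.

(** The jumps determine t - t' on the fibre of p0 up to a constant, and local
    constancy extends this to a neighbourhood of the fibre. *)
Lemma jump_section_uniq p0 a O t t' : 1/2 < bary p0 a -> open O ->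
  (forall p, same p0 p -> O p) -> jump_section O t -> jump_section O t' ->
  exists c O', [/\ open O', saturated O', O' p0 & forall p, O' p -> t p = t' p + c].
Proof.
move=> ha oO cO [loc jmp] [loc' jmp'].
pose c := t p0 - t' p0.
have fib p : same p0 p -> t p = t' p + c.
  move=> hp; suff [] : [/\ same p0 p, t p = t' p + c & exists a, 1/2 < bary p a] by [].
  apply: (same_ind (Q := fun p => [/\ same p0 p, t p = t' p + c & exists a, 1/2 < bary p a])) hp _.
    move=> x y f s g [hx tx [b hb]]; have hy := rst_trans _ _ _ _ _ hx (glues_same g).
    split=> //; last by exists (s b); case: g => _ _ ->.
    by rewrite (jmp _ _ _ _ _ (cO _ hx) (cO _ hy) g hb)
      (jmp' _ _ _ _ _ (cO _ hx) (cO _ hy) g hb) tx addrAC.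
  by split; [exact: rst_refl|rewrite /c; lra|exists a].
have [p hp|r r0 hr] := @same_uniform p0 (fun p r => forall p', nearby r p p' ->
    t p' = t p /\ t' p' = t' p).
  have [r1 r10 h1] := loc _ (cO p hp); have [r2 r20 h2] := loc' _ (cO p hp).
  have [r3 r30 h3] := (open_pieces O).1 oO _ (cO p hp).
  exists (Num.min r1 (Num.min r2 r3)); first by rewrite !lt_min r10 r20.
  move=> r' r'0; rewrite !le_min => /and3P[l1 l2 l3] p' [tp' cp'].
  have wk r'' : r' <= r'' -> nearby r'' p p'.
    by move=> l; split=> // k; apply: lt_le_trans l.
  by have Op' := h3 _ (wk _ l3); split; [apply: h1|apply: h2] => //; exact: wk.
have [r1 r10 h1] := coord_gap_exists p0.
pose r' := Num.min r r1.
have r'0 : 0 < r' by rewrite lt_min r0.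
have lr : r' <= r by rewrite ge_min lexx.
have lr1 : r' <= r1 by rewrite ge_min lexx orbT.
exists c, (fibre_nbhd p0 r'); split.
- exact: fibre_nbhd_open.
- exact/fibre_nbhd_saturated/h1.
- exact: fibre_nbhd_self.
by move=> p' [p hp cp]; have [-> ->] := hr p r' hp r'0 lr p' cp; exact: fib.
Qed.

End Pieces.

(** * Jump sections around points other than the vertices *)

Section LocalExistence.
Context {R : realType} {n : nat} (T : gluing n) (q : quadvec R n).
Hypothesis qm : quad_matching T q.
Notation pieces := (@pieces R n).
Implicit Types (p : pieces) (O : set pieces) (F : flag n).

Definition fibre_section p0 (t : pieces -> R) := forall p p' f s a,
  same T p0 p -> glues T p p' f s -> 1/2 < bary p a ->
  t p' = t p + jump T q (tag p) a f.

Lemma ord4_cover (a b c d e : 'I_4) : uniq [:: a; b; c; d] -> e \in [:: a; b; c; d].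
Proof.
move=> u; have/card_uniqP : uniq [:: a; b; c; d] by [].
move=> cu; have : [:: a; b; c; d] =i predT.
  by apply/subset_cardP; [rewrite cu card_ord|exact/fintype.subsetP].
by move=> ->.
Qed.

(** At most one coordinate of p0 vanishes, so the fibre has at most one other point. *)
Lemma fibre_section_face p0 a b c : a != b -> a != c -> b != c -> 1/2 < bary p0 a ->
  bary p0 b != 0 -> bary p0 c != 0 -> exists t, fibre_section p0 t.
Proof.
move=> ab ac bc ha hb hc.
have a0 : bary p0 a != 0 by apply: contraTneq ha => ->; rewrite -leNgt; lra.
have zero_uniq d e : bary p0 d = 0 -> bary p0 e = 0 -> d = e.
  move=> d0 e0.
  have nz x : bary p0 x != 0 -> (x != d) && (x != e).
    by move=> h; rewrite !(contraNneq _ h) // => ->; rewrite ?d0 ?e0.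
  have [ad ae] := andP (nz _ a0); have [bd be] := andP (nz _ hb); have [cd ce] := andP (nz _ hc).
  have := @ord4_cover a b c d e; rewrite /= !inE !negb_or ab ac ad bc bd cd /=.
  move=> /(_ isT); rewrite (eq_sym e) (negbTE ae) (eq_sym e) (negbTE be) (eq_sym e) (negbTE ce) /=.
  by move/eqP.
have [[d d0]|nz] := pselect (exists d, bary p0 d = 0); last first.
  have fib p : same T p0 p -> p = p0.
    move=> hp; apply: (same_ind (Q := fun p => p = p0)) hp _ => // x y f s g xp.
    by case: nz; exists f; case: g => _ + _; rewrite xp.
  exists (fun=> 0) => p p' f s x /fib -> [_ pf _]; case: nz.
  by exists f.
have fib p : same T p0 p -> p = p0 \/ exists s, glues T p0 p d s.
  move=> hp; apply: (same_ind (Q := fun p => p = p0 \/ exists s, glues T p0 p d s)) hp _;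
    last by left.
  move=> x y f s g [xE|[s' [gd _ Ed]]].
    have dE : d = f by apply: zero_uniq => //; rewrite -xE; case: g.
    by right; exists s; rewrite dE -xE.
  left; case: g => gx xf Ex.
  have fE : f = s' d by rewrite -[f](permKV s') in xf *; rewrite Ed in xf; rewrite (zero_uniq _ _ xf d0).
  move: gx; rewrite fE (glue_sym gd) => -[ty sE].
  by apply: piece_ext => // k; rewrite -[k in LHS](permK s') sE Ex Ed.
exists (fun p => if `[< p = p0 >] then 0 else jump T q (tag p0) a d).
move=> p p' f s x hp g hx.
have [pE|[s' g']] := fib p hp.
  rewrite pE in g hx *; rewrite (big_coord_uniq hx ha).
  have fE : f = d by case: g => _ f0 _; exact: zero_uniq.
  rewrite fE in g *.
  case: asboolP => [p'E|_]; last by case: asboolP => // _; rewrite add0r.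
  exfalso; case: g => g _ E; apply: (glue_irrefl g); rewrite p'E.
  by congr (_, _); apply: zero_uniq => //; rewrite -d0 -(E d) p'E.
have [gd _ Ed] := g'.
have pp0 : p <> p0.
  move=> pE; apply: (glue_irrefl gd); rewrite pE.
  by congr (_, _); apply: zero_uniq => //; rewrite -d0 -(Ed d) pE.
case: g => gx xf Ex.
have fE : f = s' d by rewrite -[f](permKV s') in xf *; rewrite Ed in xf; rewrite (zero_uniq _ _ xf d0).
have xE : x = s' a by apply: big_coord_uniq hx _; rewrite Ed.
move: gx; rewrite fE (glue_sym gd) => -[ty sE].
have -> : p' = p0.
  by apply: piece_ext => // k; rewrite -[k in LHS](permK s') sE Ex Ed.
case: asboolP => // _; case: asboolP => // _.
by rewrite xE (jump_sym _ _ gd) subrr.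
Qed.

(** When p lies on an edge, its flag along this edge, with lower end at the corner
    near p; it is determined up to [swap_exits]. *)
Definition adapted p F := [/\ F.1 = tag p, 1/2 < bary p (lower F) & bary p (upper F) != 0].

Lemma perm4_eq (s t : 'S_4) : s 0 = t 0 -> s 1 = t 1 ->
  s = t \/ s = (tperm (2 : 'I_4) 3 * t)%g.
Proof.
move=> h0 h1; pose r := (s * t^-1)%g.
have r0 : r 0 = 0 by rewrite permM h0 permK.
have r1 : r 1 = 1 by rewrite permM h1 permK.
have sE : s = (r * t)%g by rewrite /r mulgKV.
have cov x : x \in [:: 0; 1; 2; 3 : 'I_4] by exact: ord4_cover.
have inj x y : r x = r y -> x = y by exact: perm_inj.
have ext (u v : 'S_4) : u 0 = v 0 -> u 1 = v 1 -> u 2 = v 2 -> u 3 = v 3 -> u = v.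
  move=> e0 e1 e2 e3; apply/permP => x; have := cov x; rewrite !inE.
  by move=> /or4P[] /eqP ->.
have r2 : r 2 = 2 \/ r 2 = 3.
  have := cov (r 2); rewrite !inE => /or4P[] /eqP e; [| |by left|by right].
  - by have := inj 2 0; rewrite e r0 => /(_ erefl)/eqP.
  - by have := inj 2 1; rewrite e r1 => /(_ erefl)/eqP.
have r3 : r 3 = 2 \/ r 3 = 3.
  have := cov (r 3); rewrite !inE => /or4P[] /eqP e; [| |by left|by right].
  - by have := inj 3 0; rewrite e r0 => /(_ erefl)/eqP.
  - by have := inj 3 1; rewrite e r1 => /(_ erefl)/eqP.
rewrite sE; case: r2 r3 => [r2|r2] [r3|r3].
- by have := inj 2 3; rewrite r2 r3 => /(_ erefl)/eqP.
- by left; rewrite -[RHS]mul1g; congr (_ * _)%g; apply: ext; rewrite perm1.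
- right; congr (_ * _)%g; apply: ext; rewrite ?tpermL ?tpermR //; rewrite tpermD //.
- by have := inj 2 3; rewrite r2 r3 => /(_ erefl)/eqP.
Qed.

(** The fibre walks around an edge, and its jumps are those of the flags.  This is
    where the quadrilateral matching equations enter. *)
Lemma fibre_section_edge p0 a b : a != b -> 1/2 < bary p0 a -> bary p0 b != 0 ->
  (forall c, c != a -> c != b -> bary p0 c = 0) -> exists t, fibre_section p0 t.
Proof.
move=> ab ha hb hz.
have [tau [tau_swap tau_cross]] := flag_potential qm.
have [u [u0 u1]] : exists u : 'S_4, u 0 = a /\ u 1 = b.
  pose c := tperm 0 a (1 : 'I_4).
  exists (tperm 0 a * tperm c b)%g; rewrite !permM tpermL.
  split; last exact: tpermL.
  rewrite tpermD //; last by rewrite eq_sym.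
  by rewrite -[X in _ != X](tpermL 0 a) (inj_eq perm_inj).
have ex_adapted p : same T p0 p -> exists F, adapted p F.
  move=> /same_perm[s hs]; exists (tag p, (u * s)%g); split=> //.
  - by rewrite /lower /= permM hs u0.
  - by rewrite /upper /= permM hs u1.
have adapted_uniq p F G : same T p0 p -> adapted p F -> adapted p G -> tau F = tau G.
  move=> /same_perm[s hs] [F1 hF hF'] [G1 hG hG'].
  have h0 : F.2 0 = G.2 0 by exact: (big_coord_uniq hF hG).
  have upE (H : flag n) : F.2 0 = H.2 0 -> bary p (upper H) != 0 -> H.2 1 = s b.
    move=> HF nz; apply: contraTeq isT => H1b; move: nz.
    have H0 : H.2 0 = s a by rewrite -HF; apply: big_coord_uniq hF _; rewrite hs.
    rewrite /upper -[H.2 1](permKV s) hs hz ?eqxx //.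
      by rewrite -(inj_eq (@perm_inj _ s)) permKV -H0 (inj_eq perm_inj).
    by rewrite -(inj_eq (@perm_inj _ s)) permKV.
  have h1 : F.2 1 = G.2 1 by rewrite (upE F) ?(upE G).
  case: (perm4_eq h0 h1) => E.
    by congr tau; apply: injective_projections => //; rewrite F1 G1.
  rewrite -[RHS]tau_swap; congr tau; apply: injective_projections => //=.
  by rewrite F1 G1.
exists (fun p => tau (xget (tag p, 1%g) [set F | adapted p F])) => p p' f s x hp g hx.
have hp' : same T p0 p' by apply: rst_trans hp (glues_same g).
set F := xget _ _; set G := xget _ _.
have aG : adapted p G.
  by rewrite /G; case: xgetP => [H -> //|nH]; have [H /nH] := ex_adapted _ hp.
have aF : adapted p' F.
  by rewrite /F; case: xgetP => [H -> //|nH]; have [H /nH] := ex_adapted _ hp'.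
have [H [aH Hf]] : exists H, adapted p H /\ exit H = f.
  have [G1 hG hG'] := aG.
  have [s1 s2 s3 s4] := swap_exitsE G.
  have aS : adapted p (swap_exits G) by split; rewrite ?s1 ?s2.
  have := @ord4_cover (G.2 0) (G.2 1) (G.2 2) (G.2 3) f.
  rewrite /= !inE !(inj_eq perm_inj) => /(_ isT) /or4P[] /eqP fE.
  - by exfalso; move: hG; case: g => _; rewrite fE /lower => -> _; lra.
  - by exfalso; move: hG'; case: g => _; rewrite fE /upper => -> _; rewrite eqxx.
  - by exists (swap_exits G); rewrite s4 fE.
  - by exists G.
have [H1 hH hH'] := aH; have [gl pf E] := g.
have aC : adapted p' (cross_exit T H).
  by rewrite /cross_exit H1 Hf gl; split=> //; rewrite /lower /upper /= permM E.
rewrite (adapted_uniq _ _ _ hp' aF aC) (adapted_uniq _ _ _ hp aG aH) tau_cross.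
by rewrite H1 Hf (big_coord_uniq hx hH).
Qed.

Lemma fibre_section_exists p0 a b : a != b -> 1/2 < bary p0 a -> bary p0 b != 0 ->
  exists t, fibre_section p0 t.
Proof.
move=> ab ha hb.
have [[c [ca cb c0]]|nc] := pselect (exists c, [/\ a != c, b != c & bary p0 c != 0]).
  exact: (fibre_section_face ab ca cb).
apply: (fibre_section_edge ab ha hb) => c ca cb; apply: contra_notP nc => /eqP c0.
by exists c; rewrite eq_sym ca eq_sym.
Qed.

(** A solution on the fibre of p0 is extended to be constant on disjoint balls
    around the points of the fibre.  The radius keeps distinct points of the fibre
    apart, keeps nonzero coordinates away from 0, and keeps the large coordinate
    above 1/2. *)
Lemma jump_section_exists p0 a b : a != b -> 1/2 < bary p0 a -> bary p0 b != 0 ->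
  exists O t, [/\ open O, saturated T O, O p0 & jump_section T q O t].
Proof.
move=> ab ha hb; have [t ht] := fibre_section_exists ab ha hb.
have [r0 r00 hr0] := coord_gap_exists p0.
have [ij|r1 r10 hr1] := @fin_min _ ('I_4 * 'I_4)%type (fun ij r =>
    bary p0 ij.1 != bary p0 ij.2 -> r *+ 2 <= `|bary p0 ij.1 - bary p0 ij.2|).
  have [|ne] := eqVneq (bary p0 ij.1) (bary p0 ij.2); first by exists 1.
  exists (`|bary p0 ij.1 - bary p0 ij.2| / 2).
    by rewrite divr_gt0 // normr_gt0 subr_eq0.
  by move=> r' _ h _; lra.
pose r := Num.min (Num.min r0 r1) (bary p0 a - 1/2).
have r_gt0 : 0 < r by rewrite !lt_min r00 r10 /=; lra.
have ra : r <= bary p0 a - 1/2 by rewrite ge_min lexx orbT.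
have gap : coord_gap p0 r by apply: hr0 => //; rewrite /r !ge_min lexx.
have sep i j : bary p0 i != bary p0 j -> r *+ 2 <= `|bary p0 i - bary p0 j|.
  by apply: (hr1 (i, j)) => //; rewrite /r !ge_min lexx orbT.
have nearby_uniq p p' x : same T p0 p -> same T p0 p' -> nearby r p x -> nearby r p' x -> p = p'.
  move=> /same_perm[s hs] /same_perm[s' hs'] [tp cp] [tp' cp'].
  apply: piece_ext => [|k]; first by rewrite tp tp'.
  rewrite -[k in LHS](permKV s) -[k in RHS](permKV s') hs hs'; apply: contraTeq isT => /sep.
  rewrite -hs -hs' !permKV; have := cp k; have := cp' k.
  move=> h1 h2; have := ler_distD (bary x k) (bary p k) (bary p' k).
  by rewrite (distrC (bary p k) (bary x k)); lra.
pose base x := xget x [set p | same T p0 p /\ nearby r p x].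
have baseE p x : same T p0 p -> nearby r p x -> base x = p.
  move=> hp cp; rewrite /base; case: xgetP => [y -> [hy cy]|/(_ p)[]//].
  exact: nearby_uniq cp.
exists (fibre_nbhd T p0 r), (t \o base); split.
- exact: fibre_nbhd_open.
- exact: fibre_nbhd_saturated.
- exact: fibre_nbhd_self.
split=> [x [p hp cp]|x x' f s c [p hp cp] _ g hc].
  have [r' r'0 hr'] := nearby_open cp; exists r' => // x' _ /hr' cp' /=.
  by rewrite !(baseE p).
have [p' gp' cp'] := glues_follow (coord_gap_same gap hp) cp g.
have hp' : same T p0 p' by apply: rst_trans hp (glues_same gp').
rewrite /= (baseE p x) // (baseE p' x') //; have [tp hcl] := cp.
rewrite -tp; apply: (ht _ _ _ s) => //.
have [s' hs'] := same_perm hp.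
have ha' : 1/2 < bary p (s' a) by rewrite hs'.
suff -> : c = s' a by [].
apply: big_coord_uniq hc _.
by have := hcl (s' a); rewrite ltr_norml hs' => /andP[? _]; lra.
Qed.

End LocalExistence.

(** * Charts of the realization *)

Section Quotient.
Context {R : realType} {n : nat} (T : gluing n).
Notation pieces := (@pieces R n).

Definition to_space (p : pieces) : realization R T :=
  (\pi_({eq_quot (same_point T)}) p)%qT.

Lemma to_space_eq p p' : to_space p = to_space p' <-> same T p p'.
Proof.
split; first by move=> /eqmodP /asboolP.
by move=> h; apply/eqmodP/asboolP.
Qed.

Lemma to_space_surj x : exists p, to_space p = x.
Proof. by exists (generic_quotient.repr x); exact: generic_quotient.reprK. Qed.

(** A saturated set is the preimage of its image, so its image is open. *)
Lemma open_to_space (O : set pieces) : open O -> saturated T O -> open (to_space @` O).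
Proof.
move=> oO sO; rewrite /open /= /quotient_open.
suff -> : (\pi_(quotient_topology {eq_quot (same_point T)}%qT) @^-1` (to_space @` O))%qT = O by [].
apply/seteqP; split=> [p [p' Op' /to_space_eq h]|p Op]; last by exists p.
exact: (same_ind (Q := O) _ h Op').
Qed.

Lemma to_space_image (O : set pieces) p : saturated T O -> (to_space @` O) (to_space p) -> O p.
Proof.
by move=> sO [p' Op' /to_space_eq h]; exact: (same_ind (Q := O) _ h Op').
Qed.

Lemma to_space_open (O : set (realization R T)) : open O -> open (to_space @^-1` O).
Proof. by []. Qed.

Lemma glues_to_space p p' f s : glues T p p' f s -> to_space p = to_space p'.
Proof. by move=> /glues_same /to_space_eq. Qed.

End Quotient.

(** A homeomorphism between subspaces, as a pair of total maps with relative
    continuity. *)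
Lemma chart (X Z : topologicalType) (U : set X) (A : set Z) (x0 : X) : open U -> U x0 ->
  homeomorphic (set_type U) (set_type A) -> exists (phi : X -> Z) (psi : Z -> X),
  [/\ forall x, U x -> A (phi x) /\ psi (phi x) = x,
      forall z, A z -> U (psi z) /\ phi (psi z) = z,
      forall x N, U x -> nbhs (phi x) N ->
        exists O, [/\ open O, O x, O `<=` U & forall y, O y -> N (phi y)] &
      forall z O, A z -> open O -> O (psi z) -> \forall w \near z, A w -> O (psi w)].
Proof.
move=> oU Ux0 [f [g [cf cg fK gK]]].
pose inU x (h : U x) : set_type U := exist (fun x => x \in U) x (mem_set h).
pose inA x (h : A x) : set_type A := exist (fun x => x \in A) x (mem_set h).
pose z0 := set_val (f (inU x0 Ux0)).
pose phi x := if pselect (U x) is left h then set_val (f (inU x h)) else z0.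
pose psi z := if pselect (A z) is left h then set_val (g (inA z h)) else x0.
have phiE (x : set_type U) : phi (set_val x) = set_val (f x).
  rewrite /phi; case: pselect => [h|]; last by have := set_mem (valP x).
  by congr (set_val (f _)); exact: val_inj.
have psiE (z : set_type A) : psi (set_val z) = set_val (g z).
  rewrite /psi; case: pselect => [h|]; last by have := set_mem (valP z).
  by congr (set_val (g _)); exact: val_inj.
exists phi, psi; split.
- move=> x Ux; have /= E := phiE (inU x Ux); rewrite set_valE /= in E.
  by rewrite E psiE fK; split => //; exact: (set_mem (valP (f (inU x Ux)))).
- move=> z Az; have /= E := psiE (inA z Az); rewrite set_valE /= in E.
  by rewrite E phiE gK; split => //; exact: (set_mem (valP (g (inA z Az)))).
- move=> x N Ux nN.
  have E := phiE (inU x Ux); rewrite [set_val _ in LHS]/= in E.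
  have : nbhs (inU x Ux) (f @^-1` (set_val @^-1` N)).
    apply: cf; apply: (@initial_continuous _ _ (set_val : set_type A -> Z)).
    by rewrite -E.
  rewrite nbhsE => -[B [[C oC CB] Bx] BN].
  exists (C `&` U); split.
  + exact: openI.
  + by split=> //; have : (set_val @^-1` C) (inU x Ux) by rewrite CB.
  + by move=> y [].
  move=> y [Cy Uy]; have E' := phiE (inU y Uy); rewrite [set_val _ in LHS]/= in E'.
  rewrite [phi y]E'; apply: BN; rewrite -CB.
  exact: Cy.
- move=> z O Az oO; have E := psiE (inA z Az); rewrite [set_val _ in LHS]/= in E.
  rewrite [psi z]E => Oz.
  have : nbhs (inA z Az) (g @^-1` (set_val @^-1` O)).
    apply: cg; apply: (@initial_continuous _ _ (set_val : set_type U -> X)).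
    exact: open_nbhs_nbhs.
  rewrite nbhsE => -[B [[C oC CB] Bz] BO].
  have Cz : C z by have : (set_val @^-1` C) (inA z Az) by rewrite CB.
  apply: (@filterS _ _ _ C); last exact: open_nbhs_nbhs.
  move=> w Cw Aw; have E' := psiE (inA w Aw); rewrite [set_val _ in LHS]/= in E'.
  by rewrite [psi w]E'; apply: BO; rewrite -CB.
Qed.

(** * Potentials on the vertex links *)

Section VertexPotential.
Context {R : realType} {n : nat} (T : gluing n) (q : quadvec R n).
Hypothesis hT : compact_3manifold R (realization R T).
Hypothesis qm : quad_matching T q.
Notation pieces := (@pieces R n).
Notation Z := 'rV[R]_3.
Implicit Types (p : pieces) (O : set pieces).
Variable c0 : corner n.
Let V (c : corner n) := connect (corner_adj T) c0 c.

Lemma link_corner_step i c f j s :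
  V (i, c) -> glue T i f = Some (j, s) -> c != f -> V (j, s c).
Proof.
move=> h g cf; apply: connect_trans h (connect1 _).
by apply/existsP; exists f; rewrite eq_sym cf /= g.
Qed.

Definition is_apex p (c : corner n) := tag p = c.1 /\ bary p c.2 = 1.

Lemma apex_coord p c a : is_apex p c -> bary p a = (a == c.2)%:R.
Proof.
move=> [_ pc]; have [->//|ac] := eqVneq a c.2.
have := bary_sum p; rewrite (bigD1 c.2) //= (bigD1 a) //= pc.
have : 0 <= \sum_(i | (i != c.2) && (i != a)) bary p i by apply: sumr_ge0 => ? _; exact: bary_ge0.
have := bary_ge0 p a; lra.
Qed.

Lemma apex_exists c : exists p, is_apex p c.
Proof.
have [||p [tp bp]] := @piece_exists R n c.1 (fun a => (a == c.2)%:R).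
- by move=> a; exact: ler0n.
- by rewrite (bigD1 c.2) //= eqxx big1 ?addr0 // => a /negbTE ->.
by exists p; rewrite /is_apex bp eqxx.
Qed.

Lemma apex_uniq p p' c : is_apex p c -> is_apex p' c -> p = p'.
Proof.
move=> h h'; apply: piece_ext; first by rewrite h.1 h'.1.
by move=> a; rewrite (apex_coord _ h) (apex_coord _ h').
Qed.

Lemma apex_same p p' c c' : connect (corner_adj T) c c' -> is_apex p c ->
  is_apex p' c' -> to_space T p = to_space T p'.
Proof.
move=> /connectP[e]; elim: e c p => [|d e IH] c p /=.
  by move=> _ -> hp hp'; rewrite (apex_uniq hp hp').
move=> /andP[/existsP[f /andP[fc adj]] pe] de hp hp'.
move: adj; case g : (glue T c.1 f) => [[j s]|] // /eqP dE.
have gp : glue T (tag p) f = Some (j, s) by rewrite hp.1.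
have pf : bary p f = 0 by rewrite (apex_coord _ hp) (negbTE fc).
have [p1 [tp1 gp1]] := glues_move gp pf.
rewrite (glues_to_space gp1); apply: IH pe de _ hp'.
by rewrite dE; split=> //=; case: gp1 => _ _ ->; exact: hp.2.
Qed.

Definition cone (e : R) : set pieces :=
  [set p | exists a, V (tag p, a) /\ 1 - e < bary p a].

Lemma cone_open e : open (cone e).
Proof.
apply/open_pieces => p [a [Va ha]]; exists (bary p a - (1 - e)); first lra.
move=> p' [tp cp]; exists a; rewrite -tp; split=> //.
by have := cp a; rewrite ltr_norml => /andP[? _]; lra.
Qed.

Lemma cone_saturated e : e <= 1/2 -> saturated T (cone e).
Proof.
move=> e2 p p' f s [g pf E] [a [Va ha]].
exists (s a); rewrite E; split=> //; apply: link_corner_step Va g _.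
by apply: contraTneq ha => ->; rewrite pf -leNgt; lra.
Qed.

(** A copy of the link of the vertex, at distance e from the vertex in each corner. *)
Definition level (e : R) : set pieces :=
  [set p | exists a, V (tag p, a) /\ bary p a = 1 - e].

Lemma level_compl_open e : open (~` level e).
Proof.
apply/open_pieces => p nl.
have [a|r r0 hr] := @fin_min R _ (fun a r => forall p', nearby r p p' ->
    ~ (V (tag p', a) /\ bary p' a = 1 - e)).
  have [Va|nVa] := pselect (V (tag p, a)); last first.
    by exists 1 => // r' _ _ p' [<- _] [].
  have ne : bary p a != 1 - e by apply: contra_notN nl => /eqP ?; exists a.
  exists `|bary p a - (1 - e)|; first by rewrite normr_gt0 subr_eq0.
  move=> r' _ r'r p' [_ cp] [_ E]; have := cp a; rewrite E distrC => h.
  by have := lt_le_trans h r'r; rewrite ltxx.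
by exists r => // p' cp [a ha]; exact: (hr a r r0 (lexx _) p' cp).
Qed.

Lemma level_saturated e : e < 1 -> saturated T (level e).
Proof.
move=> e1 p p' f s [g pf E] [a [Va ha]].
exists (s a); rewrite E; split=> //; apply: link_corner_step Va g _.
by apply: contraTneq isT => af; move: ha; rewrite af pf => ?; exfalso; lra.
Qed.

Lemma level_compl_saturated e : e < 1 -> saturated T (~` level e).
Proof.
move=> e1 p p' f s g nl l; apply: nl; exact: (level_saturated e1 (glues_sym g) l).
Qed.

Lemma segment (p p' : pieces) (u : R) : tag p = tag p' -> 0 <= u <= 1 ->
  exists x : pieces, tag x = tag p /\ forall a, bary x a = bary p a + u * (bary p' a - bary p a).
Proof.
move=> tp /andP[u0 u1]; apply: piece_exists => [a|].
  have := bary_ge0 p a; have := bary_ge0 p' a.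
  rewrite (_ : _ + _ = (1 - u) * bary p a + u * bary p' a); last by lra.
  by move=> ? ?; apply: addr_ge0; apply: mulr_ge0 => //; lra.
by rewrite big_split /= -mulr_sumr sumrB !bary_sum subrr mulr0 addr0.
Qed.

(** The triangle that [level e] cuts from the corner is convex; Cousin's lemma
    is applied along the segment from p to p'. *)
Lemma level_const e (t : pieces -> R) p p' a :
  (forall p, level e p -> exists2 r, 0 < r & forall p', level e p' -> nearby r p p' -> t p' = t p) ->
  tag p = tag p' -> V (tag p, a) -> bary p a = 1 - e -> bary p' a = 1 - e -> t p = t p'.
Proof.
move=> loc tp Va pa pa'.
have [x hx] : exists x : R -> pieces, forall u, 0 <= u <= 1 -> tag (x u) = tag p /\
    forall b, bary (x u) b = bary p b + u * (bary p' b - bary p b).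
  suff /choice[x hx] : forall u : R, exists y : pieces, 0 <= u <= 1 -> tag y = tag p /\
      forall b, bary y b = bary p b + u * (bary p' b - bary p b) by exists x.
  move=> u; have [h|h] := boolP (0 <= u <= 1); last by exists p.
  by have [y hy] := segment tp h; exists y.
have lx u : 0 <= u <= 1 -> level e (x u).
  by move=> /hx[tx bx]; exists a; rewrite tx bx pa pa' subrr mulr0 addr0.
have x0 : x 0 = p.
  have [|tx bx] := hx 0; first by rewrite lexx ler01.
  by apply: piece_ext => // b; rewrite bx mul0r addr0.
have x1 : x 1 = p'.
  have [|tx bx] := hx 1; first by rewrite lexx ler01.
  by apply: piece_ext => [|b]; rewrite ?tx // bx mul1r addrC subrK.
rewrite -x0 -x1; apply: (@cousin R (fun u w => t (x u) = t (x w))) => //.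
  by move=> u w z _ _ -> ->.
move=> u hu; have [r r0 hr] := loc _ (lx u hu).
exists r => // c d c0' cd d1 hc hd.
suff H w : 0 <= w <= 1 -> `|w - u| < r -> t (x w) = t (x u).
  by rewrite !H //; apply/andP; split; lra.
move=> hw wu; apply: hr; first exact: lx.
have [tu bu] := hx u hu; have [tw bw] := hx w hw.
split=> [|k]; first by rewrite tu tw.
rewrite bu bw (_ : _ - _ = (w - u) * (bary p' k - bary p k)); last by lra.
rewrite normrM; apply: le_lt_trans wu; rewrite ler_piMr //.
have le1 (y : pieces) : bary y k <= 1.
  rewrite -(bary_sum y) (bigD1 k) //= lerDl; apply: sumr_ge0 => ? _; exact: bary_ge0.
have := bary_ge0 p k; have := bary_ge0 p' k; have := le1 p; have := le1 p'.
by move=> *; rewrite ler_norml; apply/andP; split; lra.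
Qed.

Lemma level_piece e (i : 'I_n) (c f : 'I_4) : 0 < e -> e < 1 -> c != f ->
  exists p : pieces, [/\ tag p = i, bary p c = 1 - e & bary p f = 0].
Proof.
move=> e0 e1 cf.
have [d [dc df]] : exists d : 'I_4, d != c /\ d != f.
  have : ~~ ([set: 'I_4] \subset [set c; f])%SET.
    apply/negP => /subset_leq_card; rewrite cardsT card_ord cards2; by case: (c != f).
  by move=> /fintype.subsetPn[d _]; rewrite !inE negb_or => /andP[? ?]; exists d.
have [||p [tp bp]] := @piece_exists R n i (fun a => if a == c then 1 - e else
    if a == d then e else 0).
- by move=> a; case: ifP => _; [lra|case: ifP => _ //; lra].
- rewrite (bigD1 c) //= (bigD1 d) //= eqxx (negbTE dc) eqxx big1 ?addr0; last first.
    by move=> a /andP[/negbTE -> /negbTE ->].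
  lra.
exists p; split=> //; rewrite bp ?eqxx // eq_sym (negbTE cf) eq_sym (negbTE df) //.
Qed.


(** In a chart at the vertex, the points at distance between b and a from the
    image of the vertex form a shell, over which jump sections exist locally, hence
    globally by [section_shell].  The shell contains a copy of the link; the section is
    constant on each triangle of the link, and its values there are t. *)
Lemma vertex_potential : exists t : corner n -> R, forall i f j s c,
  V (i, c) -> glue T i f = Some (j, s) -> c != f ->
  t (j, s c) = t (i, c) + jump T q i c f.
Proof.
have [a0 ha0] := apex_exists c0.
have cone_a0 e : 0 < e -> cone e a0.
  by move=> e0; exists c0.2; rewrite ha0.1 ha0.2 -surjective_pairing; split; [exact: connect0|lra].
set v0 := to_space T a0.
have [_ _ _ /(_ v0)[U [W [oU Uv0 oW /(chart oU Uv0)]]]] := hT.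
set A := W `&` @half_space R => -[phi [psi [phiA psiU phi_cont psi_cont]]].
pose v := phi v0; have [Av psiv] : A v /\ psi v = v0 := phiA _ Uv0.
have vz : 0 <= v 0 ord_max := Av.2.
have half1 : (1/2 : R) <= 1/2 by [].
have half_lt1 : (1/2 : R) < 1 by lra.
have near_v O : open O -> saturated T O -> O a0 ->
    \forall w \near v, A w -> (to_space T @` O) (psi w).
  move=> oO sO Oa; apply: psi_cont => //; first exact: open_to_space.
  by rewrite psiv; exists a0.
clear psiv.
(* The chart covers the cube of radius a, and this part of the half space comes
   from the cone over the link; the cube is inside the half space unless its centre
   is on the boundary plane. *)
have [a [a_gt0 az sub_cone subW]] : exists a, [/\ 0 < a, v 0 ord_max = 0 \/ a <= v 0 ord_max,
    forall w : Z, A w -> `|w 0 0 - v 0 0| <= a -> `|w 0 1 - v 0 1| <= a ->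
      `|w 0 ord_max - v 0 ord_max| <= a -> (to_space T @` cone (1/2)) (psi w) &
    forall w : Z, `|w 0 0 - v 0 0| <= a -> `|w 0 1 - v 0 1| <= a ->
      `|w 0 ord_max - v 0 ord_max| <= a -> W w].
  have c2 : 0 < (1/2 : R) by lra.
  have nW : \forall w \near v, W w by apply: open_nbhs_nbhs; split=> //; exact: Av.1.
  have n1 := near_v _ (@cone_open (1/2)) (cone_saturated half1) (cone_a0 _ c2).
  have nI := @filterI _ (nbhs v) (nbhs_filter v) _ _ n1 nW.
  have [e e0 He] := iffLR (@nbhs_coord _ _ _) nI.
  pose a := if v 0 ord_max == 0 then e / 2 else Num.min (e / 2) (v 0 ord_max).
  have ae : a <= e / 2 by rewrite /a; case: ifP => _ //; rewrite ge_min lexx.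
  have a0' : 0 < a.
    rewrite /a; case: ifP => vz0; first lra.
    have vpos : 0 < v 0 ord_max by rewrite lt_def vz0 vz.
    by rewrite lt_min vpos andbT; lra.
  have He' (w : Z) : `|w 0 0 - v 0 0| <= a -> `|w 0 1 - v 0 1| <= a ->
      `|w 0 ord_max - v 0 ord_max| <= a -> (A w -> (to_space T @` cone (1/2)) (psi w)) /\ W w.
    by move=> h1 h2 h3; apply: He; lra.
  exists a; split=> //.
  - by rewrite /a; case: ifP => [/eqP|_]; [left|right; rewrite ge_min lexx orbT].
  - by move=> w Aw h1 h2 h3; have [h _] := He' w h1 h2 h3; exact: h.
  - by move=> w h1 h2 h3; have [_] := He' w h1 h2 h3.
pose zl := if v 0 ord_max == 0 then v 0 ord_max else v 0 ord_max - a.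
have zlP : zl = v 0 ord_max \/ zl = v 0 ord_max - a by rewrite /zl; case: ifP; [left|right].
have zl0 : 0 <= zl.
  by rewrite /zl; case: ifP => [/eqP ->//|/eqP v0']; case: az => // ?; lra.
(* By continuity at the vertex, the link at a small height e is mapped into the
   cube of radius a. *)
have [e [e_gt0 e_half conea]] : exists e, [/\ 0 < e, e < 1/2 & forall p, level e p ->
    U (to_space T p) /\ [/\ `|phi (to_space T p) 0 0 - v 0 0| < a,
      `|phi (to_space T p) 0 1 - v 0 1| < a &
      `|phi (to_space T p) 0 ord_max - v 0 ord_max| < a]].
  pose N := [set w : Z | [/\ `|w 0 0 - v 0 0| < a, `|w 0 1 - v 0 1| < a &
    `|w 0 ord_max - v 0 ord_max| < a]].
  have nN : nbhs v N by apply/nbhs_coord; exists a.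
  have [O [oO Ov OU ON]] := phi_cont _ _ Uv0 nN.
  have [c|r r0 hr] := @fin_min R _ (fun (c : corner n) r => V c -> forall p,
      tag p = c.1 -> 1 - r < bary p c.2 -> O (to_space T p)).
    have [Vc|nVc] := boolP (V c); last by exists 1.
    have [ac hac] := apex_exists c.
    have Oac : O (to_space T ac) by rewrite -(apex_same Vc ha0 hac).
    have /open_pieces/(_ ac Oac)[r r0 hr] := to_space_open oO.
    exists r => // r' r'0 r'r _ p tp bp; apply: hr; split=> [|k]; first by rewrite hac.1 tp.
    rewrite (apex_coord _ hac).
    have := bary_sum p; rewrite (bigD1 c.2) //=.
    have [->|kc] := eqVneq k c.2.
      have : 0 <= \sum_(i | i != c.2) bary p i by apply: sumr_ge0 => ? _; exact: bary_ge0.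
      by move=> *; rewrite ltr_norml /= mulr1n; apply/andP; split; lra.
    rewrite (bigD1 k) //=.
    have : 0 <= \sum_(i | (i != c.2) && (i != k)) bary p i by apply: sumr_ge0 => ? _; exact: bary_ge0.
    by have := bary_ge0 p k => *; rewrite ltr_norml /= mulr0n; apply/andP; split; lra.
  pose e := Num.min (r / 2) (1/4).
  have er : e <= r / 2 by rewrite ge_min lexx.
  have e4 : e <= 1/4 by rewrite ge_min lexx orbT.
  have e0 : 0 < e by rewrite lt_min; apply/andP; split; lra.
  exists e; split=> //; first by lra.
  move=> p [b [Vb hb]].
  have Op : O (to_space T p).
    by apply: (hr (tag p, b) r r0 (lexx _) Vb p erefl); rewrite hb /=; lra.
  by split; [exact: OU|exact: ON].
(* The level set is closed and misses the vertex, so its image misses a cube of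
   some radius b. *)
have [b [b_gt0 ba outb]] : exists b, [/\ 0 < b, b < a & forall w, A w ->
    `|w 0 0 - v 0 0| < b -> `|w 0 1 - v 0 1| < b -> `|w 0 ord_max - v 0 ord_max| < b ->
    (to_space T @` ~` level e) (psi w)].
  have e1 : e < 1 by lra.
  have nl : (~` level e) a0.
    move=> [c [_]]; rewrite (apex_coord _ ha0); by case: eqP => _ /=; rewrite ?mulr1n ?mulr0n => ?; lra.
  have nI := near_v _ (@level_compl_open e) (level_compl_saturated e1) nl.
  have [r r0 hr] := iffLR (@nbhs_coord _ _ _) nI; exists (Num.min r (a / 2)); split.
  - by rewrite lt_min r0 /=; lra.
  - by rewrite gt_min; apply/orP; right; lra.
  by move=> w Aw; rewrite !lt_min => /andP[h1 _] /andP[h2 _] /andP[h3 _]; exact: hr.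
pose D := [set p : pieces | U (to_space T p)].
pose Phi p := phi (to_space T p).
pose S (N : set Z) (t : pieces -> R) := jump_section T q [set p | D p /\ N (Phi p)] t.
have S_sub N N' t : N' `<=` N -> S N t -> S N' t.
  by move=> NN; apply: jump_section_sub => p [? /NN].
have S_shift N t c : S N t -> S N (fun p => t p + c) by exact: jump_section_shift.
have shellA z : shell v a b zl z -> A z.
  move=> /(shell_bound zlP)[h1 h2 h3 hz]; split; first exact: subW.
  exact: le_trans zl0 hz.
have triv z : shell v a b zl z -> locally_trivial_at D Phi S z.
  move=> hz; have Az := shellA z hz; have [Uz phiz] := psiU z Az.
  have [p hp] := to_space_surj (psi z).
  have Dp : D p by rewrite /D /= hp.
  have Phip : Phi p = z by rewrite /Phi hp.
  have cp : cone (1/2) p.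
    apply: (to_space_image (cone_saturated half1)); rewrite hp.
    by have [h1 h2 h3 _] := shell_bound zlP hz; exact: sub_cone.
  have [c [Vc hc]] := cp; have {}hc : 1/2 < bary p c by lra.
  have [d [dc hd]] : exists d, c != d /\ bary p d != 0.
    apply: contrapT => nd.
    have pc : bary p c = 1.
      have := bary_sum p; rewrite (bigD1 c) //= big1 ?addr0 // => d dc.
      by apply/eqP; apply: contra_notT nd => h; exists d; rewrite eq_sym.
    have E : psi z = v0 by rewrite -hp; apply/esym; apply: (apex_same Vc ha0).
    by move: hz; rewrite -phiz E; exact: shell_center.
  split.
  - by exists p.
  - have [O [t [oO sO Op jt]]] := jump_section_exists qm dc hc hd.
    exists [set w | A w -> (to_space T @` O) (psi w)], t; split.
      apply: psi_cont => //; first exact: open_to_space.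
      by rewrite -hp; exists p.
    apply: jump_section_sub jt => p' [Up' h].
    have [Ap' pp'] := phiA _ Up'.
    by have := h Ap'; rewrite pp'; exact: to_space_image.
  move=> N s t nN Ss St.
  have [|O [oO Oz OU ON]] := phi_cont (psi z) N Uz; first by rewrite phiz.
  have sub : to_space T @^-1` O `<=` [set p | D p /\ N (Phi p)].
    by move=> p' Op'; split; [exact: OU|exact: ON].
  have [p' /to_space_eq pp'|k [O' [oO' sO' Op' st]]] := jump_section_uniq hc (to_space_open oO) _
    (jump_section_sub sub Ss) (jump_section_sub sub St).
    by rewrite /= -pp' hp.
  exists k.
  have := psi_cont z _ Az (open_to_space oO' sO'); rewrite -hp => /(_ (ex_intro2 _ _ p Op' erefl)).
  apply: filterS => w Hw p1 Dp1 Phip1; apply: st; apply: (to_space_image sO').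
  have [Ap1 <-] := phiA _ Dp1; rewrite -/(Phi p1) Phip1; apply: Hw.
  by rewrite -Phip1.
have [t secT] := section_shell S_sub S_shift b_gt0 ba zlP triv.
have level_shell p : level e p -> shell v a b zl (Phi p).
  move=> lp; have [Up [h1 h2 h3]] := conea p lp.
  have [Ap psip] := phiA _ Up.
  apply: shell_intro => //; first by rewrite /zl; case: ifP => [/eqP ->|_];
      [exact: Ap.2|by move: h3; rewrite ltr_distl => /andP[/ltW]].
  move=> [k1 k2 k3]; have := outb _ Ap k1 k2 k3.
  by rewrite psip => /(to_space_image (level_compl_saturated (lt_trans e_half half_lt1))); apply.
have tloc p : level e p -> exists2 r, 0 < r & forall p', level e p' -> nearby r p p' -> t p' = t p.
  move=> lp; have [N [s [nN [loc _] eN]]] := secT _ (level_shell _ lp).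
  have Dp := (conea p lp).1.
  have [r1 r10 h1] := loc p (conj Dp (nbhs_singleton nN)).
  have [O [oO Op OU ON]] := phi_cont _ _ Dp nN.
  have /open_pieces/(_ p Op)[r2 r20 h2] := to_space_open oO.
  exists (Num.min r1 r2); first by rewrite lt_min r10.
  move=> p' lp' [tp cp].
  have n1 : nearby r1 p p' by split=> // k; have := cp k; rewrite lt_min => /andP[].
  have n2 : nearby r2 p p' by split=> // k; have := cp k; rewrite lt_min => /andP[].
  have Np' : N (Phi p') by apply: ON; exact: h2.
  rewrite (eN p') //; [|exact: (conea p' lp').1|exact: level_shell].
  rewrite (eN p) //; [|exact: nbhs_singleton nN|exact: level_shell].
  by apply: h1 => //; split=> //; exact: (conea p' lp').1.
pose pt (c : corner n) := xget a0 [set p | tag p = c.1 /\ bary p c.2 = 1 - e].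
have ptE c p : V c -> tag p = c.1 -> bary p c.2 = 1 - e -> t (pt c) = t p.
  move=> Vc tp bp; rewrite /pt; case: xgetP => [p' -> [tp' bp']|/(_ p)[]//].
  apply: (level_const tloc (a := c.2)) => //; first by rewrite tp tp'.
  by rewrite tp' -surjective_pairing.
exists (t \o pt) => i f j s c Vc g cf /=.
have e1 : e < 1 by lra.
have [p [tp bc bf]] := level_piece i e_gt0 e1 cf.
have gp : glue T (tag p) f = Some (j, s) by rewrite tp.
have [p' [tp' gp']] := glues_move gp bf.
have bp' : bary p' (s c) = 1 - e by case: gp' => _ _ ->.
have lp : level e p by exists c; rewrite tp.
have lp' : level e p' by exact: level_saturated gp' lp.
rewrite (ptE (j, s c) p') //; last exact: link_corner_step Vc g cf.
rewrite (ptE (i, c) p) //.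
have [N [s' [nN [_ jmp] eN]]] := secT _ (level_shell _ lp).
have Np := nbhs_singleton nN.
have PhiE : Phi p' = Phi p by rewrite /Phi (glues_to_space gp').
rewrite (eN p') ?PhiE //; [|exact: (conea p' lp').1|exact: level_shell].
rewrite (eN p) //; [|exact: (conea p lp).1|exact: level_shell].
rewrite -tp; apply: (jmp p p' f s c) => //.
- by split=> //; exact: (conea p lp).1.
- by rewrite /= PhiE; split=> //; exact: (conea p' lp').1.
- by rewrite bc; lra.
Qed.

End VertexPotential.

(** * Lifting quadrilateral solutions *)

Section Matching.
Context {R : realType} {n : nat} (T : gluing n).
Implicit Types (w x : stdvec R n) (c d : corner n).

Lemma corner_adj_sym : connect_sym (corner_adj T).
Proof.
apply: sym_connect_sym => c d.
suff imp c' d' : corner_adj T c' d' -> corner_adj T d' c' by apply/idP/idP; exact: imp.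
move=> /existsP[f /andP[fc]]; case g : (glue T c'.1 f) => [[j s]|] // /eqP ->.
apply/existsP; exists (s f); rewrite /= (inj_eq perm_inj) fc (glue_sym g) permK.
by apply/eqP; case: (c') => ? ?.
Qed.

Lemma std_index (p : 'I_(4 + 3)) :
  (exists a, p = tri a) \/ (exists k, p = quad k).
Proof.
by case: (split_ordP p) => [a ->|k ->]; [left; exists a|right; exists k].
Qed.

Lemma qprojE w i k : qproj w i k = w i (quad k).
Proof. by rewrite mxE. Qed.

Lemma std_matching_lin (a b : R) w x : std_matching T w -> std_matching T x ->
  std_matching T (a *: w + b *: x).
Proof.
move=> hw hx i f j s g c cf; have := hw _ _ _ _ g c cf; have := hx _ _ _ _ g c cf.
rewrite !mxE => h1 h2; rewrite addrACA -!mulrDr h1 h2 !mulrDr; exact: addrACA.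
Qed.

(** The triangle coordinates at the lower end of the edge telescope around the
    cycle. *)
Lemma std_matching_quad w : std_matching T w -> quad_matching T (qproj w).
Proof.
move=> hw c /andP[cyc uc].
pose t (F : flag n) := w F.1 (tri (lower F)).
have step F G : turn T F G -> t F + qproj w F.1 (downward F) = t G + qproj w G.1 (upward G).
  rewrite /turn; case g : (glue T F.1 (exit F)) => [[j s]|] //.
  move=> /and4P[/eqP G1 /eqP Gl _ /eqP Ge].
  have lf : lower F != exit F by rewrite /lower /exit (inj_eq perm_inj).
  by rewrite /t /upward !qprojE -quad_flag (hw _ _ _ _ g _ lf) -Gl -Ge G1.
have : \sum_(F <- c) (t F + qproj w F.1 (downward F)) =
       \sum_(F <- c) (t (next c F) + qproj w (next c F).1 (upward (next c F))).
  by apply: eq_big_seq => F Fc; apply: step; exact: next_cycle.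
have nextE (f : flag n -> R) : \sum_(F <- c) f (next c F) = \sum_(F <- c) f F.
  rewrite -(big_map (next c) xpredT f); apply: perm_big.
  apply: uniq_perm => //; first by rewrite map_inj_uniq //; exact: can_inj (prev_next uc).
  move=> F; apply/mapP/idP => [[G Gc ->]|Fc]; first by rewrite mem_next.
  by exists (prev c F); rewrite ?mem_prev // next_prev.
by rewrite (nextE (fun G => t G + qproj w G.1 (upward G))) !big_split /= => /addrI ->.
Qed.

(** Without quadrilaterals, the matching equations say that the triangle
    coordinates agree across faces. *)
Lemma std_matching_connect w c d : std_matching T w -> qproj w = 0 ->
  connect (corner_adj T) c d -> w c.1 (tri c.2) = w d.1 (tri d.2).
Proof.
move=> hw w0 /connectP[e]; elim: e c => [|d' e IH] c /=; first by move=> _ ->.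
move=> /andP[/existsP[f /andP[fc]]]; case g : (glue T c.1 f) => [[j s]|] // /eqP d'E pe dE.
rewrite -(IH _ pe dE) d'E; have := hw _ _ _ _ g c.2; rewrite eq_sym fc => /(_ isT).
by rewrite -!qprojE w0 !mxE !addr0.
Qed.

Lemma std_matching_exists (q : quadvec R n) : compact_3manifold R (realization R T) ->
  quad_matching T q -> exists2 w, std_matching T w & qproj w = q.
Proof.
move=> hT qm.
have /choice[t ht] := vertex_potential hT qm.
pose r c := fingraph.root (corner_adj T) c.
pose w : stdvec R n := row_mx (\matrix_(i, a) t (r (i, a)) (i, a)) q.
have wt i a : w i (tri a) = t (r (i, a)) (i, a) by rewrite /w /tri row_mxEl mxE.
have wq i k : w i (quad k) = q i k by rewrite /w /quad row_mxEr.
exists w; last by apply/matrixP => i k; rewrite qprojE.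
move=> i f j s g c cf; rewrite !wt !wq.
have adj : connect (corner_adj T) (i, c) (j, s c).
  by apply: connect1; apply/existsP; exists f; rewrite eq_sym cf /= g.
have -> : r (j, s c) = r (i, c) by apply/esym/(fingraph.rootP corner_adj_sym).
rewrite (ht (r (i, c)) i f j s c) //; last by rewrite corner_adj_sym connect_root.
by rewrite /jump g; lra.
Qed.

(** Subtracting from the triangle coordinates their minimum over each vertex class
    makes a lift of q canonical, so the set from which [canonical_ext] picks is
    nonempty. *)
Lemma canonical_ext_spec (q : quadvec R n) : compact_3manifold R (realization R T) ->
  quad_matching T q -> (forall i k, 0 <= q i k) -> quad_constraints q ->
  std_matching T (canonical_ext T q) /\ qproj (canonical_ext T q) = q.
Proof.
move=> hT qm q0 qc; have [w hw wq] := std_matching_exists hT qm.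
pose t c := w c.1 (tri c.2).
pose lo c := [arg min_(d < c | connect (corner_adj T) c d) t d]%O.
have loP c : connect (corner_adj T) c (lo c) /\
    forall d, connect (corner_adj T) c d -> t (lo c) <= t d.
  rewrite /lo; case: arg_minP => [|d cd dmin]; first exact: connect0.
  by split.
have lo_eq c d : connect (corner_adj T) c d -> t (lo c) = t (lo d).
  move=> cd; have [h1 h2] := loP c; have [h3 h4] := loP d.
  apply/le_anti; rewrite h2 ?h4 //; first by rewrite (connect_trans _ h1) // corner_adj_sym.
  exact: connect_trans cd h3.
pose x : stdvec R n := row_mx (\matrix_(i, a) (t (i, a) - t (lo (i, a)))) q.
have xt i a : x i (tri a) = t (i, a) - t (lo (i, a)) by rewrite /x /tri row_mxEl mxE.
have xq i k : x i (quad k) = q i k by rewrite /x /quad row_mxEr.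
have qx : qproj x = q by apply/matrixP => i k; rewrite qprojE.
suff [h _ h'] : [/\ std_admissible T (canonical_ext T q), Defs.canonical T (canonical_ext T q) &
    qproj (canonical_ext T q) = q] by split; [case: h|].
apply: (xgetPex 0 (P := [set x | [/\ std_admissible T x, Defs.canonical T x & qproj x = q]])).
exists x; split=> //.
  split=> [i j|i f j s g c cf|]; last by rewrite qx.
    case: (std_index j) => [[a ->]|[k ->]]; last by rewrite xq.
    by rewrite xt subr_ge0; have [_] := loP (i, a); apply; exact: connect0.
  have := hw _ _ _ _ g c cf; rewrite !xt !xq -wq !qprojE.
  have -> : t (lo (i, c)) = t (lo (j, s c)).
    by apply: lo_eq; apply: connect1; apply/existsP; exists f; rewrite eq_sym cf /= g.
  by rewrite /t /= => E; rewrite addrAC E addrAC.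
move=> V /imsetP[c _ ->]; split=> [d|].
  by rewrite xt -surjective_pairing subr_ge0 => _; have [_] := loP d; apply; exact: connect0.
have [h1 h2] := loP c; exists (lo c); first by rewrite inE.
by rewrite xt -surjective_pairing (lo_eq _ _ h1) subrr.
Qed.

Section Link.
Variable V : {set corner n}.
Hypothesis hV : V \in vertices T.
Notation l := (vlink R V).

Lemma vlink_tri i a : l i (tri a) = ((i, a) \in V)%:R.
Proof. by rewrite /vlink /tri row_mxEl mxE. Qed.

Lemma vlink_quad i k : l i (quad k) = 0.
Proof. by rewrite /vlink /quad row_mxEr mxE. Qed.

Lemma vlink_qproj : qproj l = 0.
Proof. by apply/matrixP => i k; rewrite qprojE vlink_quad mxE. Qed.

Lemma vertex_connect c d : c \in V -> (d \in V) = connect (corner_adj T) c d.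
Proof.
move: hV => /imsetP[e _ ->]; rewrite !inE => ec.
apply/idP/idP; last exact: connect_trans.
by apply: connect_trans; rewrite corner_adj_sym.
Qed.

Lemma vertex_closed c d : connect (corner_adj T) c d -> (c \in V) = (d \in V).
Proof.
move=> cd; apply/idP/idP => h; rewrite (vertex_connect _ h) //.
by rewrite corner_adj_sym.
Qed.

Lemma vlink_matching : std_matching T l.
Proof.
move=> i f j s g c cf; rewrite !vlink_tri !vlink_quad; congr (_%:R + _).
congr nat_of_bool; apply: vertex_closed; apply: connect1.
by apply/existsP; exists f; rewrite eq_sym cf /= g.
Qed.

Lemma link_positionsP (p : position n) :
  reflect (exists2 c, c \in V & p = (c.1, tri c.2)) (p \in link_positions R V).
Proof.
apply: (iffP idP) => [|[c cV ->]]; rewrite inE /=; last first.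
  by rewrite vlink_tri -surjective_pairing cV oner_eq0.
case: p => i j /=; case: (std_index j) => [[a ->]|[k ->]].
  rewrite vlink_tri; case: ((i, a) \in V) / boolP => [h _|]; last by rewrite eqxx.
  by exists (i, a).
by rewrite vlink_quad eqxx.
Qed.

Lemma vlinkE (p : position n) : l p.1 p.2 = (p \in link_positions R V)%:R.
Proof.
have [/link_positionsP[c cV ->]|] := boolP (p \in _).
  by rewrite vlink_tri -surjective_pairing cV.
by rewrite inE negbK => /eqP.
Qed.

Lemma link_positions_neq0 : link_positions R V != finset.set0.
Proof.
move: (hV) => /imsetP[c _ VE]; apply/finset.set0Pn; exists (c.1, tri c.2).
by apply/link_positionsP; exists c => //; rewrite VE inE connect0.
Qed.

End Link.
End Matching.

(** * Zero sets and extremal rays *)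

(** Subtracting from f the largest multiple of g that keeps it nonnegative creates
    a new zero. *)
Lemma reduce_fun (R : realType) (I : finType) (C : {set I}) (f g : I -> R) :
  (forall i, i \in C -> 0 <= f i) -> (forall i, i \in C -> 0 <= g i) ->
  (forall i, i \in C -> f i = 0 -> g i = 0) -> (exists2 i, i \in C & g i != 0) ->
  exists a, [/\ 0 < a, forall i, i \in C -> 0 <= f i - a * g i &
    exists2 i, i \in C & f i != 0 /\ f i - a * g i = 0].
Proof.
move=> f0 g0 fg [p0 p0C gp0].
pose P p := (p \in C) && (g p != 0).
have Pp0 : P p0 by rewrite /P p0C.
have pos p : P p -> 0 < g p by move=> /andP[pC gp]; rewrite lt_def gp g0.
have fpos p : P p -> 0 < f p.
  move=> /andP[pC gp]; rewrite lt_def f0 // andbT; apply: contraNneq gp => fp.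
  by rewrite (fg p).
case: (@arg_minP _ _ _ p0 P (fun p => f p / g p) Pp0) => p Pp pmin.
have gp := pos p Pp; have fp := fpos p Pp.
exists (f p / g p); split; first by rewrite divr_gt0.
  move=> q qC; have [gq|gq] := eqVneq (g q) 0; first by rewrite gq mulr0 subr0 f0.
  have Pq : P q by rewrite /P qC.
  by rewrite subr_ge0 -ler_pdivlMr ?pos //; exact: pmin.
have [pC _] := andP Pp; exists p => //; split; first by rewrite gt_eqF.
by rewrite divfK ?subrr // gt_eqF.
Qed.

Section DoubleDescription.
Context {R : realType} {n : nat} (T : gluing n).
Implicit Types (u w x y z : stdvec R n) (p : position n) (C : {set position n}).

Lemma ev_lin (a b : R) u w p : ev (a *: u + b *: w) p = a * ev u p + b * ev w p.
Proof. by rewrite !mxE. Qed.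

Lemma entry_sub (a : R) x y i j : (x - a *: y) i j = x i j - a * y i j.
Proof. by rewrite !mxE. Qed.

(** Among the vectors that are nonnegative on C, z belongs to the smallest face
    that contains y. *)
Definition zle C y z := forall p, p \in C -> ev y p = 0 -> ev z p = 0.

Definition nonneg_on C w := forall p, p \in C -> 0 <= ev w p.

Definition nonzero_on C w := exists2 p, p \in C & ev w p != 0.

Definition feasible C w :=
  [/\ std_matching T w, nonneg_on C w & quad_constraints (qproj w)].

Lemma zle_trans C y x z : zle C x y -> zle C y z -> zle C x z.
Proof. by move=> xy yz p pC /(xy p pC); exact: yz. Qed.

Lemma zle_refl C x : zle C x x. Proof. by []. Qed.

Lemma zleW C C' y z : C \subset C' -> zle C' y z -> zle C y z.
Proof. by move=> /fintype.subsetP CC' h p /CC'; exact: h. Qed.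

Lemma not_nonzero_on C w p : ~ nonzero_on C w -> p \in C -> ev w p = 0.
Proof.
by move=> nz pC; apply/eqP; apply: contra_notT nz => h; exists p.
Qed.

Lemma quad_positionsP p : reflect (exists i k, p = (i, quad k)) (p \in quad_positions n).
Proof.
apply: (iffP imset2P) => [[i k _ _ ->]|[i [k ->]]]; first by exists i, k.
by exists i k.
Qed.

Lemma quad_constraintsP w : quad_constraints (qproj w) <->
  forall i, (2 <= #|[set k : 'I_3 | w i (quad k) == 0%R]%SET|)%N.
Proof.
have E i : (#|[set k : 'I_3 | w i (quad k) == 0%R]%SET| +
            #|[set k : 'I_3 | (qproj w) i k != 0%R]%SET| = 3)%N.
  rewrite -[RHS](card_ord 3) -(cardsC [set k : 'I_3 | w i (quad k) == 0%R]%SET).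
  congr (_ + _)%N; apply: eq_card => k; rewrite !inE.
  by rewrite [(qproj w) i k]mxE.
split=> h i; have := h i; have := E i; by case: #|_| => [|[|[|[|?]]]]; case: #|_| => [|[|[|[|?]]]].
Qed.

Lemma quad_constraints_zle C y z : quad_positions n \subset C -> zle C y z ->
  quad_constraints (qproj y) -> quad_constraints (qproj z).
Proof.
move=> /fintype.subsetP qC yz /quad_constraintsP h; apply/quad_constraintsP => i.
apply: leq_trans (h i) _; apply: subset_leq_card; apply/fintype.subsetP => k; rewrite !inE.
move=> /eqP yk; apply/eqP; apply: (yz (i, quad k)) => //; apply: qC.
by apply/quad_positionsP; exists i, k.
Qed.

(** Vectors in the smallest face of a vector which satisfies the quadrilateral
    constraints satisfy them together. *)
Lemma compatible_zle C y u w : quad_positions n \subset C -> quad_constraints (qproj y) ->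
  zle C y u -> zle C y w -> compatible u w.
Proof.
move=> /fintype.subsetP qC /quad_constraintsP h yu yw; apply/forallP => i.
apply: leq_trans (h i) _; apply: subset_leq_card; apply/fintype.subsetP => k; rewrite !inE.
move=> /eqP yk; rewrite !mxE.
have kC : (i, quad k) \in C by apply: qC; apply/quad_positionsP; exists i, k.
by rewrite [u _ _](yu _ kC) //= [w _ _](yw _ kC) //= eqxx.
Qed.

Lemma compatible_lin (a b : R) u w : compatible u w ->
  quad_constraints (qproj (a *: u + b *: w)).
Proof.
move=> /forallP h; apply/quad_constraintsP => i.
apply: leq_trans (h i) _; apply: subset_leq_card; apply/fintype.subsetP => k; rewrite !inE !mxE.
by move=> /andP[/eqP -> /eqP ->]; rewrite !mulr0 addr0.
Qed.

Definition support_size C y := #|[set p in C | ev y p != 0]%SET|.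

Lemma reduce C y z : nonneg_on C y -> nonneg_on C z -> zle C y z -> nonzero_on C z ->
  exists a, [/\ 0 < a, nonneg_on C (y - a *: z) &
    exists2 p, p \in C & ev y p != 0 /\ ev (y - a *: z) p = 0].
Proof.
move=> y0 z0 yz nz.
have [a [a0 h [p pC [yp E]]]] := reduce_fun y0 z0 yz nz.
have evB q : ev (y - a *: z) q = ev y q - a * ev z q by rewrite !mxE.
exists a; split=> // [q qC|]; first by rewrite evB h.
by exists p => //; rewrite evB.
Qed.

Lemma std_matching_sub (a : R) y z : std_matching T y -> std_matching T z ->
  std_matching T (y - a *: z).
Proof.
by move=> hy hz; have := std_matching_lin 1 (- a) hy hz; rewrite scale1r scaleNr.
Qed.

Lemma feasible_reduce C y z : quad_positions n \subset C -> feasible C y -> feasible C z ->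
  zle C y z -> nonzero_on C z -> exists a, [/\ 0 < a, feasible C (y - a *: z),
    zle C y (y - a *: z) & (support_size C (y - a *: z) < support_size C y)%N].
Proof.
move=> qC [my y0 qy] [mz z0 _] yz nz.
have [a [a0 h0 [p pC [yp yzp]]]] := reduce y0 z0 yz nz.
have yyz : zle C y (y - a *: z).
  by move=> q qC' yq; rewrite !mxE yq (yz q) // mulr0 subrr.
exists a; split=> //.
  by split=> //; [exact: std_matching_sub|exact: quad_constraints_zle yyz qy].
apply: proper_card; apply/properP; split.
  apply/fintype.subsetP => q; rewrite !inE => /andP[qC' h]; rewrite qC' /=.
  by apply: contraNneq h => yq; rewrite yyz.
by exists p; rewrite !inE pC ?yp // yzp eqxx.
Qed.

(** L has one member on each extremal ray of the cone of the solutions that are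
    nonnegative on C, among the rays that satisfy the quadrilateral constraints and
    modulo the vectors that vanish on C.  Zero sets suffice to say so: the smallest
    face of a feasible vector that is nonzero on C contains a member of L, and the
    smallest face of a member contains no other member. *)
Definition ray_basis (L : stdvec R n -> Prop) C := [/\
  forall z, L z -> feasible C z /\ nonzero_on C z,
  forall y, feasible C y -> nonzero_on C y -> exists2 z, L z & zle C y z &
  forall z z', L z -> L z' -> zle C z z' -> z = z'].

(** Otherwise subtracting a multiple of y from z gives a feasible vector with more
    zeros than z; a member of L in its face would be in the face of z, hence z itself. *)
Lemma basis_ray L C z y : quad_positions n \subset C -> ray_basis L C -> L z -> feasible C y ->
  zle C z y -> nonzero_on C y ->
  exists a, 0 < a /\ forall p, p \in C -> ev y p = a * ev z p.
Proof.
move=> qC [Lf Lcov Lanti] Lz fy zy ny; have [fz nz] := Lf z Lz.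
have [_ nzz _] := fz; have [_ nny _] := fy.
have [b' [b'0 fb zleb [q qC' [zq zyq]]]] : exists b, [/\ 0 < b, feasible C (z - b *: y),
    zle C z (z - b *: y) & exists2 q, q \in C & ev z q != 0 /\ ev (z - b *: y) q = 0].
  have [b' [b'0 hb [q qC' hq]]] := reduce nzz nny zy ny.
  have zz : zle C z (z - b' *: y) by move=> r rC zr; rewrite !mxE zr (zy r) // mulr0 subrr.
  exists b'; split=> //; last by exists q.
  split=> //; first by apply: std_matching_sub; [case: fz|case: fy].
  by apply: quad_constraints_zle zz _ => //; case: fz.
have [nn|nn] := pselect (nonzero_on C (z - b' *: y)).
  have [z' Lz' h'] := Lcov _ fb nn.
  have zz' : z = z' by apply: Lanti => //; exact: zle_trans h'.
  by move: zq; rewrite zz' (h' q) ?eqxx.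
exists b'^-1; split; first by rewrite invr_gt0.
move=> r rC; have := not_nonzero_on nn rC; rewrite !mxE => /eqP; rewrite subr_eq0 => /eqP ->.
by rewrite mulKf // gt_eqF.
Qed.

End DoubleDescription.

(** * The double description step *)

Section Combine.
Context {R : realType} {n : nat} (T : gluing n).
Implicit Types (u w x y z : stdvec R n) (p : position n) (C : {set position n}).

Definition zle2 C u w z := forall p, p \in C -> ev u p = 0 -> ev w p = 0 -> ev z p = 0.

Lemma adjacentP C (L : {fset stdvec R n}) u w :
  reflect (forall z, z \in L -> zle2 C u w z -> z = u \/ z = w) (adjacent C L u w).
Proof.
have zcP z : reflect (zle2 C u w z) (zero_on_common_zeros C u w z).
  apply: (iffP forallP) => [h p pC up wp|h p].
    by have := h p; rewrite pC /= up wp eqxx /= => /eqP.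
  by apply/implyP => pC; apply/implyP => /andP[/eqP up /eqP wp]; apply/eqP; exact: h.
apply: (iffP hasPn) => [h z zL /zcP hz|h z zL].
  have := h z zL; rewrite hz andbT negb_and !negbK.
  by move=> /orP[] /eqP; [left|right].
apply/negP => /and3P[zu zw /zcP hz].
by case: (h z zL hz) => E; rewrite E eqxx in zu zw.
Qed.

Lemma combine_spec p u w : 0 < ev u p -> ev w p < 0 -> exists a b, [/\ 0 < a, 0 < b,
  combine p u w = a *: u + b *: w & a * ev u p + b * ev w p = 0].
Proof.
move=> up wp; have d0 : 0 < ev u p - ev w p by lra.
exists ((ev u p - ev w p)^-1 * - ev w p), ((ev u p - ev w p)^-1 * ev u p); split.
- by rewrite mulr_gt0 ?invr_gt0 // oppr_gt0.
- by rewrite mulr_gt0 ?invr_gt0.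
- by rewrite /combine scalerBr !scalerA addrC -scaleNr mulrN.
by rewrite -!mulrA -mulrDr mulNr [ev w p * _]mulrC addNr mulr0.
Qed.

Lemma in_position_step C (L : {fset stdvec R n}) p z :
  z \in (position_step (L, C) p).1 <-> (z \in L /\ 0 <= ev z p) \/
  exists u w, [/\ [/\ u \in L, w \in L, 0 < ev u p & ev w p < 0],
    compatible u w, adjacent C L u w & z = combine p u w].
Proof.
rewrite /position_step /= !in_fsetU !in_fset !inE /=.
split.
  move=> /orP[/orP[|]|/imfset2P[u]].
  - by move=> /andP[zL /eqP zp]; left; rewrite zL zp.
  - by move=> /andP[zL zp]; left; rewrite zL ltW.
  rewrite !inE /= => /andP[uL up] [w]; rewrite !inE /= => /andP[/andP[wL wp] /andP[cmp adj]] ->.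
  by right; exists u, w.
move=> [[zL]|[u [w [[uL wL up wp] cmp adj ->]]]].
  by rewrite le_eqVlt eq_sym zL /= => /orP[->|->]; rewrite ?orbT.
apply/orP; right; apply/imfset2P; exists u; first by rewrite !inE uL.
by exists w => //; rewrite !inE wL wp cmp.
Qed.

Section SignedCover.
Variables (G : stdvec R n -> Prop) (C : {set position n}) (p : position n).
Hypothesis qC : quad_positions n \subset C.
Hypothesis basisG : ray_basis T G C.
Hypothesis lin : forall y, std_matching T y -> (forall q, q \in C -> ev y q = 0) -> ev y p = 0.

(** If z has the wrong sign at p, removing a multiple of z from y keeps the sign of
    y at p and enlarges its zero set. *)
Lemma signed_cover (s : R) y : feasible T C y -> 0 < s * ev y p ->
  exists z, [/\ G z, zle C y z & 0 < s * ev z p].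
Proof.
have [Gf Gcov _] := basisG.
have [k] := ubnP (support_size C y); elim: k y => // k IH y; rewrite ltnS => yk fy yp.
have ny : nonzero_on C y.
  apply: contrapT => nn; have [my _ _] := fy.
  by move: yp; rewrite (lin my (fun q => not_nonzero_on nn)) mulr0 ltxx.
have [z Gz yz] := Gcov y fy ny; have [fz nz] := Gf z Gz.
have [zp|zp] := ltrP 0 (s * ev z p); first by exists z.
have [a [a0 fyz yyz lt]] := feasible_reduce qC fy fz yz nz.
have [||z' [Gz' yz' zp']] := IH _ _ fyz.
- exact: leq_trans lt yk.
- by rewrite !mxE mulrBr mulrCA; have := mulr_ge0_le0 (ltW a0) zp; lra.
by exists z'; split=> //; exact: zle_trans yz'.
Qed.

(** Correctness of the adjacency test.  A vector y with y_p = 0 has in its face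
    some u and w of opposite signs at p.  If a third ray t is in the face of u and w,
    combining t with u or w gives a vector d that vanishes at p and is in the face of
    the combination c of u and w; as c and d are not proportional, c minus a multiple
    of d is a vector in the face of y with more zeros, and one concludes by induction
    on the support. *)
Lemma double_cover y : feasible T (p |: C) y -> nonzero_on (p |: C)%SET y ->
  (exists z, [/\ G z, 0 <= ev z p & zle (p |: C)%SET y z]) \/
  (exists u w, [/\ [/\ G u, G w, 0 < ev u p & ev w p < 0], zle C y u, zle C y w,
     ev y p = 0 & forall z, G z -> zle2 C u w z -> z = u \/ z = w]).
Proof.
have [Gf Gcov Ganti] := basisG.
have subC : C \subset (p |: C)%SET by exact: finset.subsetU1.
have feasC y' : feasible T (p |: C)%SET y' -> feasible T C y'.
  by move=> [? h ?]; split=> // q qC'; apply: h; rewrite !inE qC' orbT.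
have zleU y' z : zle C y' z -> (ev y' p = 0 -> ev z p = 0) -> zle (p |: C)%SET y' z.
  by move=> h hp q; rewrite !inE => /orP[/eqP ->|/h].
have [k] := ubnP (support_size C y); elim: k y => // k IH y; rewrite ltnS => yk fy ny.
have fyC := feasC _ fy; have [my y0 qy] := fy.
have yp0 : 0 <= ev y p by apply: y0; rewrite !inE eqxx.
move: yp0; rewrite le_eqVlt => /orP[/eqP yp|yp]; last first.
  have [|z [Gz yz]] := @signed_cover 1 y fyC; first by rewrite mul1r.
  rewrite mul1r => zp; left; exists z; split=> //; first exact: ltW.
  by apply: zleU => // yp'; rewrite yp' ltxx in yp.
have {}yp : ev y p = 0 by [].
have nyC : nonzero_on C y.
  case: ny => q; rewrite !inE => /orP[/eqP ->|qC' yq]; last by exists q.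
  by rewrite yp eqxx.
have [z Gz yz] := Gcov y fyC nyC; have [fz nz] := Gf z Gz.
have [zp|zp0] := eqVneq (ev z p) 0.
  by left; exists z; split=> //; [rewrite zp|apply: zleU].
have [u [w [[Gu Gw up wp] yu yw]]] : exists u w, [/\ [/\ G u, G w, 0 < ev u p & ev w p < 0],
    zle C y u & zle C y w].
  have [a [a0 fyz yyz lt]] := feasible_reduce qC fyC fz yz nz.
  have E : ev (y - a *: z) p = - (a * ev z p) by rewrite !mxE yp sub0r.
  case: (ltgtP 0 (ev z p)) zp0 => // zp _.
    have [|w [Gw yw wp]] := @signed_cover (-1) _ fyz.
      by rewrite E mulN1r opprK mulr_gt0.
    exists z, w; split=> //; last exact: zle_trans yw.
    by split=> //; move: wp; rewrite mulN1r oppr_gt0.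
  have [|u [Gu yu up]] := @signed_cover 1 _ fyz.
    by rewrite E mul1r oppr_gt0 pmulr_rlt0.
  exists u, z; split=> //; last exact: zle_trans yu.
  by split=> //; move: up; rewrite mul1r.
have [adj|nadj] := pselect (forall z, G z -> zle2 C u w z -> z = u \/ z = w).
  by right; exists u, w.
have [t [Gt ut nut nwt]] : exists t, [/\ G t, zle2 C u w t, t <> u & t <> w].
  apply: contrapT => nt; apply: nadj => t Gt ut; apply: contrapT => /not_orP[? ?].
  by apply: nt; exists t.
have [[mu u0 qu] [mw w0 qw]] : feasible T C u /\ feasible T C w.
  by split; [case: (Gf u Gu)|case: (Gf w Gw)].
have [[mt t0 qt] nt] := Gf t Gt.
have yt : zle C y t by move=> q qC' yq; apply: ut => //; [exact: yu|exact: yw].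
have [tp|tp0] := eqVneq (ev t p) 0.
  by left; exists t; split=> //; [rewrite tp|apply: zleU].
have [a [b [a0 b0 cE cp]]] := combine_spec up wp.
set c := a *: u + b *: w.
have cev q : ev c q = a * ev u q + b * ev w q by rewrite /c !mxE.
have comb_feas v v' r r' : feasible T C v -> feasible T C v' -> zle C y v -> zle C y v' ->
    0 < r -> 0 < r' -> r * ev v p + r' * ev v' p = 0 -> feasible T (p |: C)%SET (r *: v + r' *: v').
  move=> [mv v0 _] [mv' v0' _] yv yv' r0 r'0 E; split.
  - exact: std_matching_lin.
  - move=> q; rewrite !inE !mxE => /orP[/eqP ->|qC']; first by rewrite E.
    by apply: addr_ge0; apply: mulr_ge0; rewrite ?(ltW r0) ?(ltW r'0) ?v0 ?v0'.
  - by apply: compatible_lin; apply: compatible_zle yv yv'.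
have fu : feasible T C u by []. have fw : feasible T C w by []. have ft : feasible T C t by [].
have fc : feasible T (p |: C)%SET c by exact: comb_feas.
(* a second combination at p inside the smallest face of c *)
suff [d [fd cd nd dp dc]] : exists d, [/\ feasible T (p |: C)%SET d, zle C c d, nonzero_on C d,
    ev d p = 0 & forall r, ~ (forall q, q \in C -> ev c q = r * ev d q)].
  have yc : zle C y c.
    by move=> q qC' yq; rewrite cev yu // yw // !mulr0 addr0.
  have [r [r0 fcd ccd lt]] := feasible_reduce qC (feasC _ fc) (feasC _ fd) cd nd.
  have cdp : ev (c - r *: d) p = 0 by rewrite !mxE dp cp mulr0 subrr.
  have ycd := zle_trans yc ccd.
  have [|||[z' [Gz' z'p cz']]|[u' [w' [G' cu' cw' _ adj']]]] := IH (c - r *: d).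
  - apply: leq_trans lt _; apply: leq_trans yk; apply: subset_leq_card.
    apply/fintype.subsetP => q; rewrite !inE => /andP[qC' h]; rewrite qC' /=.
    by apply: contraNneq h => yq; rewrite yc.
  - case: fcd => mcd ncd qcd; split=> // q.
    by rewrite !inE => /orP[/eqP ->|/ncd //]; rewrite cdp.
  - apply: contrapT => ncd; apply: (dc r) => q qC'.
    have : ev (c - r *: d) q = 0 by apply: (not_nonzero_on ncd); rewrite !inE qC' orbT.
    have -> : ev (c - r *: d) q = ev c q - r * ev d q by rewrite !mxE.
    by move=> /eqP; rewrite subr_eq0 => /eqP.
  - left; exists z'; split=> //; apply: zle_trans cz'.
    by apply: zleU.
  - right; exists u', w'; split=> //; [exact: zle_trans cu'|exact: zle_trans cw'].
have pos0 k1 k2 (x1 x2 : R) : 0 < k1 -> 0 <= k2 -> 0 <= x1 -> 0 <= x2 ->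
    k1 * x1 + k2 * x2 = 0 -> x1 = 0.
  move=> k10 k20 x10 x20 E; have h1 := mulr_ge0 (ltW k10) x10; have h2 := mulr_ge0 k20 x20.
  have /eqP : k1 * x1 = 0 by lra.
  by rewrite mulf_eq0 (gt_eqF k10) => /eqP.
have nzd v v' r r' q : q \in C -> ev t q != 0 -> 0 < r -> 0 < r' -> 0 <= ev v' q -> v = t ->
    ev (r *: v + r' *: v') q != 0.
  move=> qC' tq r0 r'0 v'0 ->; rewrite !mxE gt_eqF //.
  have : 0 < r * ev t q by rewrite mulr_gt0 // lt_def tq t0.
  by have := mulr_ge0 (ltW r'0) v'0; lra.
have [q0 q0C tq0] := nt.
case: (ltgtP 0 (ev t p)) tp0 => // tp _.
  have [a' [b' [a'0 b'0 _ dp]]] := combine_spec tp wp.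
  exists (a' *: t + b' *: w); split.
  - exact: comb_feas.
  - move=> q qC'; rewrite cev !mxE => cq.
    have uq : ev u q = 0 by apply: pos0 cq => //; rewrite ?(ltW b0) ?u0 ?w0.
    have wq : ev w q = 0 by move: cq; rewrite addrC; apply: pos0; rewrite ?(ltW a0) ?u0 ?w0.
    by rewrite (ut q) // wq !mulr0 addr0.
  - by exists q0 => //; apply: nzd => //; exact: w0.
  - by rewrite !mxE.
  move=> r E.
  have {}E q : q \in C -> a * ev u q + (b - r * b') * ev w q = r * a' * ev t q.
    by move=> qC'; have := E q qC'; rewrite cev !mxE; lra.
  have [le|lt] := lerP (r * b') b.
    apply: nut; apply: Ganti => // q qC' tq.
    by have := E q qC'; rewrite tq mulr0; apply: pos0; rewrite ?subr_ge0 ?u0 ?w0.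
  have ra : 0 < r * a'.
    rewrite mulr_gt0 // -(pmulr_lgt0 _ b'0); exact: lt_trans lt.
  apply: nut; apply/esym; apply: Ganti => // q qC' uq.
  apply: (@pos0 (r * a') (r * b' - b) (ev t q) (ev w q)); rewrite ?t0 ?w0 ?subr_ge0 ?(ltW lt) //.
  by rewrite -E // uq; lra.
have [a' [b' [a'0 b'0 _ dp]]] := combine_spec up tp.
exists (a' *: u + b' *: t); split.
- exact: comb_feas.
- move=> q qC'; rewrite cev !mxE => cq.
  have uq : ev u q = 0 by apply: pos0 cq => //; rewrite ?(ltW b0) ?u0 ?w0.
  have wq : ev w q = 0 by move: cq; rewrite addrC; apply: pos0; rewrite ?(ltW a0) ?u0 ?w0.
  by rewrite (ut q) // uq !mulr0 addr0.
- by exists q0 => //; rewrite addrC; apply: nzd => //; exact: u0.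
- by rewrite !mxE.
move=> r E.
have {}E q : q \in C -> b * ev w q + (a - r * a') * ev u q = r * b' * ev t q.
  by move=> qC'; have := E q qC'; rewrite cev !mxE; lra.
have [le|lt] := lerP (r * a') a.
  apply: nwt; apply: Ganti => // q qC' tq.
  by have := E q qC'; rewrite tq mulr0; apply: pos0; rewrite ?subr_ge0 ?u0 ?w0.
have rb : 0 < r * b'.
  rewrite mulr_gt0 // -(pmulr_lgt0 _ a'0); exact: lt_trans lt.
apply: nwt; apply/esym; apply: Ganti => // q qC' wq.
apply: (@pos0 (r * b') (r * a' - a) (ev t q) (ev u q)); rewrite ?t0 ?u0 ?subr_ge0 ?(ltW lt) //.
by rewrite -E // wq; lra.
Qed.
End SignedCover.
End Combine.

(** * The inner loop *)

Section VertexStep.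
Context {R : realType} {n : nat} (T : gluing n).
Implicit Types (u w x y z : stdvec R n) (p q : position n) (A C : {set position n}).
Implicit Types (L : {fset stdvec R n}).
Variables (V : {set corner n}) (C : {set position n}) (X : {fset stdvec R n}).
Hypothesis hV : V \in vertices T.
Notation l := (vlink R V).
Notation TV := (link_positions R V).
Hypothesis qC : quad_positions n \subset C.
Hypothesis CT : forall q, q \in C -> q \notin TV.
Hypothesis basisX : ray_basis T (fun z => z \in X) C.
Hypothesis X_nonneg : forall x, x \in X -> nonneg_on TV x.

Lemma link0 q : q \in C -> ev l q = 0.
Proof. by move=> qC'; rewrite vlinkE (negbTE (CT qC')). Qed.

Lemma link1 q : q \in TV -> ev l q = 1.
Proof. by move=> qT; rewrite vlinkE qT. Qed.

Lemma link_feasible C' : feasible T C' l.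
Proof.
split; first exact: vlink_matching.
- by move=> q _; rewrite vlinkE ler0n.
- move=> i; rewrite vlink_qproj; apply: (@leq_trans 0); rewrite // leqn0 cards_eq0.
  by apply/eqP/setP => k; rewrite !inE mxE eqxx.
Qed.

Lemma const_on_link y : std_matching T y -> (forall q, q \in C -> ev y q = 0) ->
  forall q q', q \in TV -> q' \in TV -> ev y q = ev y q'.
Proof.
move=> my y0 q q' /link_positionsP[c cV ->] /link_positionsP[d dV ->].
apply: (std_matching_connect my); last by rewrite -(vertex_connect hV).
apply/matrixP => i k; rewrite qprojE mxE; apply: (y0 (i, quad k)).
by apply: (fintype.subsetP qC); apply/quad_positionsP; exists i, k.
Qed.

(** A vector in the face of x is a multiple of x on C, and vectors that vanish on
    C are constant on the triangles around V; so modulo later links this face is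
    spanned by x and the link of V. *)
Lemma X_ray x y : x \in X -> feasible T C y -> zle C x y -> nonzero_on C y ->
  exists a b, [/\ 0 < a, forall q, q \in C -> ev y q = a * ev x q &
    forall q, q \in TV -> ev y q = a * ev x q + b].
Proof.
move=> xX fy xy ny; have [a [a0 E]] := basis_ray qC basisX xX fy xy ny.
have /finset.set0Pn[q0 q0T] := @link_positions_neq0 R n T V hV.
exists a, (ev (y - a *: x) q0); split=> // q qT.
have [Xf _ _] := basisX; have [[mx _ _] _] := Xf x xX; have [my _ _] := fy.
have d0 q' : q' \in C -> ev (y - a *: x) q' = 0 by move=> q'C; rewrite !mxE E // subrr.
rewrite -(const_on_link (std_matching_sub a my mx) d0 qT q0T).
by rewrite !mxE; lra.
Qed.

Definition has_zero A z := exists2 q, q \in A & ev z q = 0.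

Definition bounded_rays A L z := z = l \/ z \in L /\ has_zero A z.

(** X is the list of partial canonical parts and A the set of positions that have
    been processed.  The list L differs from a ray basis in two ways: the link l,
    which is a ray, is added only after the loop, and the members x of X without zero on
    A are not extremal, being the sum of a ray and of a positive multiple of l. *)
Definition loop_invariant A L := [/\ ray_basis T (bounded_rays A L) (A :|: C)%SET,
  forall z, z \in L -> feasible T (A :|: C)%SET z /\ nonzero_on C z,
  {subset X <= L} & forall z, z \in L -> has_zero A z \/ z \in X].

Lemma link_notin A L : loop_invariant A L -> l \notin L.
Proof.
move=> [_ Lf _ _]; apply/negP => /Lf[_ [q qC']].
by rewrite link0 ?eqxx.
Qed.

Lemma feasible_subset C' C'' z : C' \subset C'' -> feasible T C'' z -> feasible T C' z.
Proof. by move=> /fintype.subsetP sub [? h ?]; split=> // q /sub; exact: h. Qed.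

(** The link has no zero on A and vanishes on C, so it is comparable to no vector
    that has a zero on A and does not vanish on C. *)
Lemma ray_basis_intro A L : A \subset TV -> A != finset.set0 ->
  (forall z, z \in L -> feasible T (A :|: C)%SET z /\ nonzero_on C z) ->
  (forall y, feasible T (A :|: C)%SET y -> nonzero_on (A :|: C)%SET y ->
     exists2 z, bounded_rays A L z & zle (A :|: C)%SET y z) ->
  (forall z z', z \in L -> z' \in L -> has_zero A z -> has_zero A z' ->
     zle (A :|: C)%SET z z' -> z = z') ->
  ray_basis T (bounded_rays A L) (A :|: C)%SET.
Proof.
move=> /fintype.subsetP AT /finset.set0Pn[q0 q0A] Lf Lcov Lanti; split=> //.
- move=> z [->|[zL _]].
    split; first exact: link_feasible.
    by exists q0; rewrite ?inE ?q0A // link1 ?oner_eq0 // AT.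
  have [fz [q qC' zq]] := Lf z zL; split=> //.
  by exists q => //; rewrite inE qC' orbT.
move=> z z' [->|[zL [q qA zq]]] [->|[z'L hz']] //.
- move=> h; have [_ [q qC']] := Lf z' z'L.
  by rewrite h ?eqxx ?inE ?qC' ?orbT //; exact: link0.
- move=> /(_ q); rewrite inE qA zq link1 ?AT // => /(_ isT erefl)/eqP.
  by rewrite oner_eq0.
- by apply: Lanti => //; exists q.
Qed.

Section Combination.
Variables (A : {set position n}) (p : position n) (u w : stdvec R n).
Hypothesis pT : p \in TV.
Hypotheses (fu : forall q, q \in (A :|: C)%SET -> 0 <= ev u q).
Hypotheses (fw : forall q, q \in (A :|: C)%SET -> 0 <= ev w q).
Hypotheses (mu : std_matching T u) (mw : std_matching T w).
Hypotheses (up : 0 < ev u p) (wp : ev w p < 0).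

Lemma combine_at : ev (combine p u w) p = 0.
Proof. by have [a [b [_ _ -> E]]] := combine_spec up wp; rewrite !mxE. Qed.

Lemma combine_zero q : q \in (A :|: C)%SET -> ev (combine p u w) q = 0 ->
  ev u q = 0 /\ ev w q = 0.
Proof.
move=> qAC; have [a [b [a0 b0 -> _]]] := combine_spec up wp; rewrite !mxE => /eqP.
rewrite paddr_eq0 ?mulr_ge0 ?fu ?fw ?(ltW a0) ?(ltW b0) //.
by rewrite !mulf_eq0 (gt_eqF a0) (gt_eqF b0) /= => /andP[/eqP -> /eqP ->].
Qed.

Lemma zle_combine y : zle (A :|: C)%SET y u -> zle (A :|: C)%SET y w ->
  zle ((p |: A) :|: C)%SET y (combine p u w).
Proof.
have [a [b [a0 b0 cE E]]] := combine_spec up wp => yu yw q.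
rewrite -finset.setUA finset.in_setU1 => /orP[/eqP -> _|qAC yq]; first exact: combine_at.
by rewrite cE !mxE yu // yw // !mulr0 addr0.
Qed.

Lemma combine_feasible : compatible u w -> feasible T ((p |: A) :|: C)%SET (combine p u w).
Proof.
move=> cmp; have [a [b [a0 b0 cE E]]] := combine_spec up wp; split.
- by rewrite cE; exact: std_matching_lin.
- move=> q; rewrite -finset.setUA finset.in_setU1 => /orP[/eqP ->|qAC].
    by rewrite combine_at.
  by rewrite cE !mxE addr_ge0 // mulr_ge0 ?fu ?fw // ltW.
- by rewrite cE; exact: compatible_lin.
Qed.

Lemma combine_nonzero : nonzero_on C u -> nonzero_on C (combine p u w).
Proof.
move=> [q qC' uq]; exists q => //; apply: contra_neq uq => /combine_zero[] //.
by rewrite inE qC' orbT.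
Qed.

End Combination.

(** At the first position p only - l is negative.  Each x of X with x_p > 0 is
    adjacent to it and gives the point of x + R l that vanishes at p; the rays of the
    new cone are these points, the x with x_p = 0, and l. *)
Lemma loop_start p : p \in TV ->
  loop_invariant [set p]%SET (position_step ((X `|` [fset - l])%fset, C) p).1.
Proof.
move=> pT; set L := (X `|` _)%fset; have [Xf Xcov Xanti] := basisX.
have lp : ev l p = 1 by exact: link1.
have nlE q : ev (- l) q = - ev l q by rewrite !mxE.
have nl0 q : q \in C -> ev (- l) q = 0 by move=> qC'; rewrite nlE link0 // oppr0.
have nlp : ev (- l) p < 0 by rewrite nlE lp; lra.
have inL z : z \in L <-> z \in X \/ z = - l.
  rewrite /L !inE; split; first by move=> /orP[|/eqP]; [left|right].
  by move=> [->//|->]; rewrite eqxx orbT.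
have nl_match : std_matching T (- l).
  have := std_matching_lin (-1) 0 (@vlink_matching R _ _ _ hV) (@vlink_matching R _ _ _ hV).
  by rewrite scale0r addr0 scaleN1r.
have pC : p \notin C by apply: contraL pT => /CT.
have pUC z : z \in X -> forall q, q \in (finset.set0 :|: C)%SET -> 0 <= ev z q.
  by move=> zX q; rewrite finset.set0U; have [[_ h _] _] := Xf z zX; exact: h.
have nlUC q : q \in (finset.set0 :|: C)%SET -> 0 <= ev (- l) q.
  by rewrite finset.set0U => /nl0 ->.
have X_match z : z \in X -> std_matching T z by move=> /Xf[[]].
have setE : ((p |: finset.set0) :|: C)%SET = ([set p] :|: C)%SET by rewrite finset.setU0.
have new_cases z : z \in (position_step (L, C) p).1 ->
    (z \in X) \/ exists x, [/\ x \in X, 0 < ev x p, compatible x (- l) & z = combine p x (- l)].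
  move=> /in_position_step[[/inL[zX|->] zp]|[u [w [[/inL uL /inL wL up wp] cmp _ ->]]]].
  - by left.
  - by move: zp nlp; rewrite leNgt => /negP.
  right; exists u.
  case: uL up => [uX|->] up; last by move: up nlp; lra.
  case: wL wp cmp => [wX|->] wp cmp; last by split.
  by move: wp (X_nonneg wX pT); rewrite ltNge => /negP.
have inv2 z : z \in (position_step (L, C) p).1 ->
    feasible T ([set p] :|: C)%SET z /\ nonzero_on C z.
  move=> /new_cases[zX|[x [xX xp cmp ->]]].
    have [[mz z0 qz] nz] := Xf z zX; split=> //; split=> // q.
    by rewrite !inE => /orP[/eqP ->|/z0 //]; exact: X_nonneg.
  rewrite -setE; split.
    by apply: combine_feasible => //; [exact: pUC|exact: X_match].
  apply: (@combine_nonzero finset.set0) => //; first exact: pUC.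
  by have [] := Xf x xX.
have XL : {subset X <= (position_step (L, C) p).1}.
  move=> x xX; apply/in_position_step; left; split; first by apply/inL; left.
  exact: X_nonneg.
have base z : z \in (position_step (L, C) p).1 -> has_zero [set p]%SET z ->
    exists2 x, x \in X & [/\ zle C x z, zle C z x &
      z = if ev x p == 0 then x else combine p x (- l)].
  move=> /new_cases[zX|[x [xX xp cmp ->]]] [q /set1P -> zp].
    by exists z => //; split=> //; rewrite zp eqxx.
  exists x => //; rewrite (gt_eqF xp); split=> //.
    have [a [b [a0 b0 -> _]]] := combine_spec xp nlp => q' q'C xq'.
    by rewrite ev_lin xq' nl0 // !mulr0 addr0.
  move=> q' q'C; move/(@combine_zero finset.set0 p x (- l) (pUC x xX) nlUC xp nlp).
  by rewrite finset.set0U => /(_ q'C)[].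
split=> //; last first.
  move=> z zL; case: (new_cases z zL) => [zX|[x [xX xp cmp ->]]]; [by right|left].
  by exists p; rewrite ?inE ?eqxx // combine_at.
apply: ray_basis_intro => //.
- by apply/fintype.subsetP => q /set1P ->.
- by apply/finset.set0Pn; exists p; rewrite inE.
- move=> y [my y0 qy] [q0 q0C yq0].
  have [yp|yp] := eqVneq (ev y p) 0; last first.
    exists l; first by left.
    move=> q; rewrite !inE => /orP[/eqP ->|qC' _]; last exact: link0.
    by move=> E; rewrite E eqxx in yp.
  have fy : feasible T C y by split=> // q qC'; apply: y0; rewrite inE qC' orbT.
  have ny : nonzero_on C y.
    by exists q0 => //; move: q0C; rewrite !inE => /orP[/eqP q0p|//]; rewrite q0p yp eqxx in yq0.
  have [x xX yx] := Xcov y fy ny.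
  have ynl : zle C y (- l) by move=> q qC' _; exact: nl0.
  have xp0 := X_nonneg xX pT.
  have [xp|xp] := eqVneq (ev x p) 0.
    exists x; first by right; split; [exact: XL|exists p; rewrite ?inE].
    by move=> q; rewrite !inE => /orP[/eqP -> //|]; exact: yx.
  have {}xp : 0 < ev x p by rewrite lt_def xp.
  exists (combine p x (- l)); last first.
    by rewrite -setE; apply: zle_combine => //; rewrite finset.set0U.
  right; split; last by exists p; rewrite ?inE // combine_at.
  apply/in_position_step; right; exists x, (- l); split=> //.
  + by split=> //; apply/inL; [left|right].
  + exact: compatible_zle qy yx ynl.
  apply/adjacentP => z /inL[zX h|->]; [left|by right].
  by apply/esym/Xanti => // q qC' xq; apply: h => //; exact: nl0.
move=> z z' zL z'L hz hz' zz'.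
have [x xX [xz zx zE]] := base z zL hz; have [x' x'X [xz' zx' zE']] := base z' z'L hz'.
have xx' : x = x'.
  apply: Xanti => //; apply: zle_trans xz _; apply: zle_trans zx'.
  by apply: zleW zz'; exact: finset.subsetUr.
by rewrite zE zE' xx'.
Qed.

(** By [double_cover], each face contains a ray that is kept or the combination of
    two adjacent rays u and w.  If u is not the link, u and w pass the test of
    the algorithm: an x of X that fails it would put l in the face of u and w.  If u is
    the link, then w is the lowest point of x + R l for some x of X, up to scaling, and
    combining x with w gives the same ray as combining l with w.  The results are
    incomparable, because the zeros of a combination are the common zeros of the pair,
    and the test excludes every other member of the list from its face. *)
Lemma loop_step A L p : loop_invariant A L -> A \subset TV -> A != finset.set0 -> p \in TV ->
  loop_invariant (p |: A)%SET (position_step (L, (A :|: C)%SET) p).1.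
Proof.
move=> inv AT' A0 pT; have lL := link_notin inv.
have [basisG Lf XL LX] := inv; have [Gf Gcov Ganti] := basisG.
have [Xf Xcov Xanti] := basisX.
have AT := fintype.subsetP AT'; have /finset.set0Pn[q0 q0A] := A0.
have lp : ev l p = 1 by exact: link1.
set L' := (position_step _ _).1.
have inC q : q \in C -> q \in (A :|: C)%SET by move=> qC'; rewrite inE qC' orbT.
have inA q : q \in A -> q \in (A :|: C)%SET by move=> qA; rewrite inE qA.
have subC z y : zle (A :|: C)%SET z y -> zle C z y by apply: zleW; exact: finset.subsetUr.
have qAC : quad_positions n \subset (A :|: C)%SET.
  by apply: fintype.subset_trans qC _; exact: finset.subsetUr.
have L0 z : z \in L -> forall q, q \in (A :|: C)%SET -> 0 <= ev z q.
  by move=> zL; have [[_ h _] _] := Lf z zL.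
have L_match z : z \in L -> std_matching T z by move=> /Lf[[]].
have L_C z : z \in L -> feasible T C z.
  by move=> zL; apply: feasible_subset (finset.subsetUr A C) _; have [] := Lf z zL.
have L_nz z : z \in L -> nonzero_on C z by move=> /Lf[].
have X_A x q : x \in X -> q \in A -> 0 <= ev x q by move=> xX /AT; exact: X_nonneg.
have X_A0 x q : x \in X -> ~ has_zero A x -> q \in A -> 0 < ev x q.
  move=> xX nh qA; rewrite lt_def X_A // andbT; apply: contra_not_neq nh => xq.
  by exists q.
have G_L z : z \in L -> has_zero A z -> bounded_rays A L z by move=> *; right.
have L_anti z y : z \in L -> y \in L -> has_zero A z -> zle (A :|: C)%SET z y -> z = y.
  move=> zL yL hz zy; apply: Ganti => //; first exact: G_L.
  by apply: G_L => //; case: hz => q qA zq; exists q => //; apply: zy => //; exact: inA.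
have L'E z : z \in L' <-> (z \in L /\ 0 <= ev z p) \/
    exists u w, [/\ [/\ u \in L, w \in L, 0 < ev u p & ev w p < 0],
    compatible u w, adjacent (A :|: C)%SET L u w & z = combine p u w] by exact: in_position_step.
have XL' : {subset X <= L'}.
  by move=> x xX; apply/L'E; left; split; [exact: XL|exact: X_nonneg].
have L'f z : z \in L' -> feasible T ((p |: A) :|: C)%SET z /\ nonzero_on C z.
  move=> /L'E[[zL zp]|[u [w [[uL wL up wp] cmp _ ->]]]].
    have [[mz z0 qz] nz] := Lf z zL; split=> //; split=> // q.
    by rewrite -finset.setUA finset.in_setU1 => /orP[/eqP ->|/z0].
  split; first by apply: combine_feasible => //; [exact: L0|exact: L0|exact: L_match|exact: L_match].
  apply: (@combine_nonzero A) => //; [exact: L0|exact: L0|exact: L_nz].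
have has_zeroU z : has_zero A z -> has_zero (p |: A)%SET z.
  by move=> [q qA zq]; exists q => //; rewrite !inE qA orbT.
have zleU y z : zle (A :|: C)%SET y z -> (ev y p = 0 -> ev z p = 0) ->
    zle ((p |: A) :|: C)%SET y z.
  by move=> h hp q; rewrite -finset.setUA finset.in_setU1 => /orP[/eqP ->|/h].
split=> //; last first.
  move=> z /L'E[[zL zp]|[u [w [[uL wL up wp] _ _ ->]]]].
    by have [hz|zX] := LX z zL; [left; exact: has_zeroU|right].
  by left; exists p; rewrite ?inE ?eqxx // combine_at.
have pA0 : (p |: A)%SET != finset.set0 by apply/finset.set0Pn; exists p; rewrite !inE eqxx.
apply: ray_basis_intro => //.
- by apply/fintype.subsetP => q; rewrite finset.in_setU1 => /orP[/eqP -> //|]; exact: AT.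
- move=> y; rewrite -finset.setUA => fy ny.
  have lin y' : std_matching T y' -> (forall q, q \in (A :|: C)%SET -> ev y' q = 0) -> ev y' p = 0.
    move=> my y0; rewrite (const_on_link my _ pT (AT _ q0A)); first by apply: y0; exact: inA.
    by move=> q /inC; exact: y0.
  rewrite finset.setUA.
  have [[z [Gz zp yz]]|[u [w [[Gu Gw up wp] yu yw yp adj]]]] :=
      double_cover qAC basisG lin fy ny.
    exists z; last by rewrite -finset.setUA.
    case: Gz zp => [->|[zL hz]] zp; [by left|right; split; last exact: has_zeroU].
    by apply/L'E; left.
  have [wL hw] : w \in L /\ has_zero A w.
    by case: Gw wp => // ->; rewrite lp => ?; exfalso; lra.
  have qy : quad_constraints (qproj y) by case: fy.
  have combine_in v : v \in L -> 0 < ev v p -> zle (A :|: C)%SET y v ->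
      (forall z, z \in L -> zle2 (A :|: C)%SET v w z -> z = v \/ z = w) ->
      exists2 z, bounded_rays (p |: A)%SET L' z & zle ((p |: A) :|: C)%SET y z.
    move=> vL vp yv adjv; exists (combine p v w); last exact: zle_combine.
    right; split; last by exists p; rewrite ?inE ?eqxx // combine_at.
    apply/L'E; right; exists v, w; split=> //; last exact/adjacentP.
    exact: compatible_zle qy yv yw.
  case: Gu up yu adj => [->|[uL hu]] up yu adj; last first.
    apply: (combine_in u uL up yu) => z zL uwz.
    have [hz|nhz] := pselect (has_zero A z); first by apply: adj => //; exact: G_L.
    have ulw : zle2 (A :|: C)%SET u w l.
      move=> q; rewrite inE => /orP[qA|qC'] uq wq; last exact: link0.
      by case: nhz; exists q => //; apply: uwz => //; exact: inA.
    have [lu|lw] := adj l (or_introl erefl) ulw.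
      by move: lL; rewrite lu uL.
    by move: lL; rewrite lw wL.
  (* the ray w is adjacent to the link: it lies below an element x of X *)
  have adjw z : bounded_rays A L z -> zle C w z -> z = l \/ z = w.
    move=> Gz wz; apply: adj => // q; rewrite inE => /orP[qA|qC'] lq wq; last exact: wz.
    by move: lq; rewrite link1 ?AT // => /eqP; rewrite oner_eq0.
  have [x xX wx] := Xcov w (L_C w wL) (L_nz w wL).
  have xL := XL x xX.
  have nhx : ~ has_zero A x.
    move=> hx; case: (adjw x (G_L x xL hx) wx) => E.
      by move: lL; rewrite -E xL.
    by move: wp (X_nonneg xX pT); rewrite E ltNge => /negP.
  have xw : zle C x w.
    case: (@arg_minP _ _ _ q0 (fun q => q \in A) (fun q => ev x q) q0A) => q1 q1A min1.
    pose e := x - ev x q1 *: l.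
    have eE q : ev e q = ev x q - ev x q1 * ev l q by rewrite !mxE.
    have eC q : q \in C -> ev e q = ev x q by move=> qC'; rewrite eE link0 // mulr0 subr0.
    have [mx _ qx] : feasible T C x by exact: L_C.
    have fe : feasible T (A :|: C)%SET e.
      split.
      - by apply: std_matching_sub => //; exact: (vlink_matching hV).
      - move=> q; rewrite inE => /orP[qA|qC']; last by rewrite eC // L0 // inC.
        by rewrite eE link1 ?AT // mulr1 subr_ge0; exact: min1.
      - apply: (quad_constraints_zle qC _ qx) => q qC' xq.
        by rewrite eC.
    have ne : nonzero_on (A :|: C)%SET e.
      by have [q qC' xq] := L_nz x xL; exists q; [exact: inC|rewrite eC].
    have [z Gz ez] := Gcov e fe ne.
    have e1 : ev e q1 = 0 by rewrite eE link1 ?AT // mulr1 subrr.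
    have xz : zle C x z by move=> q qC' xq; apply: ez; [exact: inC|rewrite eC].
    case: (adjw z Gz (zle_trans wx xz)) => E; last by rewrite -E.
    by have := ez q1 (inA _ q1A) e1; rewrite E link1 ?AT // => /eqP; rewrite oner_eq0.
  have yx : zle (A :|: C)%SET y x.
    move=> q; rewrite inE => /orP[qA|qC'] yq; last by apply: wx => //; apply: yw => //; exact: inC.
    by have := yu q (inA _ qA) yq; rewrite link1 ?AT // => /eqP; rewrite oner_eq0.
  have [xp|xp] := eqVneq (ev x p) 0.
    exists x; last exact: zleU.
    by right; split; [exact: XL'|exists p; rewrite // !inE eqxx].
  have {}xp : 0 < ev x p by rewrite lt_def xp X_nonneg.
  apply: (combine_in x xL xp yx) => z zL xwz.
  have xz : zle C x z by move=> q qC' xq; apply: xwz => //; [exact: inC|exact: xw].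
  have [hz|zX] := LX z zL; last by left; apply/esym; exact: Xanti.
  case: (adjw z (G_L z zL hz) (zle_trans wx xz)) => [E|]; last by right.
  by move: lL; rewrite -E zL.
move=> z z' zL' z'L' hz hz' zz'.
have zzAC : zle (A :|: C)%SET z z'.
  by apply: zleW zz'; apply: finset.setSU; exact: finset.subsetU1.
have zzp : ev z p = 0 -> ev z' p = 0 by apply: zz'; rewrite !inE eqxx.
have X_zero y : y \in L -> has_zero (p |: A)%SET y -> ~ has_zero A y -> y \in X /\ ev y p = 0.
  move=> yL [q qA yq] nh; split; first by case: (LX y yL).
  move: qA; rewrite !inE => /orP[/eqP qp|qA]; first by rewrite -qp.
  by case: nh; exists q.
case/L'E: zL' hz zz' zzAC zzp => [[zL zp]|[u [w [[uL wL up wp] _ /adjacentP adj ->]]]] hz zz' zzAC zzp.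
  have [hzA|nhzA] := pselect (has_zero A z).
    case/L'E: z'L' hz' zz' zzAC zzp => [[z'L z'p]|[u [w [[uL wL up wp] _ _ ->]]]] hz' zz' zzAC zzp.
      exact: L_anti.
    have zw : zle (A :|: C)%SET z w.
      move=> q qC' zq.
      exact: (combine_zero (L0 _ uL) (L0 _ wL) up wp qC' (zzAC q qC' zq)).2.
    by move: zp wp; rewrite (L_anti z w) // leNgt => /negP.
  have [zX zp0] := X_zero z zL hz nhzA.
  case/L'E: z'L' hz' zz' zzAC zzp => [[z'L z'p]|[u [w [[uL wL up wp] _ _ ->]]]] hz' zz' zzAC zzp.
    have [a [b [a0 _ E]]] := X_ray zX (L_C z' z'L) (subC _ _ zzAC) (L_nz z' z'L).
    have b0 : b = 0 by have := E p pT; rewrite zzp // zp0 mulr0 add0r.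
    apply: Xanti => //; last exact: subC.
    case: (LX z' z'L) => // -[q qA]; rewrite E ?AT // b0 addr0 => /eqP.
    by rewrite mulf_eq0 (gt_eqF a0) /= (gt_eqF (X_A0 z q zX nhzA qA)).
  have zu : zle C z u.
    move=> q qC' zq.
    exact: (combine_zero (L0 _ uL) (L0 _ wL) up wp (inC _ qC') (zzAC q (inC _ qC') zq)).1.
  have [a [b [a0 _ E]]] := X_ray zX (L_C u uL) zu (L_nz u uL).
  have b0 : 0 < b by move: up; rewrite E // zp0 mulr0 add0r.
  have uX : u \in X.
    case: (LX u uL) => // -[q qA]; rewrite E ?AT // => /eqP.
    by rewrite gt_eqF // ltr_wpDl // mulr_ge0 ?(ltW a0) ?X_A.
  by move: up; rewrite -(Xanti z u) // zp0 ltxx.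
have cp : ev (combine p u w) p = 0 by exact: combine_at.
have uwz z1 : zle (A :|: C)%SET z' z1 -> zle2 (A :|: C)%SET u w z1.
  move=> z'z1 q qC' uq wq; apply: z'z1 => //; apply: zzAC => //.
  by have [a [b [_ _ -> _]]] := combine_spec up wp; rewrite ev_lin uq wq !mulr0 addr0.
case/L'E: z'L' hz' zz' zzAC zzp uwz => [[z'L z'p]|[u' [w' [[u'L w'L up' wp'] _ _ ->]]]] hz' zz' zzAC zzp uwz.
  have z'p0 := zzp cp.
  case: (adj z' z'L (uwz z' (@zle_refl _ _ _ _))) => E.
    by move: up; rewrite -E z'p0 ltxx.
  by move: wp; rewrite -E z'p0 ltxx.
have czu : zle (A :|: C)%SET (combine p u' w') u'.
  by move=> q qC' /(combine_zero (L0 _ u'L) (L0 _ w'L) up' wp' qC')[].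
have czw : zle (A :|: C)%SET (combine p u' w') w'.
  by move=> q qC' /(combine_zero (L0 _ u'L) (L0 _ w'L) up' wp' qC')[].
case: (adj u' u'L (uwz _ czu)) => Eu; last by move: up' wp; rewrite Eu ltNge => /negP h /ltW.
case: (adj w' w'L (uwz _ czw)) => Ew; first by move: wp' up; rewrite Ew ltNge => /negP h /ltW.
by rewrite Eu Ew.
Qed.

End VertexStep.

(** * Vertices of a polytope *)

Section Polytope.
Context {R : realType} {n m : nat}.
Variable M : 'M[R]_(n, m) -> Prop.
Hypothesis M_lin : forall (a b : R) x y, M x -> M y -> M (a *: x + b *: y).
Implicit Types (x y z : 'M[R]_(n, m)).

Let P : set 'M[R]_(n, m) := [set w | proj_simplex w /\ M w].
Let total x := \sum_i \sum_j x i j.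

Definition nonneg_mx x := forall i j, 0 <= x i j.
Definition zero_sub x y := forall i j, x i j = 0 -> y i j = 0.

Lemma totalZ (a : R) x : total (a *: x) = a * total x.
Proof.
rewrite mulr_sumr; apply: eq_bigr => i _; rewrite mulr_sumr.
by apply: eq_bigr => j _; rewrite mxE.
Qed.

Lemma totalD x y : total (x + y) = total x + total y.
Proof.
rewrite -big_split; apply: eq_bigr => i _; rewrite -big_split.
by apply: eq_bigr => j _; rewrite mxE.
Qed.

Lemma total_gt0 x : nonneg_mx x -> x != 0 -> 0 < total x.
Proof.
move=> x0 nx; rewrite lt_def sumr_ge0 ?andbT; last by move=> i _; exact: sumr_ge0.
apply: contraNneq nx => E; apply/eqP/matrixP => i j; rewrite mxE.
have s0 k : true -> 0 <= \sum_j x k j by move=> _; exact: sumr_ge0.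
have x0' k : true -> 0 <= x i k by move=> _; exact: x0.
exact: (@psumr_eq0P _ _ _ _ x0' (@psumr_eq0P _ _ _ _ s0 E i isT) j isT).
Qed.

Lemma total_neq0 x : total x != 0 -> x != 0.
Proof.
apply: contraNneq => ->; rewrite /total big1 // => i _.
by rewrite big1 // => j _; rewrite mxE.
Qed.

Lemma reduce_mx x y : nonneg_mx x -> nonneg_mx y -> zero_sub x y -> y != 0 ->
  exists a, [/\ 0 < a, nonneg_mx (x - a *: y), zero_sub x (x - a *: y) &
    exists p, ev x p != 0 /\ ev (x - a *: y) p = 0].
Proof.
move=> x0 y0 xy ny.
have [p0 np0] : exists p0 : 'I_n * 'I_m, ev y p0 != 0.
  apply: contrapT => h; move: ny; apply/negP; rewrite negbK; apply/eqP/matrixP => i j.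
  by rewrite mxE; apply/eqP; apply: contra_notT h => h; exists (i, j).
have [||||a [a0 h [p _ [xp E]]]] :=
    @reduce_fun R _ [set: 'I_n * 'I_m]%SET (fun p => ev x p) (fun p => ev y p).
- by move=> p _; exact: x0.
- by move=> p _; exact: y0.
- by move=> p _; exact: xy.
- by exists p0; rewrite ?inE.
have evB q : ev (x - a *: y) q = ev x q - a * ev y q by rewrite !mxE.
exists a; split=> //.
- by move=> i j; have := h (i, j); rewrite -evB inE; apply.
- by move=> i j xij; rewrite (evB (i, j)) xij (xy i j) // mulr0 subrr.
- by exists p; rewrite evB.
Qed.

(** A vertex is not inside a segment of the polytope, so a small multiple of y cannot be
    removed from x unless y is proportional to x. *)
Lemma polytope_vertex_support x y : polytope_vertices P x -> nonneg_mx y -> M y ->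
  y != 0 -> zero_sub x y -> y = total y *: x.
Proof.
move=> [[[x0 x1] Mx] ext] y0 My ny xy.
have ty := total_gt0 y0 ny.
have [a [a0 h _ _]] := reduce_mx x0 y0 xy ny.
pose t := Num.min (1/2) (a * total y).
have t0 : 0 < t by rewrite lt_min (mulr_gt0 a0 ty) andbT; lra.
have t2 : t <= 1/2 by rewrite ge_min lexx.
have ta : t <= a * total y by rewrite ge_min lexx orbT.
have t1 : 0 < 1 - t by lra.
pose y1 := (total y)^-1 *: y.
pose z := (1 - t)^-1 *: (x - t *: y1).
have y1_ge0 : nonneg_mx y1 by move=> i j; rewrite mxE mulr_ge0 // invr_ge0 ltW.
have Py : P y1.
  split; last by have := M_lin (total y)^-1 0 My My; rewrite scale0r addr0.
  by split=> //; rewrite -/(total y1) totalZ mulVf // gt_eqF.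
have Pz : P z.
  have zE : x - t *: y1 = 1 *: x + (- t * (total y)^-1) *: y.
    by rewrite scale1r /y1 scalerA -scaleNr mulNr.
  split; last first.
    have := M_lin (1 - t)^-1 0 (M_lin 1 (- t * (total y)^-1) Mx My) Mx.
    by rewrite scale0r addr0 -zE.
  split.
    move=> i j; rewrite /z mxE mulr_ge0 ?invr_ge0 ?(ltW t1) //.
    have := h i j; rewrite !mxE => hij.
    have : t * ((total y)^-1 * y i j) <= a * y i j.
      by rewrite mulrA ler_wpM2r // ler_pdivrMr.
    lra.
  rewrite -/(total z) totalZ zE totalD !totalZ divfK ?gt_eqF //.
  by rewrite [total x]x1 mul1r mulVf // gt_eqF.
have xE : x = t *: y1 + (1 - t) *: z.
  have -> : (1 - t) *: z = x - t *: y1 by rewrite scalerA mulfV ?gt_eqF // scale1r.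
  by rewrite addrC subrK.
have E := ext _ _ _ Py Pz _ xE.
have y1x : x = y1.
  rewrite {1}xE -E; last by apply/andP; split => //; lra.
  by rewrite -scalerDl addrC subrK scale1r.
by rewrite y1x /y1 scalerA mulfV ?gt_eqF // scale1r.
Qed.

Lemma polytope_vertex_intro x : nonneg_mx x -> M x -> x != 0 ->
  (forall y, nonneg_mx y -> M y -> y != 0 -> zero_sub x y -> exists a, y = a *: x) ->
  polytope_vertices P ((total x)^-1 *: x).
Proof.
move=> x0 Mx nx ext; have tx := total_gt0 x0 nx.
split.
  split; last by have := M_lin (total x)^-1 0 Mx Mx; rewrite scale0r addr0.
  split=> [i j|]; first by rewrite mxE mulr_ge0 // invr_ge0 ltW.
  by rewrite -/(total _) totalZ mulVf // gt_eqF.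
move=> y z t Py Pz /andP[t0 t1] xE.
have key w : P w -> zero_sub x w -> w = (total x)^-1 *: x.
  move=> [[w0 w1] Mw] xw; have [|a wE] := ext w w0 Mw _ xw.
    by apply: total_neq0; rewrite /total w1 oner_eq0.
  have : total w = 1 by [].
  rewrite wE totalZ => aE; congr (_ *: _).
  by apply: (mulIf (lt0r_neq0 tx)); rewrite aE mulVf // gt_eqF.
have [[[y0 _] _] [[z0 _] _]] := (Py, Pz).
have both i j : x i j = 0 -> y i j = 0 /\ z i j = 0.
  move=> xij; have := congr1 (fun w => fun_of_matrix w i j) xE; rewrite !mxE xij mulr0.
  have := mulr_ge0 (ltW t0) (y0 i j); have t1' : 0 < 1 - t by lra.
  have := mulr_ge0 (ltW t1') (z0 i j) => h1 h2 h3.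
  have /eqP : t * y i j = 0 by lra.
  have /eqP : (1 - t) * z i j = 0 by lra.
  by rewrite !mulf_eq0 (gt_eqF t0) (gt_eqF t1') /= => /eqP -> /eqP ->.
transitivity ((total x)^-1 *: x); first by apply: (key y Py) => i j /both[].
by apply/esym/(key z Pz) => i j /both[].
Qed.

(** A vector whose support is minimal is proportional to a vertex; otherwise some
    multiple of another vector can be removed, with more zeros as a result. *)
Lemma polytope_vertex_below y : nonneg_mx y -> M y -> y != 0 ->
  exists2 x, polytope_vertices P x & zero_sub y x.
Proof.
pose supp x := #|[set p : 'I_n * 'I_m | ev x p != 0]%SET|.
have [k] := ubnP (supp y); elim: k y => // k IH y; rewrite ltnS => yk y0 My ny.
have [ext|] := pselect (forall z, nonneg_mx z -> M z -> z != 0 -> zero_sub y z -> exists a, z = a *: y).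
  exists ((total y)^-1 *: y); first exact: polytope_vertex_intro.
  by move=> i j yij; rewrite mxE yij mulr0.
move=> next; have [z [z0 Mz nz yz nE]] : exists z, [/\ nonneg_mx z, M z, z != 0, zero_sub y z &
    ~ exists a, z = a *: y].
  apply: contrapT => h; apply: next => z z0 Mz nz yz; apply: contrapT => nE.
  by apply: h; exists z.
have [a [a0 h yyz [p [yp yzp]]]] := reduce_mx y0 z0 yz nz.
have [||||x vx hx] := IH (y - a *: z).
- apply: leq_trans yk; apply: proper_card; apply/properP; split.
    apply/fintype.subsetP => q; rewrite !inE => hq; apply: contraNneq hq => yq.
    by rewrite (yyz q.1 q.2).
  by exists p; rewrite !inE ?yp // yzp eqxx.
- exact: h.
- by have := M_lin 1 (- a) My Mz; rewrite scale1r scaleNr.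
- apply/eqP => E; apply: nE; exists a^-1.
  by rewrite -[y](subrK (a *: z)) E add0r scalerA mulVf ?scale1r // gt_eqF.
by exists x => // i j /yyz; exact: hx.
Qed.

End Polytope.

(** * The conversion algorithm *)

Section Conversion.
Context {R : realType} {n : nat} (T : gluing n).
Implicit Types (u w x y z : stdvec R n) (p q : position n) (A C : {set position n}).
Implicit Types (L : {fset stdvec R n}) (V : {set corner n}).

Lemma partial_canonicalP V x : V \in vertices T ->
  nonneg_on (link_positions R V) (partial_canonical V x) /\
  has_zero (link_positions R V) (partial_canonical V x).
Proof.
move=> hV; set l := largest (link_scalars V x).
have ev_pc c : c \in V -> (x - l *: vlink R V) c.1 (tri c.2) = x c.1 (tri c.2) - l.
  by move=> cV; rewrite entry_sub vlink_tri -surjective_pairing cV mulr1.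
have [c0 c0V] : exists c, c \in V by move: hV => /imsetP[c _ ->]; exists c; rewrite inE connect0.
case: (@arg_minP _ _ _ c0 (fun c => c \in V) (fun c => x c.1 (tri c.2)) c0V) => c cV cmin.
have scal (k : R) : link_scalars V x k <-> k <= x c.1 (tri c.2).
  split=> [h|h d dV].
    by have := h c cV; rewrite entry_sub vlink_tri -surjective_pairing cV mulr1 subr_ge0.
  rewrite entry_sub vlink_tri -surjective_pairing dV mulr1 subr_ge0.
  exact: le_trans h (cmin d dV).
have lE : l = x c.1 (tri c.2).
  have [k1 k2] : (link_scalars V x `&` ubound (link_scalars V x)) l.
    apply: (xgetPex 0); exists (x c.1 (tri c.2)); split; first exact/scal.
    by move=> k /scal.
  by apply/le_anti; rewrite (iffLR (scal _) k1) k2 //; exact/scal.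
split=> [p /link_positionsP[d dV ->]|].
  by rewrite /= ev_pc // lE subr_ge0; exact: cmin.
exists (c.1, tri c.2); first by apply/link_positionsP; exists c.
by rewrite /= ev_pc // lE subrr.
Qed.

Lemma foldl_position_step V C (X : {fset stdvec R n}) ps A L :
  V \in vertices T -> quad_positions n \subset C ->
  (forall q, q \in C -> q \notin link_positions R V) ->
  ray_basis T (fun z => z \in X) C ->
  (forall x, x \in X -> nonneg_on (link_positions R V) x) ->
  loop_invariant T V C X A L -> A \subset link_positions R V -> A != finset.set0 ->
  {subset ps <= link_positions R V} ->
  exists L', foldl (@position_step R n) (L, (A :|: C)%SET) ps =
      (L', ((A :|: [set p in ps]) :|: C)%SET) /\
    loop_invariant T V C X (A :|: [set p in ps])%SET L'.
Proof.
move=> hV qC CT bX X0; elim: ps A L => [|p ps IH] A L inv AT A0 psT /=.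
  have -> : (A :|: [set p in [::]])%SET = A by apply/setP => q; rewrite !inE orbF.
  by exists L.
have pT : p \in link_positions R V by apply: psT; rewrite inE eqxx.
have inv' := loop_step hV qC CT bX X0 inv AT A0 pT.
have -> : (A :|: [set q in p :: ps])%SET = ((p |: A) :|: [set q in ps])%SET.
  by apply/setP => q; rewrite !inE; case: (q == p); case: (q \in A).
have [|||L' [E inv'']] := IH _ _ inv'.
- apply/fintype.subsetP => q; rewrite finset.in_setU1 => /orP[/eqP -> //|].
  exact: (fintype.subsetP AT).
- by apply/finset.set0Pn; exists p; rewrite !inE eqxx.
- by move=> q qps; apply: psT; rewrite inE qps orbT.
by exists L'; split=> //; rewrite -E /= finset.setUA.
Qed.

(** After the loop every partial canonical part has a zero among the processed
    positions, so the list together with the link is a ray basis. *)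
Lemma vertex_step_basis (order : {set corner n} -> seq (position n)) V L C :
  V \in vertices T -> perm_eq (order V) (enum (link_positions R V)) ->
  quad_positions n \subset C -> (forall q, q \in C -> q \notin link_positions R V) ->
  ray_basis T (fun z => z \in L) C ->
  exists L', vertex_step order (L, C) V = (L', (link_positions R V :|: C)%SET) /\
    ray_basis T (fun z => z \in L') (link_positions R V :|: C)%SET.
Proof.
move=> hV horder qC CT bL; have [Lf Lcov Lanti] := bL.
set X := [fset partial_canonical V x | x in L]%fset.
set TV := link_positions R V in horder CT *.
have XE z : z \in X -> exists2 x, x \in L & z = partial_canonical V x.
  by move=> /imfsetP[x xL ->]; exists x.
have pcC x q : q \in C -> ev (partial_canonical V x) q = ev x q.
  move=> qC'; rewrite /partial_canonical entry_sub.
  by rewrite vlinkE (negbTE (CT q qC')) mulr0 subr0.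
have X0 x : x \in X -> nonneg_on TV x.
  by move=> /XE[y yL ->]; have [] := partial_canonicalP y hV.
have Xz x : x \in X -> has_zero TV x.
  by move=> /XE[y yL ->]; have [] := partial_canonicalP y hV.
have pczle x y : zle C (partial_canonical V x) (partial_canonical V y) -> zle C x y.
  by move=> h q qC' xq; rewrite -pcC // h // pcC.
have bX : ray_basis T (fun z => z \in X) C.
  split.
  - move=> z /XE[x xL ->]; have [[mx x0 qx] [q qC' xq]] := Lf x xL.
    split; last by exists q => //; rewrite pcC.
    split.
    + by apply: std_matching_sub => //; exact: (vlink_matching hV).
    + by move=> q' q'C; rewrite pcC // x0.
    + by apply: (quad_constraints_zle qC _ qx) => q' q'C; rewrite pcC.
  - move=> y fy ny; have [x xL yx] := Lcov y fy ny.
    exists (partial_canonical V x); first by apply/imfsetP; exists x.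
    by move=> q qC' yq; rewrite pcC // yx.
  move=> z z' /XE[x xL ->] /XE[x' x'L ->] h.
  by rewrite (Lanti x x') //; exact: pczle.
case oE : (order V) => [|p ps].
  have /finset.set0Pn[q] := @link_positions_neq0 R n T V hV.
  by rewrite -mem_enum -(perm_mem horder) oE.
have memo q : (q \in p :: ps) = (q \in TV) by rewrite -oE (perm_mem horder) mem_enum.
have pT : p \in TV by rewrite -memo inE eqxx.
have start := loop_start hV qC CT bX X0 pT.
have [|||L' [foldE inv]] := foldl_position_step (ps := ps) hV qC CT bX X0 start.
- by apply/fintype.subsetP => q /set1P ->.
- by apply/finset.set0Pn; exists p; rewrite inE.
- by move=> q qps; rewrite -/TV -memo inE qps orbT.
have TE : ([set p] :|: [set q in ps])%SET = TV.
  by apply/setP => q; rewrite -memo !inE.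
rewrite TE in foldE inv.
exists (L' `|` [fset vlink R V])%fset; split.
  by rewrite /vertex_step -/X oE /=; move: foldE => /= ->.
have [[Gf Gcov Ganti] Lf' _ LX] := inv.
have GE z : z \in (L' `|` [fset vlink R V])%fset <-> bounded_rays V TV L' z.
  rewrite !inE; split.
    move=> /orP[zL|/eqP ->]; last by left.
    by right; split=> //; case: (LX z zL) => //; exact: Xz.
  by move=> [->|[-> //]]; rewrite eqxx orbT.
split.
- by move=> z /GE; exact: Gf.
- by move=> y fy ny; have [z Gz yz] := Gcov y fy ny; exists z => //; apply/GE.
- by move=> z z' /GE Gz /GE Gz'; exact: Ganti.
Qed.

Lemma link_disjoint V V' q : V \in vertices T -> V' \in vertices T -> V != V' ->
  q \in link_positions R V -> q \notin link_positions R V'.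
Proof.
move=> hV hV' VV' /link_positionsP[c cV ->]; apply: contra VV'.
move=> /link_positionsP[d dV' E].
have dc : d = c.
  apply/esym/injective_projections; first exact: (congr1 fst E).
  exact: (lshift_inj (congr1 snd E)).
rewrite dc in dV'; apply/eqP/setP => e.
by rewrite (vertex_connect hV _ cV) (vertex_connect hV' _ dV').
Qed.

Lemma foldl_vertex_step (order : {set corner n} -> seq (position n)) vs L C :
  uniq vs -> {subset vs <= vertices T} ->
  (forall V, V \in vs -> perm_eq (order V) (enum (link_positions R V))) ->
  quad_positions n \subset C ->
  (forall V q, V \in vs -> q \in C -> q \notin link_positions R V) ->
  ray_basis T (fun z => z \in L) C ->
  exists L' C', [/\ foldl (vertex_step order) (L, C) vs = (L', C'),
    ray_basis T (fun z => z \in L') C', C \subset C' &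
    forall V, V \in vs -> link_positions R V \subset C'].
Proof.
elim: vs L C => [|V vs IH] L C.
  by move=> _ _ _ qC _ bL; exists L, C; split.
rewrite cons_uniq => /andP[Vvs uvs] vsT horder qC CT bL.
rewrite -[foldl _ _ _]/(foldl (vertex_step order) (vertex_step order (L, C) V) vs).
have hV : V \in vertices T by apply: vsT; rewrite inE eqxx.
have [||L1 [-> bL1]] := vertex_step_basis hV (horder V _) qC _ bL.
- by rewrite inE eqxx.
- by move=> q; apply: CT; rewrite inE eqxx.
have [||||L' [C' [-> bL' CC' sub]]] := IH L1 (link_positions R V :|: C)%SET uvs _ _ _ _ bL1.
- by move=> W Wvs; apply: vsT; rewrite inE Wvs orbT.
- by move=> W Wvs; apply: horder; rewrite inE Wvs orbT.
- by apply: fintype.subset_trans qC _; exact: finset.subsetUr.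
- move=> W q Wvs; rewrite inE => /orP[|qC']; last by apply: CT; rewrite ?inE ?Wvs ?orbT.
  apply: link_disjoint => //; first by apply: vsT; rewrite inE Wvs orbT.
  by apply: contraNneq Vvs => ->.
move: CC'; rewrite finset.subUset => /andP[VC' CC'].
exists L', C'; split=> // W; rewrite inE => /orP[/eqP -> //|]; exact: sub.
Qed.

(** Forgetting triangles identifies the feasible vectors, modulo links, with the
    admissible vectors of the quadrilateral matching equations; the support-minimal
    ones are the multiples of vertices. *)
Lemma initial_basis (qs : {fset quadvec R n}) : compact_3manifold R (realization R T) ->
  [set` qs] = quad_solution_set T ->
  ray_basis T (fun z => z \in [fset canonical_ext T q | q in qs]%fset) (quad_positions n).
Proof.
move=> hT hqs.
have qM : forall (a b : R) (x y : quadvec R n), quad_matching T x -> quad_matching T y ->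
    quad_matching T (a *: x + b *: y).
  move=> a b x y hx hy c ec; have := hx c ec; have := hy c ec => E1 E2.
  transitivity (a * (\sum_(F <- c) x F.1 (upward F)) + b * (\sum_(F <- c) y F.1 (upward F))).
    by rewrite !mulr_sumr -big_split; apply: eq_bigr => F _; rewrite !mxE.
  rewrite E1 E2 !mulr_sumr -big_split; apply: eq_bigr => F _; rewrite !mxE //.
have qsP (q : quadvec R n) : q \in qs <-> quad_solution_set T q by rewrite -hqs.
have quadP i k : (i, quad k) \in quad_positions n by apply/quad_positionsP; exists i, k.
have spec (q : quadvec R n) : q \in qs -> [/\ std_matching T (canonical_ext T q),
    qproj (canonical_ext T q) = q & nonneg_mx q].
  move=> /qsP[[[[q0 _] qm] _] qc].
  by have [] := canonical_ext_spec hT qm q0 qc.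
have extE (q : quadvec R n) i k : q \in qs -> ev (canonical_ext T q) (i, quad k) = q i k.
  by move=> /spec[_ qE _]; rewrite -[in RHS]qE qprojE.
split.
- move=> z /imfsetP[q /= qqs ->]; have [mq qE q0] := spec q qqs.
  have /qsP[[[[_ q1] _] _] qc] := qqs; split.
    split=> //; last by rewrite qE.
    by move=> p /quad_positionsP[i [k ->]]; rewrite extE.
  apply: contrapT => h; move/eqP: (oner_neq0 R); apply; rewrite -[LHS]q1 big1 // => i _.
  by rewrite big1 // => k _; rewrite -(extE q i k qqs); exact: (not_nonzero_on h (quadP i k)).
- move=> y [my y0 qy] ny.
  have q0 : nonneg_mx (qproj y) by move=> i k; rewrite qprojE; exact: (y0 (i, quad k)).
  have nq : qproj y != 0.
    case: ny => p /quad_positionsP[i [k ->]]; apply: contraNneq => E.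
    by rewrite /= -qprojE E mxE.
  have [q vq yq] := polytope_vertex_below qM q0 (std_matching_quad my) nq.
  have qqs : q \in qs.
    apply/qsP; split=> // i; apply: leq_trans (qy i); apply: subset_leq_card.
    apply/fintype.subsetP => k; rewrite !inE; apply: contraNneq => /yq ->; exact: eqxx.
  exists (canonical_ext T q); first by apply/imfsetP; exists q.
  move=> p /quad_positionsP[i [k ->]] yp; rewrite extE //; apply: yq.
  by rewrite qprojE.
move=> z z' /imfsetP[q /= qqs ->] /imfsetP[q' /= q'qs ->] h.
have [_ _ q0] := spec q qqs; have [_ _ q'0] := spec q' q'qs.
have /qsP[vq _] := qqs; have /qsP[[[[_ q'1] q'm] _] _] := q'qs.
congr canonical_ext.
have nq' : q' != 0.
  by apply: total_neq0; rewrite q'1 oner_eq0.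
have qq' : zero_sub q q'.
  by move=> i k qik; rewrite -extE //; apply: h => //; rewrite extE.
have := polytope_vertex_support qM vq q'0 q'm nq' qq'.
by rewrite q'1 scale1r => ->.
Qed.

(** When C consists of all positions, the members of a ray basis are the
    admissible vectors of minimal support, that is, the multiples of admissible
    vertices. *)
Lemma solution_set_of_basis L : ray_basis T (fun z => z \in L) [set: position n]%SET ->
  std_solution_set T = @projective_image R n @` [set` L] /\
  {in L &, injective (@projective_image R n)}.
Proof.
move=> bL; have [Lf Lcov Lanti] := bL.
have sM : forall (a b : R) x y, std_matching T x -> std_matching T y ->
    std_matching T (a *: x + b *: y) by move=> *; exact: std_matching_lin.
have qT : quad_positions n \subset [set: position n]%SET by exact: finset.subsetT.
have inT p : p \in [set: position n]%SET by rewrite inE.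
have nz x : nonzero_on [set: position n]%SET x <-> x != 0.
  split=> [[p _]|x0]; first by apply: contraNneq => ->; rewrite mxE.
  apply: contrapT => h; move/eqP: x0; apply; apply/matrixP => i j; rewrite mxE.
  exact: (not_nonzero_on h (inT (i, j))).
have nn x : nonneg_on [set: position n]%SET x <-> nonneg_mx x.
  by split=> [h i j|h p _]; [exact: (h (i, j))|exact: h].
have zz x y : zle [set: position n]%SET x y <-> zero_sub x y.
  by split=> [h i j|h p _]; [exact: (h (i, j))|exact: h].
have tot z : z \in L -> 0 < \sum_i \sum_j z i j.
  by move=> /Lf[[_ /nn z0 _] /nz]; exact: total_gt0.
have qcZ (a : R) z : quad_constraints (qproj z) -> quad_constraints (qproj (a *: z)).
  by apply: (quad_constraints_zle qT) => p _ zp; rewrite mxE zp mulr0.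
split.
  apply/seteqP; split=> [x [vx qx]|_ [z /= zL <-]].
    have [[[x0 x1] mx] _] := vx.
    have nx : x != 0 by apply: total_neq0; rewrite x1 oner_eq0.
    have fx : feasible T [set: position n]%SET x by split=> //; exact/nn.
    have [z zL /zz xz] := Lcov x fx (iffRL (nz x) nx).
    have [[mz /nn z0 _] /nz nz'] := Lf z zL.
    exists z => //; rewrite /projective_image.
    rewrite [in X in _ *: X](polytope_vertex_support sM vx z0 mz nz' xz).
    by rewrite scalerA mulVf ?scale1r // gt_eqF // tot.
  have [fz nz'] := Lf z zL; have [mz /nn z0 qz] := fz; split; last exact: qcZ.
  apply: (polytope_vertex_intro sM) => //; first exact/nz.
  move=> y y0 my ny zy.
  have fy : feasible T [set: position n]%SET y.
    split; [exact: my|exact/nn|].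
    by apply: (quad_constraints_zle qT _ qz); exact/zz.
  have [a [_ E]] := basis_ray qT bL zL fy (iffRL (zz _ _) zy) (iffRL (nz y) ny).
  by exists a; apply/matrixP => i j; rewrite mxE; exact: (E (i, j)).
move=> z z' zL z'L E; apply: Lanti => //; apply/zz => i j zij.
have := congr1 (fun w : stdvec R n => w i j) E; rewrite /projective_image !mxE zij mulr0.
move=> /esym/eqP; rewrite mulf_eq0 invr_eq0 gt_eqF /=; last exact: tot.
by move/eqP.
Qed.

End Conversion.

Theorem mainTheorem2 (R : realType) (n : nat) (T : gluing n)
    (hT : compact_3manifold R (realization R T))
    (vs : seq {set corner n}) (hvs : perm_eq vs (enum (vertices T)))
    (order : {set corner n} -> seq (position n))
    (horder : forall V, V \in vs ->
      perm_eq (order V) (enum (link_positions R V)))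
    (qs : {fset quadvec R n})
    (hqs : [set` qs] = quad_solution_set T) :
  let L := convert T vs order qs in
  std_solution_set T = @projective_image R n @` [set` L] /\
  {in L &, injective (@projective_image R n)}.
Proof.
have memvs V : (V \in vs) = (V \in vertices T) by rewrite (perm_mem hvs) mem_enum.
have [||||L' [C' [E bL qC' sub]]] := @foldl_vertex_step R n T order vs _ (quad_positions n)
  _ _ horder _ _ (initial_basis hT hqs).
- by rewrite (perm_uniq hvs) enum_uniq.
- by move=> V; rewrite memvs.
- exact: fintype.subxx.
- move=> V q _ /quad_positionsP[i [k ->]]; rewrite inE negbK /=.
  by rewrite vlink_quad.
rewrite /convert E /=; apply: solution_set_of_basis.
suff <- : C' = [set: position n]%SET by [].
apply/setP => -[i j]; rewrite finset.in_setT.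
case: (std_index j) => [[a ->]|[k ->]]; last first.
  by apply: (fintype.subsetP qC'); apply/quad_positionsP; exists i, k.
have hV : [set d | connect (corner_adj T) (i, a) d]%SET \in vs.
  by rewrite memvs; apply/imsetP; exists (i, a).
apply: (fintype.subsetP (sub _ hV)); apply/link_positionsP.
by exists (i, a); rewrite // inE connect0.
Qed.
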